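(* Let $V_0\in L^2(\mathbb{T}^d;\mathbb{R}^d)$ be a divergence-free vector field of zero spatial mean, and let $F,\bar V\in L^2(0,T;L^2(\mathbb{T}^d;\mathbb{R}^d))$. Then the sup-inf problem $$\mathcal{J}_E[\bar V](V_0)=\sup_{(\lambda,\gamma)\in\mathcal{R}}\ \inf_{V}\Bigg(\int_0^T\!\!\int_{\mathbb{T}^d}\tfrac12 V^iV^j(\partial_j\lambda_i+\partial_i\lambda_j+a_V\delta_{ij})+V^i\big(\partial_t\lambda_i+\partial_i\gamma-a_V\bar V^i\big)\,dx\,dt$$ $$\qquad\qquad+\int_0^T\!\!\int_{\mathbb{T}^d}\Big(\tfrac12 a_V\bar V^i\bar V^i+F^i\lambda_i+\tfrac1T\lambda_i(0,x)V_0^i(x)\Big)\,dx\,dt\Bigg),$$ where the infimum is over $V\in L^2(0,T;L^2(\mathbb{T}^d;\mathbb{R}^d))$, always admits a solution $(\lambda,\gamma)\in\mathcal{R}$; that is, the supremum over $\mathcal{R}$ is attained.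
   Context: Here $d\in\{2,3\}$, $\mathbb{T}^d=\mathbb{R}^d/\mathbb{Z}^d$, $T>0$ and $a_V>0$ are fixed, and repeated indices are summed from $1$ to $d$. $\partial_i$ is the derivative in $x_i$; $\mathrm{div}$ and $\nabla$ are taken in the space variable. $X_T(Y)$ abbreviates $X(0,T;Y(\mathbb{T}^d))$. For a vector field $\lambda$, $\nabla^{sym}\lambda=\frac12(\nabla\lambda+(\nabla\lambda)^T)$. The class of dual variables is $$\mathcal{R}=\Big\{(\lambda,\gamma):\ \lambda\in H^1_T(L^2)\ (\mathbb{R}^d\text{-valued}),\ \nabla^{sym}\lambda\in L^\infty_T(L^\infty),\ \mathrm{div}\,\lambda=0,\ \lambda(T,x)=0\text{ for a.e. }x\in\mathbb{T}^d,\ \gamma\in L^2_T(H^1)\ (\text{scalar}),\ \int_{\mathbb{T}^d}\gamma(t,x)\,dx=0\text{ for a.e. }t\in[0,T]\Big\}.$$ The inner infimum takes values in $[-\infty,\infty)$. The field $\bar V$ is called the base state; it is not required to be divergence free. *)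

(* Defs.v *)
From HB Require Import structures.
From mathcomp Require Import all_boot all_order all_algebra.
From mathcomp Require Import all_classical all_reals all_analysis.

Set Implicit Arguments.
Unset Strict Implicit.
Unset Printing Implicit Defensive.
Import Order.TTheory GRing.Theory Num.Theory.
Import numFieldNormedType.Exports.

Local Open Scope classical_set_scope.
Local Open Scope ring_scope.

Definition rV_display : measure_display.
Proof. exact: default_measure_display. Qed.

Section measurable_rV.
Context (R : realType) (n : nat).

Let coords : 'I_n -> 'rV[R]_n -> R := fun i x => x 0 i.

Let rV_set0 : g_sigma_preimage coords set0.
Proof. exact: sigma_algebra0. Qed.

Let rV_setC A : g_sigma_preimage coords A -> g_sigma_preimage coords (~` A).
Proof. exact: sigma_algebraC. Qed.

Let rV_bigcup (F : _^nat) : (forall i, g_sigma_preimage coords (F i)) ->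
  g_sigma_preimage coords (\bigcup_i (F i)).
Proof. exact: sigma_algebra_bigcup. Qed.

HB.instance Definition _ := @isMeasurable.Build rV_display
  'rV[R]_n (g_sigma_preimage coords) rV_set0 rV_setC rV_bigcup.

End measurable_rV.

Lemma measurable_fun_rVP d (X : measurableType d) (R : realType) n
    (f : X -> 'rV[R]_n) :
  (forall i, measurable_fun setT (fun x => f x 0 i)) -> measurable_fun setT f.
Proof.
move=> mf; suff h : preimage_set_system setT f measurable `<=` measurable.
  by move=> _ A mA; apply: h; exists A.
rewrite -(g_sigma_preimage_comp (fun i (x : 'rV[R]_n) => x 0 i) f).
apply: smallest_sub; first exact: sigma_algebra_measurable.
case: n => [|n] in f mf *; first by rewrite big_ord0.
rewrite -bigcup_mkord_ord; apply: bigcup_sub => i Ii.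
by move=> A [B mB <-]; exact: mf.
Qed.

Lemma measurable_coord (R : realType) n (i : 'I_n) :
  measurable_fun setT (fun x : 'rV[R]_n => x 0 i).
Proof.
move=> _ Y mY; rewrite setTI; apply: sub_sigma_algebra => /=.
rewrite -bigcup_seq/=; exists i => /=; first by rewrite mem_index_enum.
by exists Y => //; rewrite setTI.
Qed.

Definition rV_cons (R : realType) n (z : measurableTypeR R * 'rV[R]_n) : 'rV[R]_n.+1 :=
  \row_i oapp (fun j => z.2 0 j) z.1 (unlift ord0 i).

Lemma measurable_rV_cons (R : realType) n :
  measurable_fun setT (@rV_cons R n).
Proof.
apply: measurable_fun_rVP => i.
under eq_fun do rewrite mxE.
case: unliftP => [j _|_] /=; last exact: measurable_fst.
exact: measurableT_comp (measurable_coord j) measurable_snd.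
Qed.

HB.instance Definition _ (R : realType) n :=
  isMeasurableFun.Build _ _ _ _ (@rV_cons R n) (@measurable_rV_cons R n).

(* Functions on the torus R^d/Z^d are represented by functions on R^d of which
   only the values on the fundamental domain [0,1]^d matter; the Haar measure of
   the torus is the d-fold product of the uniform law on [0,1]. *)
Fixpoint torus (R : realType) (n : nat) : probability 'rV[R]_n R :=
  match n with
  | 0 => \d_(0 : 'rV[R]_0)
  | m.+1 => distribution
      (uniform_prob (@ltr01 R) \x torus R m)%E (@rV_cons R m)
  end.

Section time.
Context (R : realType) (T : R).

Lemma lebesgue_itv0_lty : (lebesgue_measure (`[0%R, T] : set R) < +oo)%E.
Proof. by rewrite lebesgue_measure_itv/=; case: ifP; rewrite ?ltry. Qed.

(* Lebesgue measure on [0,T] *)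
Definition time_measure : set (measurableTypeR R) -> \bar R :=
  @mfrestr _ (measurableTypeR R) R _ lebesgue_measure
    (measurable_itv `[0, T]) lebesgue_itv0_lty.
HB.instance Definition _ := FiniteMeasure.on time_measure.

End time.

(* Time-space points (t, x); measurableTypeR R is R with its Borel sets. *)
Notation spacetime R d := (measurableTypeR R * 'rV[R]_d)%type.

Section spaces.
Context (R : realType) (d : nat).

Local Notation spacetime := (spacetime R d).

Implicit Types (T : R) (u g : spacetime -> R) (lam : spacetime -> 'rV[R]_d).

Definition cylinder T : {measure set spacetime -> \bar R} :=
  (time_measure T \x torus R d)%E.

(* L^2(0,T;L^2(T^d)) and L^oo(0,T;L^oo(T^d)), as L^2 and L^oo of ]0,T[ x T^d *)
Definition L2 T : set (spacetime -> R) := [set u | u \in Lfun (cylinder T) 2%:E].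
Definition Loo T : set (spacetime -> R) := [set u | u \in Lfun (cylinder T) +oo%E].

Definition component (A : Type) (V : A -> 'rV[R]_d) (i : 'I_d) : A -> R :=
  fun z => V z 0 i.

Definition vL2 T : set (spacetime -> 'rV[R]_d) :=
  [set V | forall i, L2 T (component V i)].

(* C^oo: all iterated directional derivatives exist and are Frechet
   differentiable (hence continuous). *)
Definition smooth (U : normedModType R) (phi : U -> R) :=
  forall (vs : seq U) (x : U),
    differentiable (foldr (fun v f => 'D_v f : U -> R) phi vs) x.

Definition unitv (i : 'I_d) : 'rV[R]_d := delta_mx 0 i.
Definition dirt : spacetime := (1, 0).
Definition dirx (i : 'I_d) : spacetime := (0, unitv i).

Definition torus_test (psi : 'rV[R]_d -> R) :=
  smooth psi /\ forall i x, psi (x + unitv i) = psi x.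

(* C_c^oo(]0,T[ x T^d) *)
Definition cyl_test T (phi : spacetime -> R) :=
  [/\ smooth phi,
      forall i z, phi (z + dirx i) = phi z &
      exists a b : R, [/\ 0 < a, b < T &
        forall t x, ~~ (a <= t <= b) -> phi (t, x) = 0]].

(* g is the distributional derivative of u in the direction v *)
Definition is_wderiv T (v : spacetime) u g := forall phi, cyl_test T phi ->
  \int[cylinder T]_z (u z * 'D_v phi z) = - \int[cylinder T]_z (g z * phi z).

(* s is the (i, j) entry of the distributional symmetric gradient of lam; the
   partial derivatives of lam need not be functions individually. *)
Definition is_wsymgrad T lam (i j : 'I_d) (s : spacetime -> R) :=
  forall phi, cyl_test T phi ->
  \int[cylinder T]_z
    (2^-1 * (lam z 0 i * 'D_(dirx j) phi z + lam z 0 j * 'D_(dirx i) phi z)) =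
  - \int[cylinder T]_z (s z * phi z).

Definition div_free T lam := forall phi, cyl_test T phi ->
  \int[cylinder T]_z (\sum_i lam z 0 i * 'D_(dirx i) phi z) = 0.

Definition torus_div_free (V0 : 'rV[R]_d -> 'rV[R]_d) :=
  forall psi, torus_test psi ->
  \int[torus R d]_x (\sum_i V0 x 0 i * 'D_(unitv i) psi x) = 0.

(* The weak derivatives as functions, unique up to a.e. equality. *)
Definition wderiv T (v : spacetime) u : spacetime -> R :=
  xget (cst 0) [set g | L2 T g /\ is_wderiv T v u g].

Definition wsymgrad T lam (i j : 'I_d) : spacetime -> R :=
  xget (cst 0) [set s | Loo T s /\ is_wsymgrad T lam i j s].

(* v belongs to C([0,T]; L^2(T^d)) *)
Definition C_L2 T (v : spacetime -> R) :=
  forall t, t \in `[0, T] ->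
    (fun x => v (t, x)) \in Lfun (torus R d) 2%:E /\
    Lnorm (torus R d) 2%:E (fun x => (v (s, x) - v (t, x))%:E)
      @[s --> within [set` `[0, T]] (nbhs t)] --> 0%E.

(* u(t, .), the value at time t of the continuous representative of u *)
Definition trace T u (t : R) : 'rV[R]_d -> R :=
  xget (cst 0) [set w | exists v : spacetime -> R,
    [/\ v = u %[ae cylinder T], C_L2 T v & w = (fun x => v (t, x))]].

Definition H1_L2 T u :=
  L2 T u /\ exists g, L2 T g /\ is_wderiv T dirt u g.

Definition L2_H1 T u :=
  L2 T u /\ forall i, exists g, L2 T g /\ is_wderiv T (dirx i) u g.

Definition symgrad_Loo T lam :=
  forall i j, exists s, Loo T s /\ is_wsymgrad T lam i j s.

Definition dual_class T :
    set ((spacetime -> 'rV[R]_d) * (spacetime -> R)) :=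
  [set p | [/\ forall i, H1_L2 T (component p.1 i),
               symgrad_Loo T p.1,
               div_free T p.1,
               forall i, trace T (component p.1 i) T = cst 0 %[ae torus R d] &
               L2_H1 T p.2 /\
               {ae time_measure T, forall t, \int[torus R d]_x p.2 (t, x) = 0}]].

Definition lagrangian T (aV : R) (V0 : 'rV[R]_d -> 'rV[R]_d)
    (F Vbar : spacetime -> 'rV[R]_d)
    (p : (spacetime -> 'rV[R]_d) * (spacetime -> R))
    (V : spacetime -> 'rV[R]_d) : R :=
  let: (lam, gam) := p in
  \int[cylinder T]_z
    (\sum_i \sum_j 2^-1 * V z 0 i * V z 0 j *
       (2 * wsymgrad T lam i j z + aV * (i == j)%:R) +
     \sum_i V z 0 i * (wderiv T dirt (component lam i) z +
       wderiv T (dirx i) gam z - aV * Vbar z 0 i)) +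
  \int[cylinder T]_z
    (2^-1 * aV * (\sum_i Vbar z 0 i * Vbar z 0 i) +
     \sum_i F z 0 i * lam z 0 i +
     T^-1 * (\sum_i trace T (component lam i) 0 z.2 * V0 z.2 0 i)).

Definition dual_value T (aV : R) (V0 : 'rV[R]_d -> 'rV[R]_d)
    (F Vbar : spacetime -> 'rV[R]_d) p : \bar R :=
  ereal_inf [set (lagrangian T aV V0 F Vbar p V)%:E | V in vL2 T].

Definition J_E T (aV : R) (V0 : 'rV[R]_d -> 'rV[R]_d)
    (F Vbar : spacetime -> 'rV[R]_d) : \bar R :=
  ereal_sup [set dual_value T aV V0 F Vbar p | p in dual_class T].

End spaces.

(* Main.v *)
Require Import Defs.
From mathcomp Require Import all_boot all_order all_algebra.
From mathcomp Require Import all_classical all_reals all_analysis.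
From mathcomp Require Import measurable_realfun ess_sup_inf ring lra zify.

(* The inner infimum is concave in the dual variable: for fixed V the Lagrangian
   is affine in lambda, gamma and their derivatives.  If the infimum is at least
   a real number a, then testing with V = k 1_A xi, for k large, shows that
   2 nabla^sym lambda + a_V Id is nonnegative a.e.; as div lambda = 0 its trace is
   constant, so nabla^sym lambda is bounded a.e. by a constant depending only on
   a_V and d.  With this bound, testing with a small multiple of
   -(dt lambda + nabla gamma - a_V Vbar) bounds the L^2 norm of
   dt lambda + nabla gamma, and hence those of dt lambda and of nabla gamma, which
   are orthogonal since lambda is divergence free; Poincare's inequality bounds
   gamma.  So the superlevel sets of the dual functional are convex and bounded in
   L^2.  Elements of almost minimal norm of the superlevel sets approaching the
   supremum form a Cauchy sequence, by the parallelogram identity; its strong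
   limit satisfies all the constraints and attains the supremum.
   Weak derivatives are handled in the Hartley basis of products of cos + sin on
   ]0, T[ x T^d, and lambda is recovered from dt lambda as the primitive which
   vanishes at time T. *)

Set Implicit Arguments.
Unset Strict Implicit.
Unset Printing Implicit Defensive.
Import Order.TTheory GRing.Theory Num.Theory.
Import numFieldNormedType.Exports.

Local Open Scope classical_set_scope.
Local Open Scope ring_scope.

(** * Square-integrable functions *)

(** The dual variable is replaced by a family [D] of functions in which the Lagrangian is affine:
    time derivatives and symmetric gradient of lambda, gamma and its gradient. The trace of lambda
    at time 0 is minus the time integral of its derivative, so the initial term too is a continuous
    linear form on L^2 and no trace has to be followed along a limit. The one term that is not
    L^2-continuous is the integral of V_i V_j against the symmetric gradient: V_i V_j is only
    integrable, and the uniform bound obtained from positivity is what lets this term pass to the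
    limit. The zero dual variable has nonnegative value, which together with coercivity makes the
    supremum finite. Traces and weak derivatives are chosen representatives, so each must be shown
    unique a.e. before it can be computed. Orthogonality of dt lambda and nabla gamma cannot be had
    by testing one against the other, neither being a test function; Parseval's identity reduces it,
    like Poincare's inequality, to one frequency at a time. The basis is periodic in time while test
    functions have compact support there, whence the cutoffs. *)

Section square_integrable.
Context d (X : measurableType d) (R : realType).
Variable mu : {measure set X -> \bar R}.
Hypothesis fin_mu : mu setT \is a fin_num.

Local Notation integrable f := (mu.-integrable setT (EFin \o f)).
Local Notation Lsq f := (f \in Lfun mu 2%:E).

Implicit Types f g h : X -> R.

Definition ip f g := \int[mu]_z (f z * g z).

Lemma Lsq_measurable f : Lsq f -> measurable_fun setT f.
Proof. by rewrite inE => /andP[/[!inE]]. Qed.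

Lemma LsqP f :
  Lsq f <-> measurable_fun setT f /\ integrable (fun x => f x ^+ 2).
Proof.
split=> [sf|[mf /integrableP[_ If]]].
  by split; [exact: Lsq_measurable | exact: Lfun2_integrable_sqr].
rewrite inE; apply/andP; split; rewrite inE//= /finite_norm unlock.
rewrite poweR_lty//; move: If; congr (_ < _)%E; apply: eq_integral => x _.
by rewrite /= powR_mulrn// normrX.
Qed.

Lemma integrableM f g : Lsq f -> Lsq g -> integrable (fun x => f x * g x).
Proof. by move=> sf sg; apply/Lfun1_integrable; exact: Lfun2_mul_Lfun1. Qed.

Lemma Lsq_integrable f : Lsq f -> integrable f.
Proof. by move=> sf; apply/Lfun1_integrable; exact: Lfun_subset12. Qed.

Lemma LsqZ a f : Lsq f -> Lsq (fun x => a * f x).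
Proof.
move=> sf.
have := @Lfun_scale _ _ _ mu f a 2 (ler1n _ 2) sf.
rewrite (_ : (fun _ => _) = a \o* f)//.
by apply/funext => x /=; rewrite mulrC.
Qed.

Lemma LsqD f g : Lsq f -> Lsq g -> Lsq (f + g).
Proof. by move=> sf sg; apply: (Lfun_addr_closed mu (lee1n 2)).2. Qed.

Lemma LsqN f : Lsq f -> Lsq (- f).
Proof.
move=> /(LsqZ (-1)); rewrite (_ : - f = fun x => -1 * f x)//.
by apply/funext => x; rewrite mulN1r.
Qed.

Lemma LsqB f g : Lsq f -> Lsq g -> Lsq (f - g).
Proof. by move=> sf sg; exact: LsqD sf (LsqN sg). Qed.

Lemma Lsq0 : Lsq (cst 0).
Proof. exact: (Lfun_addr_closed mu (lee1n 2)).1. Qed.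

Lemma Lsq_sum (I : Type) (s : seq I) (F : I -> X -> R) :
  (forall i, Lsq (F i)) -> Lsq (fun x => \sum_(i <- s) F i x).
Proof.
move=> sF; rewrite (_ : (fun _ => _) = \sum_(i <- s) F i); last first.
  by apply/funext => x; rewrite fct_sumE.
elim/big_ind : _ => //; [exact: Lsq0 | exact: LsqD].
Qed.

(** Measurability of [g] does not follow from that of [f], since the measure need not be complete;
    it is therefore a separate hypothesis here and in the similar lemmas below. *)
Lemma Lsq_ae f g : measurable_fun setT g -> f = g %[ae mu] -> Lsq f -> Lsq g.
Proof.
move=> mg fg /LsqP[mf /integrableP[mf2 If]]; apply/LsqP; split => //.
apply/integrableP; split; first exact/measurable_EFinP/measurable_funX.
move: If; congr (_ < _)%E; apply: ae_eq_integral => //.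
- by apply: measurableT_comp => //; exact/measurable_EFinP/measurable_funX.
- by apply: measurableT_comp => //; exact/measurable_EFinP/measurable_funX.
- by apply: filterS fg => x /= fgx _; rewrite fgx.
Qed.

Lemma integrable_ae_eq f g : measurable_fun setT g -> f = g %[ae mu] ->
  integrable f -> integrable g.
Proof.
move=> mg fg /integrableP[mf If].
apply/integrableP; split; first exact/measurable_EFinP.
move: If; congr (_ < _)%E; apply: ae_eq_integral => //.
- exact: measurableT_comp.
- by apply: measurableT_comp => //; exact/measurable_EFinP.
- by apply: filterS fg => x /= fgx _; rewrite fgx.
Qed.

Lemma ae_eq_Rintegral f g : measurable_fun setT f -> measurable_fun setT g ->
  f = g %[ae mu] -> \int[mu]_z f z = \int[mu]_z g z.
Proof.
move=> mf mg fg; rewrite /Rintegral; congr fine.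
apply: ae_eq_integral => //; [exact/measurable_EFinP|exact/measurable_EFinP|].
by apply: filterS fg => x /= fgx _; rewrite fgx.
Qed.

Lemma integrableMb f g (C : R) : integrable f -> measurable_fun setT g ->
  {ae mu, forall x, `|g x| <= C} -> integrable (fun x => f x * g x).
Proof.
move=> If mg gC.
have mf : measurable_fun setT f by apply/measurable_EFinP; case/integrableP: If.
have C0 : 0 <= Num.max C 0 by rewrite le_max lexx orbT.
have ICf : integrable (fun x => Num.max C 0 * f x).
  exact: (integrableZl measurableT (Num.max C 0) If).
case/integrableP: ICf => _ ICf.
apply/integrableP; split; first exact/measurable_EFinP/measurable_funM.
apply: le_lt_trans ICf; apply: ae_ge0_le_integral => //.
- by apply: measurableT_comp => //; exact/measurable_EFinP/measurable_funM.
- by apply: measurableT_comp => //; exact/measurable_EFinP/measurable_funM.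
- apply: filterS gC => x gC _; rewrite /= lee_fin !normrM mulrC.
  by rewrite ler_wpM2r// [leRHS]ger0_norm// le_max gC.
Qed.

Lemma LsqMb f g (C : R) : Lsq f -> measurable_fun setT g ->
  {ae mu, forall x, `|g x| <= C} -> Lsq (fun x => f x * g x).
Proof.
move=> /LsqP[mf If] mg gC; apply/LsqP; split; first exact: measurable_funM.
under eq_fun do rewrite exprMn.
apply: (@integrableMb _ _ (C ^+ 2)) => //; first exact: measurable_funX.
apply: filterS gC => x gC; rewrite normrX ler_pXn2r// nnegrE//.
exact: le_trans gC.
Qed.

Lemma Lsq_cst c : Lsq (cst c).
Proof.
apply/LsqP; split; first exact: measurable_cst.
apply/integrableP; split; first by apply/measurable_EFinP; exact: measurable_funX.
rewrite (eq_integral (cst (`|c ^+ 2|%:E))) => [|//].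
rewrite integral_cst// lte_mul_pinfty//.
by rewrite ltey_eq fin_mu.
Qed.

Lemma Lsq_bounded g (C : R) : measurable_fun setT g ->
  {ae mu, forall x, `|g x| <= C} -> Lsq g.
Proof.
move=> mg gC; have := LsqMb (Lsq_cst 1) mg gC.
by under eq_fun do rewrite mul1r.
Qed.

Lemma ipC f g : ip f g = ip g f.
Proof. by apply: eq_Rintegral => x _; rewrite mulrC. Qed.

Lemma ipDl f g h : Lsq f -> Lsq g -> Lsq h -> ip (f + g) h = ip f h + ip g h.
Proof.
move=> sf sg sh; rewrite /ip -RintegralD//; [|exact: integrableM..].
by apply: eq_Rintegral => x _; rewrite mulrDl.
Qed.

Lemma ipBl f g h : Lsq f -> Lsq g -> Lsq h -> ip (f - g) h = ip f h - ip g h.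
Proof.
move=> sf sg sh; rewrite /ip -RintegralB//; [|exact: integrableM..].
by apply: eq_Rintegral => x _; rewrite mulrBl.
Qed.

Lemma ipZl a f h : Lsq f -> Lsq h -> ip (fun x => a * f x) h = a * ip f h.
Proof.
move=> sf sh; rewrite /ip -RintegralZl//; last exact: integrableM.
by apply: eq_Rintegral => x _; rewrite mulrA.
Qed.

Lemma ipDr f g h : Lsq f -> Lsq g -> Lsq h -> ip h (f + g) = ip h f + ip h g.
Proof. by move=> *; rewrite ipC ipDl// !(ipC _ h). Qed.

Lemma ipBr f g h : Lsq f -> Lsq g -> Lsq h -> ip h (f - g) = ip h f - ip h g.
Proof. by move=> *; rewrite ipC ipBl// !(ipC _ h). Qed.

Lemma ipZr a f h : Lsq f -> Lsq h -> ip h (fun x => a * f x) = a * ip h f.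
Proof. by move=> *; rewrite ipC ipZl// ipC. Qed.

Lemma Rintegral_sum (I : Type) (s : seq I) (F : I -> X -> R) :
  (forall i, integrable (F i)) ->
  \int[mu]_z (\sum_(i <- s) F i z) = \sum_(i <- s) \int[mu]_z F i z.
Proof.
move=> iF; elim: s => [|i s IH].
  under eq_Rintegral do rewrite big_nil.
  by rewrite big_nil Rintegral_cst// mul0r.
under eq_Rintegral do rewrite big_cons.
rewrite big_cons RintegralD ?IH//.
have := integrable_sum measurableT s (fun i _ => iF i) (P := xpredT).
by apply: eq_integrable => // x _; rewrite /= sumEFin.
Qed.

Lemma integrable_Rsum (I : Type) (s : seq I) (F : I -> X -> R) :
  (forall i, integrable (F i)) -> integrable (fun z => \sum_(i <- s) F i z).
Proof.
move=> iF; have := integrable_sum measurableT s (fun i _ => iF i) (P := xpredT).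
by apply: eq_integrable => // x _; rewrite /= sumEFin.
Qed.

Lemma ip_suml (I : Type) (s : seq I) (F : I -> X -> R) h :
  (forall i, Lsq (F i)) -> Lsq h ->
  ip (fun x => \sum_(i <- s) F i x) h = \sum_(i <- s) ip (F i) h.
Proof.
move=> sF sh; rewrite /ip -Rintegral_sum => [|i]; last exact: integrableM.
by apply: eq_Rintegral => x _; rewrite mulr_suml.
Qed.

Lemma ip_ge0 f : 0 <= ip f f.
Proof. by apply: Rintegral_ge0 => x _; rewrite -expr2 sqr_ge0. Qed.

Lemma ip_ae f f' g : measurable_fun setT f -> measurable_fun setT f' ->
  measurable_fun setT g -> f = f' %[ae mu] -> ip f g = ip f' g.
Proof.
move=> mf mf' mg ff'; apply: ae_eq_Rintegral; [exact: measurable_funM..|].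
by apply: filterS ff' => x /= -> .
Qed.

Lemma ip_eq0 f : Lsq f -> ip f f = 0 -> f = cst 0 %[ae mu].
Proof.
move=> sf ff0.
have Iff := integrableM sf sf.
have : (\int[mu]_x `|(f x * f x)%:E| = 0)%E.
  rewrite (eq_integral (fun x => (f x * f x)%:E)) => [|x _]; last first.
    by rewrite gee0_abs// lee_fin -expr2 sqr_ge0.
  by rewrite -[LHS]fineK ?integrable_fin_num// -/(Rintegral _ _ _) -/(ip f f) ff0.
move/ae_eq_integral_abs => /(_ measurableT) H.
have /H : measurable_fun setT (fun x => (f x * f x)%:E).
  by case/integrableP : Iff.
by apply: filterS => x /= /(_ I) [] /eqP; rewrite mulf_eq0 orbb => /eqP.
Qed.

Lemma ip_sqrD f g : Lsq f -> Lsq g ->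
  ip (f + g) (f + g) = ip f f + ip f g *+ 2 + ip g g.
Proof.
by move=> sf sg; rewrite ipDl ?ipDr//; [rewrite (ipC g f); ring|exact: LsqD].
Qed.

Lemma ip_sqrB f g : Lsq f -> Lsq g ->
  ip (f - g) (f - g) = ip f f - ip f g *+ 2 + ip g g.
Proof.
by move=> sf sg; rewrite ipBl ?ipBr//; [rewrite (ipC g f); ring|exact: LsqB].
Qed.

(** Expand the square of [e f - g] and divide by [e]. The weight [e] is tuned at each use. *)
Lemma ip_young f g (e : R) : Lsq f -> Lsq g -> 0 < e ->
  ip f g *+ 2 <= e * ip f f + e^-1 * ip g g.
Proof.
move=> sf sg e0.
have : 0 <= e^-1 * ip ((fun x => e * f x) - g) ((fun x => e * f x) - g).
  by rewrite mulr_ge0 ?ip_ge0// invr_ge0 ltW.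
have sef := LsqZ e sf.
rewrite ip_sqrB// !ipZl// !ipZr// => h; rewrite -subr_ge0.
by apply: le_trans h _; rewrite le_eqVlt; apply/orP; left; apply/eqP; field; rewrite gt_eqF.
Qed.

(** Up to the factor [ip f f], the nonnegative quantity expanded below is the squared norm of [g]
    minus its projection on [f]. If [ip f f = 0] then [f] vanishes a.e. and both sides are 0. *)
Lemma ip_CS f g : Lsq f -> Lsq g -> ip f g ^+ 2 <= ip f f * ip g g.
Proof.
move=> sf sg.
have [f0|f0] := eqVneq (ip f f) 0.
  have -> : ip f g = 0.
    rewrite (_ : ip f g = ip (cst 0) g).
      by rewrite /ip; under eq_Rintegral do rewrite mul0r; rewrite Rintegral_cst// mul0r.
    apply: ip_ae; [exact: Lsq_measurable|exact: measurable_cst|exact: Lsq_measurable|].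
    exact: ip_eq0.
  by rewrite f0 mul0r expr2 mul0r.
have fp : 0 < ip f f by rewrite lt_neqAle eq_sym f0 ip_ge0.
have sh := LsqZ (ip f g / ip f f) sf.
have : 0 <= ip f f * ip ((fun x => ip f g / ip f f * f x) - g)
                        ((fun x => ip f g / ip f f * f x) - g).
  by rewrite mulr_ge0 ?ip_ge0.
rewrite ip_sqrB// !ipZl// !ipZr// => h; rewrite -subr_ge0.
by apply: le_trans h _; rewrite le_eqVlt; apply/orP; left; apply/eqP; field.
Qed.

Lemma ip_sqrD_le f g : Lsq f -> Lsq g ->
  ip (f + g) (f + g) <= 2 * ip f f + 2 * ip g g.
Proof.
move=> sf sg; have := ip_ge0 (f - g); rewrite ip_sqrB// ip_sqrD//; lra.
Qed.

End square_integrable.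
Arguments LsqP {d X R mu f}.

(** * Completeness of L^2 *)

Section Lsq_completeness.
Context d (X : measurableType d) (R : realType).
Variable mu : {measure set X -> \bar R}.
Hypothesis fin_mu : mu setT \is a fin_num.

Local Notation integrable f := (mu.-integrable setT (EFin \o f)).
Local Notation Lsq f := (f \in Lfun mu 2%:E).
Local Notation ip := (ip mu).

Implicit Types f g h : X -> R.

Definition L2cvg (fn : nat -> X -> R) f :=
  ip (fn n - f) (fn n - f) @[n --> \oo] --> 0.

Lemma cvg_ipl fn f g : (forall n, Lsq (fn n)) -> Lsq f -> Lsq g ->
  L2cvg fn f -> ip (fn n) g @[n --> \oo] --> ip f g.
Proof.
move=> sfn sf sg fnf.
apply/cvgrPdist_lt => /= e e0.
have e1 : 0 < e ^+ 2 / (ip g g + 1).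
  by rewrite divr_gt0 ?exprn_gt0// ltr_pwDr// ip_ge0.
move/cvgr0Pnorm_lt : fnf => /(_ _ e1); apply: filterS => n /=.
rewrite ger0_norm ?ip_ge0// ltr_pdivlMr ?ltr_pwDr ?ip_ge0// => fne.
rewrite distrC -ipBl// -(@ltr_pXn2r _ 2) ?nnegrE ?(ltW e0)// -normrX ger0_norm ?sqr_ge0//.
apply: le_lt_trans (ip_CS (LsqB (sfn n) sf) sg) _.
apply: le_lt_trans fne; rewrite ler_wpM2l ?ip_ge0//; lra.
Qed.

Lemma limn_einf_le (u : (\bar R)^nat) (c : \bar R) (K : nat) :
  (forall n, (K <= n)%N -> (u n <= c)%E) -> (limn_einf u <= c)%E.
Proof.
move=> uc; rewrite limn_einf_lim; apply: lime_le.
  exact: is_cvg_einfs.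
apply: nearW => n; apply: (@le_trans _ _ (u (maxn n K))).
  by apply: ereal_inf_lbound; exists (maxn n K) => //=; exact: leq_maxl.
by apply: uc; exact: leq_maxr.
Qed.

(** The measure being finite, L^2 bounds on the increments give L^1 bounds that are summable. The
    series of absolute increments is then integrable, hence finite a.e., and the sequence
    telescopes. *)
Lemma fast_cauchy_ae_cvg (h : nat -> X -> R) : (forall n, Lsq (h n)) ->
  (forall k, ip (h k.+1 - h k) (h k.+1 - h k) <= ((2 ^+ k.+1)^-1) ^+ 2) ->
  {ae mu, forall x, cvgn (h ^~ x)}.
Proof.
move=> sh dh; pose dlt k := h k.+1 - h k.
have sd k : Lsq (dlt k) by exact: LsqB.
have sad k : Lsq (fun x => `|dlt k x|).
  have /LsqP[md Id] := sd k; apply/LsqP; split; first exact: measurableT_comp.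
  by apply: eq_integrable Id => // x _; rewrite /= real_normK// num_real.
pose M := ip (cst 1) (cst 1).
have ld k : (\int[mu]_x `|dlt k x|%:E <= ((1 + M) / (2 ^ (k + 1))%:R)%:E)%E.
  have /fineK <- := integrable_fin_num measurableT (Lsq_integrable fin_mu (sad k)).
  rewrite lee_fin -/(Rintegral mu setT _).
  have -> : \int[mu]_x `|dlt k x| = ip (fun x => `|dlt k x|) (cst 1).
    by apply: eq_Rintegral => x _; rewrite mulr1.
  have p0 : 0 < (2 : R) ^+ k.+1 by rewrite exprn_gt0.
  (* The weight [2 ^ (k+1)] balances the two terms: the squared norm of [dlt k] is at most
     [4 ^ -(k+1)], so both are of order [2 ^ -(k+1)]. *)
  have := ip_young (sad k) (Lsq_cst fin_mu 1) p0; rewrite -/M.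
  have -> : ip (fun x => `|dlt k x|) (fun x => `|dlt k x|) = ip (dlt k) (dlt k).
    by apply: eq_Rintegral => x _; rewrite -normrM ger0_norm// -expr2 sqr_ge0.
  have := dh k; rewrite -/(dlt k) addn1 natrX.
  set p := _ ^+ k.+1 in p0 *; set a := ip (fun _ => _) _; set b := ip _ _ => bp.
  have pa : p * a <= p^-1.
    have pE : p * (p^-1 ^+ 2) = p^-1 by field; rewrite gt_eqF.
    by rewrite -[leRHS]pE ler_pM2l.
  have b0 : 0 <= b by apply: Rintegral_ge0 => x _; rewrite mulr_ge0.
  by rewrite mulrDl mul1r mulr2n (mulrC M); lra.
have := integral_nneseries mu measurableT (f := fun k x => `|dlt k x|%:E).
move=> /(_ (fun k => (measurable_int mu (Lsq_integrable fin_mu (sad k))))).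
move=> /(_ (fun _ _ _ => normr_ge0 _)) intE.
have I : (mu.-integrable setT (fun x => \sum_(0 <= k <oo) `|dlt k x|%:E)%E).
  apply/integrableP; split.
    apply: ge0_emeasurable_sum => // k _.
    exact: (measurable_int mu (Lsq_integrable fin_mu (sad k))).
  under eq_integral.
    move=> x _; rewrite gee0_abs; last by apply: nneseries_ge0 => *; rewrite lee_fin.
    over.
  rewrite intE; apply: le_lt_trans.
    by apply: lee_nneseries => [k _ _|k _]; [exact: integral_ge0|exact: ld].
  have := @cvg_geometric_eseries_half _ (1 + M) 0.
  by move/cvg_lim => -> //; rewrite ltry.
have := integrable_ae measurableT I; apply: filterS => x /(_ Logic.I) fx.
suff : cvgn (series (dlt ^~ x)).
  have -> : series (dlt ^~ x) = (fun n => h n x - h 0%N x).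
    apply/funext => n; rewrite /series/= /dlt.
    exact: (telescope_sumr (h ^~ x) (leq0n n)).
  move=> /cvg_ex[l hl]; apply/cvg_ex; exists (l + h 0%N x).
  have -> : h ^~ x = (fun n => (h n x - h 0%N x) + h 0%N x).
    by apply/funext => n; rewrite subrK.
  by apply: cvgD => //; exact: cvg_cst.
apply: normed_cvg; apply: nondecreasing_is_cvgn.
  by apply: nondecreasing_series => *; exact: normr_ge0.
exists (fine (\sum_(0 <= k <oo) `|dlt k x|%:E)%E) => _ [n _ <-].
rewrite -lee_fin fineK// /series/= -sumEFin.
by apply: nneseries_lim_ge => k _; rewrite lee_fin.
Qed.

(** Riesz-Fischer: a rapidly convergent subsequence converges a.e., and Fatou's lemma along it turns
    the Cauchy condition into convergence in norm to the pointwise limit. *)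
Lemma Lsq_complete (fn : nat -> X -> R) : (forall n, Lsq (fn n)) ->
  (forall e : R, 0 < e -> exists N, forall n m, (N <= n)%N -> (N <= m)%N ->
    ip (fn n - fn m) (fn n - fn m) <= e) ->
  exists f, Lsq f /\ L2cvg fn f.
Proof.
move=> sfn cfn.
have e0 k : 0 < ((2 ^+ k.+1)^-1 : R) ^+ 2 by rewrite exprn_gt0// invr_gt0 exprn_gt0.
have [N HN] := choice (fun k => cfn _ (e0 k)).
(* Adding up the [(N j).+1] makes the indices strictly increasing while keeping [nn k] above
   [N k]. *)
pose nn k := (\sum_(j < k.+1) (N j).+1)%N.
have nnN k : (N k <= nn k)%N.
  by rewrite /nn big_ord_recr/= (leq_trans (leqnSn _))// leq_addl.
have nnS k : (nn k < nn k.+1)%N.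
  by rewrite {2}/nn big_ord_recr/= addnS ltnS leq_addr.
have nnk k : (k <= nn k)%N by elim: k => // k IH; exact: leq_ltn_trans IH (nnS k).
pose h k := fn (nn k).
have sh k : Lsq (h k) by exact: sfn.
have hcvg : {ae mu, forall x, cvgn (h ^~ x)}.
  apply: fast_cauchy_ae_cvg => // k; apply: HN; last exact: nnN.
  exact: leq_trans (nnN k) (ltnW (nnS k)).
have mh k : measurable_fun setT (EFin \o h k).
  by apply/measurable_EFinP; exact: Lsq_measurable.
(* The upper limit is measurable everywhere, including on the null set where the subsequence
   diverges. *)
pose f x := fine (limn_esup (fun k => (h k x)%:E)).
have mf : measurable_fun setT f.
  apply: measurableT_comp => //; exact: measurable_fun_limn_esup.
have hf : {ae mu, forall x, h k x @[k --> \oo] --> f x}.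
  apply: filterS hcvg => x /cvg_ex[l hl].
  have hlE : (h k x)%:E @[k --> \oo] --> l%:E.
    by apply: cvg_EFin hl; exact: nearW.
  by rewrite /f (cvg_limn_einf_sup hlE).2.
have mB n k : measurable_fun setT (fun x => ((fn n x - h k x) ^+ 2)%:E).
  apply/measurable_EFinP; apply: measurable_funX; apply: measurable_funB;
  exact: Lsq_measurable.
have mBf n : measurable_fun setT (fun x => ((fn n x - f x) ^+ 2)%:E).
  apply/measurable_EFinP; apply: measurable_funX; apply: measurable_funB => //.
  exact: Lsq_measurable.
have key e n K : 0 < e ->
    (forall m, (K <= m)%N -> ip (fn n - fn m) (fn n - fn m) <= e) ->
    (\int[mu]_x ((fn n x - f x) ^+ 2)%:E <= e%:E)%E.
  move=> ep He.
  have -> : (\int[mu]_x ((fn n x - f x) ^+ 2)%:E =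
             \int[mu]_x limn_einf (fun k => ((fn n x - h k x) ^+ 2)%:E))%E.
    apply: ae_eq_integral => //.
      under eq_fun do rewrite -[limn_einf _]oppeK -limn_esupN.
      apply: measurableT_comp => //; apply: measurable_fun_limn_esup => k.
      exact: measurableT_comp.
    apply: filterS hf => x hx _; apply/esym.
    have hx2 : ((fn n x - h k x) ^+ 2)%:E @[k --> \oo] --> ((fn n x - f x) ^+ 2)%:E.
      apply: cvg_EFin; first exact: nearW.
      under eq_fun do rewrite expr2.
      by rewrite expr2; apply: cvgM; apply: cvgB => //; exact: cvg_cst.
    by rewrite (cvg_limn_einf_sup hx2).1.
  apply: le_trans (fatou mu measurableT (mB n) _) _.
    by move=> k x _; rewrite lee_fin sqr_ge0.
  apply: (@limn_einf_le _ _ K) => k Kk.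
  have <- : (ip (fn n - h k) (fn n - h k))%:E =
            (\int[mu]_x ((fn n x - h k x) ^+ 2)%:E)%E.
    rewrite /ip /Rintegral fineK; last first.
      by apply: integrable_fin_num => //; apply: integrableM; exact: LsqB.
    by under eq_integral do rewrite -expr2.
  by rewrite lee_fin He// (leq_trans Kk).
have [N0 HN0] := cfn 1 ltr01.
have sf : Lsq f.
  have sB : Lsq (fn N0 - f).
    apply/LsqP; split; first by apply: measurable_funB => //; exact: Lsq_measurable.
    apply/integrableP; split; first exact: mBf.
    under eq_integral do rewrite /= ger0_norm ?sqr_ge0//.
    apply: le_lt_trans (ltry 1); apply: (key _ _ N0) => // m N0m.
    exact: HN0.
  have := LsqB (sfn N0) sB; rewrite (_ : _ - _ = f)//.
  by rewrite opprB addrC subrK.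
exists f; split => //; apply/cvgr0Pnorm_lt => /= e ep.
have ep2 : 0 < e / 2 by rewrite divr_gt0.
have [N1 HN1] := cfn _ ep2.
exists N1 => // n /= N1n; rewrite ger0_norm ?ip_ge0//.
apply: le_lt_trans (_ : e / 2 < e); last by lra.
rewrite -lee_fin /ip /Rintegral fineK; last first.
  by apply: integrable_fin_num => //; apply: integrableM => //; exact: LsqB.
under eq_integral do rewrite -expr2.
by apply: (key _ _ N1) => // m N1m; exact: HN1.
Qed.

End Lsq_completeness.

(** * Almost minimal elements of midpoint-convex sets *)

Section minimizing_sequences.
Context d (X : measurableType d) (R : realType).
Variable mu : {measure set X -> \bar R}.
Hypothesis fin_mu : mu setT \is a fin_num.
Variable J : finType.

Local Notation Lsq f := (f \in Lfun mu 2%:E).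
Local Notation ip := (ip mu).

Implicit Types D E : J -> X -> R.

Definition energy D := \sum_j ip (D j) (D j).

Definition midpoint D E : J -> X -> R := fun j x => 2^-1 * (D j x + E j x).

Lemma energy_ge0 D : 0 <= energy D.
Proof. by apply: sumr_ge0 => j _; exact: ip_ge0. Qed.

Lemma ip_le_energy D j : ip (D j) (D j) <= energy D.
Proof.
by rewrite /energy (bigD1 j)//= lerDl; apply: sumr_ge0 => i _; exact: ip_ge0.
Qed.

Lemma energy_parallelogram D E : (forall j, Lsq (D j)) -> (forall j, Lsq (E j)) ->
  energy (fun j => D j - E j) =
  2 * energy D + 2 * energy E - 4 * energy (midpoint D E).
Proof.
move=> sD sE; rewrite /energy !mulr_sumr -big_split -sumrB.
apply: eq_bigr => j _; rewrite ip_sqrB//.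
have sDE : Lsq (D j + E j) by exact: LsqD.
rewrite /midpoint; have -> : (fun x => 2^-1 * (D j x + E j x)) =
  (fun x => 2^-1 * (D j + E j) x) by [].
by rewrite ipZl ?ipZr ?ip_sqrD//; [rewrite /=; field|exact: LsqZ].
Qed.

(* Elements of almost minimal energy in a decreasing sequence of midpoint-convex
   sets form a Cauchy sequence, by the parallelogram identity: this replaces weak
   compactness. *)
Lemma midpoint_convex_cvg (K : nat -> set (J -> X -> R)) (M : R) :
  (forall n, K n !=set0) ->
  (forall n m, (n <= m)%N -> K m `<=` K n) ->
  (forall D, K 0%N D -> forall j, Lsq (D j)) ->
  (forall n D E, K n D -> K n E -> K n (midpoint D E)) ->
  (forall D, K 0%N D -> energy D <= M) ->
  exists (D : nat -> J -> X -> R) (E : J -> X -> R),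
    (forall n, K n (D n)) /\ forall j, Lsq (E j) /\ L2cvg mu (D ^~ j) (E j).
Proof.
move=> K0 Kdec KL2 Kmid KM.
pose A n := [set energy D | D in K n].
have lbA n : has_lbound (A n) by exists 0 => _ [D _ <-]; exact: energy_ge0.
have infA n : has_inf (A n).
  by split=> //; have [D KD] := K0 n; exists (energy D), D.
pose m n := inf (A n).
have mM n : m n <= M.
  have [D KD] := K0 n; apply: le_trans (KM _ (Kdec _ _ (leq0n n) _ KD)).
  by apply: ge_inf => //; exists D.
have mnd : {homo m : n k / (n <= k)%N >-> n <= k}.
  move=> n k nk; apply: lb_le_inf; first by have [] := infA k.
  by move=> _ [D KD <-]; apply: ge_inf => //; exists D => //; exact: Kdec KD.
have cm : cvgn m.
  by apply: nondecreasing_is_cvgn => //; exists M => _ [n _ <-].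
have ml n : m n <= limn m by exact: nondecreasing_cvgn_le.
have /choice[D HD] : forall n, exists D, K n D /\ energy D < m n + n.+1%:R^-1.
  move=> n; have n0 : 0 < n.+1%:R^-1 :> R by rewrite invr_gt0.
  by have [_ [D KD <-] lt] := inf_adherent n0 (infA n); exists D.
have sD n j : Lsq (D n j).
  by apply: KL2; apply: (Kdec 0%N n) => //; exact: (HD n).1.
(* The midpoint lies in [K n], so its energy is at least [m n], while the energies of [D n] and
   [D k] exceed [limn m] by at most the harmonic terms. What the parallelogram identity leaves is
   the gap between [m n] and its limit. *)
have est n k : (n <= k)%N ->
    energy (fun j => D n j - D k j) <= 2 * (limn m - m n) + 4 * n.+1%:R^-1.
  move=> nk; rewrite energy_parallelogram//.
  have mid : m n <= energy (midpoint (D n) (D k)).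
    apply: ge_inf => //; exists (midpoint (D n) (D k)) => //.
    by apply: Kmid; [exact: (HD n).1|apply: Kdec nk _ _; exact: (HD k).1].
  have kn : k.+1%:R^-1 <= n.+1%:R^-1 :> R by rewrite lef_pV2 ?posrE// ler_nat.
  move: (HD n).2 (HD k).2 (ml k) kn mid.
  by move: (n.+1%:R^-1) (k.+1%:R^-1) (energy _) (energy _) (energy _) => *; lra.
exists D.
suff /choice[E HE] : forall j, exists f : X -> R, Lsq f /\ L2cvg mu (D ^~ j) f.
  by exists E; split => // n; exact: (HD n).1.
move=> j; apply: Lsq_complete => // e e0.
have : 2 * (limn m - m n) + 4 * n.+1%:R^-1 @[n --> \oo] --> 2 * (limn m - limn m) + 4 * 0.
  apply: cvgD; apply: cvgM; [exact: cvg_cst| |exact: cvg_cst|exact: cvg_harmonic].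
  by apply: cvgB => //; exact: cvg_cst.
rewrite subrr !mulr0 addr0 => /cvgr0Pnorm_lt /(_ _ e0)[N _ HN].
exists N => n k Nn Nk; wlog nk : n k Nn Nk / (n <= k)%N.
  move=> H; have [/H->//|/ltnW kn] := leqP n k.
  rewrite -opprB (_ : ip _ _ = ip (D k j - D n j) (D k j - D n j)); first exact: H.
  by apply: eq_Rintegral => x _; rewrite mulrNN.
apply: le_trans (ip_le_energy (fun j => D n j - D k j) j) _.
apply: le_trans (est _ _ nk) _.
by apply: ltW; apply: le_lt_trans (HN n Nn); exact: ler_norm.
Qed.

End minimizing_sequences.

(** * Integration on the cylinder *)

Section product_Rintegral.
Context d1 d2 (X : measurableType d1) (Y : measurableType d2) (R : realType).
Variables (m1 : {sigma_finite_measure set X -> \bar R}).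
Variables (m2 : {sigma_finite_measure set Y -> \bar R}).

Local Notation m12 := (m1 \x m2)%E.

Lemma ae_product1 (P : X * Y -> Prop) : {ae m12, forall z, P z} ->
  {ae m1, forall x, {ae m2, forall y, P (x, y)}}.
Proof.
move=> [N [mN N0 PN]].
have : (\int[m1]_x `|m2 (xsection N x)| = 0)%E.
  by rewrite -[RHS]N0; apply: eq_integral => x _; rewrite gee0_abs.
move/(ae_eq_integral_abs m1 measurableT (measurable_fun_xsection m2 mN)).1.
apply: filterS => x /(_ Logic.I) /= Nx; exists (xsection N x).
split => //; first exact: measurable_xsection.
by move=> y nP; rewrite /xsection/= inE; exact: PN.
Qed.

Lemma ae_fst (P : X -> Prop) : {ae m1, forall x, P x} ->
  {ae m12, forall z, P z.1}.
Proof.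
move=> [N [mN N0 PN]]; exists (N `*` setT); split.
- exact: measurableX.
- by rewrite product_measure1E// [X in (X * _)%E]N0 mul0e.
- by move=> z /= nP; split => //; exact: PN.
Qed.

Lemma ae_snd (P : Y -> Prop) : {ae m2, forall y, P y} ->
  {ae m12, forall z, P z.2}.
Proof.
move=> [N [mN N0 PN]]; exists (setT `*` N); split.
- exact: measurableX.
- by rewrite product_measure1E// [X in (_ * X)%E]N0 mule0.
- by move=> z /= nP; split => //; exact: PN.
Qed.

(** An integrable function is finite a.e., so [fine] changes it on a null set only. Iterated real
    integrals need this: the inner one is [fine] of an integral that may be infinite at exceptional
    points. *)
Lemma integrable_fine d (T : measurableType d) (mu : {measure set T -> \bar R})
    (F : T -> \bar R) : mu.-integrable setT F ->
  mu.-integrable setT (EFin \o (fun x => fine (F x))) /\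
  (\int[mu]_x (fine (F x))%:E = \int[mu]_x F x)%E.
Proof.
move=> iF; have mF := measurable_int mu iF.
have mfF : measurable_fun setT (EFin \o (fun x => fine (F x))).
  by apply/measurable_EFinP; exact: measurableT_comp.
have FE : ae_eq mu setT (EFin \o (fun x => fine (F x))) F.
  by have := integrable_ae measurableT iF; apply: filterS => x /= /[apply] /fineK.
split; last exact: ae_eq_integral.
apply/integrableP; split => //.
case/integrableP : iF => _; congr (_ < _)%E; apply: ae_eq_integral => //.
- exact: measurableT_comp.
- exact: measurableT_comp.
- by apply: filterS FE => x /= + Tx; move=> /(_ Tx) <-.
Qed.

Lemma Rfubini1 (f : X * Y -> R) : m12.-integrable setT (EFin \o f) ->
  m1.-integrable setT (EFin \o (fun x => \int[m2]_y f (x, y))) /\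
  \int[m12]_z f z = \int[m1]_x \int[m2]_y f (x, y).
Proof.
move=> If; have [? E] := integrable_fine (integrable_fubini_F If).
by split => //; rewrite /Rintegral E integral12_prod_meas1.
Qed.

Lemma integrable_fubini_G (f : X * Y -> \bar R) : m12.-integrable setT f ->
  m2.-integrable setT (fubini_G m1 f).
Proof.
move=> If; have mf := measurable_int m12 If.
apply/integrableP; split; first exact: measurable_fubini_G If.
apply: le_lt_trans ((integrable21ltyP m1 m2 mf).1 If).
apply: ge0_le_integral => //.
- by apply: measurableT_comp => //; exact: measurable_fubini_G If.
- by apply: (measurable_fun_fubini_tonelli_G (fun z => `|f z|%E)) => //; exact: measurableT_comp mf.
- move=> y _; apply: le_abse_integral => //; exact: measurableT_comp.
Qed.

Lemma Rfubini2 (f : X * Y -> R) : m12.-integrable setT (EFin \o f) ->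
  m2.-integrable setT (EFin \o (fun y => \int[m1]_x f (x, y))) /\
  \int[m12]_z f z = \int[m2]_y \int[m1]_x f (x, y).
Proof.
move=> If; have [? E] := integrable_fine (integrable_fubini_G If).
by split => //; rewrite /Rintegral E integral21_prod_meas1.
Qed.

Lemma Rintegral_prodM (f : X -> R) (g : Y -> R) :
  m1.-integrable setT (EFin \o f) -> m2.-integrable setT (EFin \o g) ->
  m12.-integrable setT (EFin \o (fun z => f z.1 * g z.2)) /\
  \int[m12]_z (f z.1 * g z.2) = \int[m1]_x f x * \int[m2]_y g y.
Proof.
move=> If Ig.
have mf : measurable_fun setT f by apply/measurable_EFinP; case/integrableP: If.
have mg : measurable_fun setT g by apply/measurable_EFinP; case/integrableP: Ig.
have I : m12.-integrable setT (EFin \o (fun z => f z.1 * g z.2)).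
  apply/integrable12ltyP.
    apply/measurable_EFinP; apply: measurable_funM.
      exact: measurableT_comp mf measurable_fst.
    exact: measurableT_comp mg measurable_snd.
  under eq_integral => x _.
    under eq_integral => y _ do rewrite /= normrM EFinM.
    rewrite ge0_integralZl//; last exact/measurable_EFinP/measurableT_comp.
    over.
  rewrite ge0_integralZr//.
  - apply: lte_mul_pinfty; [exact: integral_ge0| |].
    + rewrite ge0_fin_numE; first by case/integrableP: If.
      exact: integral_ge0.
    + by case/integrableP: Ig.
  - exact/measurable_EFinP/measurableT_comp.
  - exact: integral_ge0.
split => //; have [_ ->] := Rfubini1 I.
rewrite -RintegralZr//; apply: eq_Rintegral => x _ /=.
by rewrite RintegralZl.
Qed.

End product_Rintegral.

(** * The time interval and the torus as measure spaces *)

Section time_torus.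
Context (R : realType).
Implicit Types (L : R) (n : nat).

(** The uniform law from which [torus] is built is the time measure of length 1, so time and space
    coordinates obey the same integration rules. *)
Lemma uniform_time_measure (A : set (measurableTypeR R)) : measurable A ->
  uniform_prob (@ltr01 R) A = time_measure 1 A.
Proof.
move=> mA; rewrite /uniform_prob integral_uniform_pdf /time_measure/=.
rewrite /mfrestr/= /mrestr.
rewrite (eq_integral (cst 1%E)).
  by rewrite integral_cst ?mul1e//; exact: measurableI.
move=> x; rewrite inE/= => -[_]; rewrite in_itv/= /uniform_pdf => ->.
by rewrite subr0 invr1.
Qed.

Lemma time_measure_setT L : 0 <= L -> time_measure L setT = L%:E.
Proof.
move=> L0; rewrite /time_measure /mfrestr/= /mrestr setTI.
rewrite lebesgue_measure_itv/= lte_fin oppr0 adde0.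
case: ifPn => //; rewrite -leNgt => L0'.
by congr EFin; apply/eqP; rewrite eq_le L0 L0'.
Qed.

Lemma time_measure_fin L : time_measure L setT \is a fin_num.
Proof. exact: fin_num_measure. Qed.

Lemma ae_time_measure_itv L : {ae time_measure L, forall t, 0 < t < L}.
Proof.
exists (~` `]0, L[%classic); split.
- by apply: measurableC; exact: measurable_itv.
- rewrite /time_measure /mfrestr/= /mrestr setIC.
  apply/eqP; rewrite -measure_le0.
  apply: (@le_trans _ _ (lebesgue_measure ([set 0; L] : set R))).
    apply: le_measure; rewrite ?inE//=.
    + by apply: measurableI; [exact: measurable_itv|apply: measurableC; exact: measurable_itv].
    + by apply: measurableU; exact: measurable_set1.
    + move=> t/= []; rewrite !in_itv/= => /andP[t0 tL] /negP.
      rewrite negb_and -!leNgt => /orP[t0'|tL'].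
        by left; apply/eqP; rewrite eq_le t0 t0'.
      by right; apply/eqP; rewrite eq_le tL tL'.
  apply: le_trans (measureU2 _ _ _) _ => //.
  rewrite [X in (X + _)%E]lebesgue_measure_set1 add0e.
  by rewrite [leLHS]lebesgue_measure_set1.
- by move=> t /= nt; rewrite in_itv/=.
Qed.

#[local] Instance ae_time_filter L : Filter (almost_everywhere (time_measure L)).
Proof.
exact: (ae_filter_ringOfSetsType (time_measure L : {measure set _ -> \bar R})).
Qed.

Lemma integral_time_measure L (f : R -> \bar R) : measurable_fun setT f ->
  (\int[time_measure L]_t f t = \int[lebesgue_measure]_(t in `[0%R, L]) f t)%E.
Proof.
move=> mf; transitivity (\int[time_measure L]_(t in `[0%R, L]) f t)%E.
  rewrite [RHS]integral_mkcond; apply: ae_eq_integral => //.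
    by apply/(measurable_restrictT _ _).1 => //; exact: measurable_funTS.
  have := ae_time_measure_itv L; apply: filterS => t tL _.
  rewrite /= patchE mem_set// /= in_itv/=.
  by case/andP: tL => /ltW -> /ltW ->.
apply: eq_measure_integral => A mA AL.
transitivity (@lebesgue_measure R (A `&` [set` `[0, L]])) => //.
by rewrite setIidl.
Qed.

Local Notation cyl L n := (time_measure L \x torus R n)%E.

Lemma cylinder_setT L n : 0 <= L -> cyl L n setT = L%:E.
Proof.
move=> L0; rewrite -setXTT product_measure1E//.
rewrite [X in (X * _)%E]time_measure_setT//.
by rewrite [X in (_ * X)%E]probability_setT mule1.
Qed.

Lemma cylinder_fin L n : cyl L n setT \is a fin_num.
Proof.
rewrite -setXTT product_measure1E// [X in (_ * X)%E]probability_setT mule1.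
exact: time_measure_fin.
Qed.

(** The torus is a cylinder of length 1 over the torus of one dimension less; inductions on the
    dimension go through this identity. *)
Lemma torusS_pushforward n (A : set 'rV[R]_n.+1) : measurable A ->
  torus R n.+1 A = cyl 1 n (@rV_cons R n @^-1` A).
Proof.
move=> mA; rewrite /= /distribution /pushforward /product_measure1.
apply: eq_measure_integral => B mB _; exact: uniform_time_measure.
Qed.

Lemma integral_torusS n (f : 'rV[R]_n.+1 -> R) : measurable_fun setT f ->
  (cyl 1 n).-integrable setT (EFin \o (f \o @rV_cons R n)) ->
  (torus R n.+1).-integrable setT (EFin \o f) /\
  \int[torus R n.+1]_x f x = \int[cyl 1 n]_z f (rV_cons z).
Proof.
move=> mf If.
have mE : measurable_fun setT (EFin \o f) by exact/measurable_EFinP.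
have eqm : forall A : set 'rV[R]_n.+1, measurable A -> A `<=` setT ->
    torus R n.+1 A = pushforward (cyl 1 n) (@rV_cons R n) A.
  by move=> A mA _; rewrite torusS_pushforward.
split.
  have /integrableP[_ Ip] := integrable_pushforward (@measurable_rV_cons R n) mE
    (D := setT) If measurableT.
  apply/integrableP; split => //.
  by rewrite (eq_measure_integral _ eqm).
rewrite /Rintegral; congr fine.
rewrite (eq_measure_integral _ eqm).
by rewrite (integral_pushforward (@measurable_rV_cons R n)).
Qed.

Lemma integral_torus0 (f : 'rV[R]_0 -> R) :
  \int[torus R 0]_x f x = f 0.
Proof.
transitivity (\int[torus R 0]_x f 0).
  by apply: eq_Rintegral => x _; rewrite (thinmx0 x).
rewrite Rintegral_cst//.
apply: etrans (congr1 (fun u => f 0 * fine u) (probability_setT (torus R 0))) _.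
by rewrite mulr1.
Qed.

End time_torus.

(** * Bounded measurable functions *)

Section bounded_measurable.
Context d (X : measurableType d) (R : realType).

(** The bound holds everywhere rather than a.e., so that the class is stable under composition with
    any measurable map, such as a coordinate. *)
Definition bmeas (f : X -> R) :=
  measurable_fun setT f /\ exists C, forall x, `|f x| <= C.

Lemma bmeas_cst c : bmeas (cst c).
Proof. by split => //; exists `|c|. Qed.

Lemma bmeasM (f g : X -> R) : bmeas f -> bmeas g -> bmeas (fun x => f x * g x).
Proof.
move=> [mf [C fC]] [mg [D gD]]; split; first exact: measurable_funM.
by exists (C * D) => x; rewrite normrM ler_pM.
Qed.

Lemma bmeasD (f g : X -> R) : bmeas f -> bmeas g -> bmeas (fun x => f x + g x).
Proof.
move=> [mf [C fC]] [mg [D gD]]; split; first exact: measurable_funD.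
by exists (C + D) => x; apply: le_trans (ler_normD _ _) _; exact: lerD.
Qed.

Lemma bmeasZ (a : R) (f : X -> R) : bmeas f -> bmeas (fun x => a * f x).
Proof. exact: bmeasM (bmeas_cst a). Qed.

Lemma bmeasB (f g : X -> R) : bmeas f -> bmeas g -> bmeas (fun x => f x - g x).
Proof.
move=> bf bg; under eq_fun do rewrite -mulN1r.
by apply: bmeasD => //; exact: bmeasZ.
Qed.

Lemma bmeas_prod (I : Type) (s : seq I) (f : I -> X -> R) :
  (forall i, bmeas (f i)) -> bmeas (fun x => \prod_(i <- s) f i x).
Proof.
move=> bf; elim: s => [|i s IH].
  by under eq_fun do rewrite big_nil; exact: bmeas_cst.
by under eq_fun do rewrite big_cons; exact: bmeasM.
Qed.

Lemma bmeas_comp d' (Y : measurableType d') (f : X -> R) (g : Y -> X) :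
  bmeas f -> measurable_fun setT g -> measurable_fun setT (f \o g) /\
    exists C, forall x, `|f (g x)| <= C.
Proof.
by move=> [mf [C fC]] mg; split; [exact: measurableT_comp|exists C => x].
Qed.

Lemma bmeas_Lsq (mu : {measure set X -> \bar R}) (f : X -> R) :
  mu setT \is a fin_num -> bmeas f -> f \in Lfun mu 2%:E.
Proof. by move=> fm [mf [C fC]]; apply: Lsq_bounded => //; exact: aeW fC. Qed.

Lemma bmeas_integrable (mu : {measure set X -> \bar R}) (f : X -> R) :
  mu setT \is a fin_num -> bmeas f -> mu.-integrable setT (EFin \o f).
Proof. by move=> fm bf; apply: Lsq_integrable => //; exact: bmeas_Lsq. Qed.

Lemma bmeas_Lsq_mul (mu : {measure set X -> \bar R}) (f g : X -> R) :
  f \in Lfun mu 2%:E -> bmeas g -> (fun x => f x * g x) \in Lfun mu 2%:E.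
Proof. by move=> sf [mg [C gC]]; apply: LsqMb (aeW _ gC). Qed.

End bounded_measurable.

(** * Coordinates on time-space *)

Section coordinates.
Context (R : realType).

(** Time is coordinate [ord0] and the space coordinates are the [lift ord0 i]. With [len] giving the
    period of each, formulas over ['I_n.+1] treat time and space alike. *)
Definition crd n (o : 'I_n.+1) (z : spacetime R n) : R := rV_cons z 0 o.

Definition len n (L : R) (o : 'I_n.+1) : R := oapp (fun=> 1) L (unlift ord0 o).

Lemma crd0 n z : @crd n ord0 z = z.1.
Proof. by rewrite /crd mxE unlift_none. Qed.

Lemma crdS n (i : 'I_n) z : crd (lift ord0 i) z = z.2 0 i.
Proof. by rewrite /crd mxE liftK. Qed.

Lemma len0 n L : @len n L ord0 = L.
Proof. by rewrite /len unlift_none. Qed.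

Lemma lenS n L (i : 'I_n) : len L (lift ord0 i) = 1.
Proof. by rewrite /len liftK. Qed.

Lemma measurable_crd n (o : 'I_n.+1) : measurable_fun setT (crd o).
Proof.
exact: measurableT_comp (@measurable_coord R n.+1 o) (@measurable_rV_cons R n).
Qed.

Local Notation cyl L n := (time_measure L \x torus R n)%E.

Lemma torus_fin n : torus R n setT \is a fin_num.
Proof. exact: fin_num_measure. Qed.

Lemma ae_torus_itv n : {ae torus R n, forall x : 'rV[R]_n, forall i, 0 < x 0 i < 1}.
Proof.
elim: n => [|n IH]; first by apply: aeW => x [].
pose A := [set x : 'rV[R]_n.+1 | forall i, 0 < x 0 i < 1].
have mA : measurable A.
  rewrite (_ : A = \bigcap_(i in [set: 'I_n.+1])
      (setT `&` (fun x : 'rV[R]_n.+1 => x 0 i) @^-1` `]0, 1[)); last first.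
    rewrite predeqE => x; split => [Ax i _|Ax i].
      by split => //=; rewrite in_itv/=; exact: Ax.
    by have [_] := Ax i Logic.I; rewrite /= in_itv.
  apply: fin_bigcap_measurable => // i _.
  by apply: measurable_coord => //; exact: measurable_itv.
have : {ae cyl 1 n, forall z, A (rV_cons z)}.
  have := ae_fst (torus R n) (ae_time_measure_itv 1).
  have := ae_snd (time_measure 1) IH.
  apply: filterS2 => z z2 z1 i; rewrite -/(crd i z).
  by case: (unliftP ord0 i) => [j|] ->; rewrite ?crdS ?crd0.
move=> [N [mN N0 AN]]; exists (~` A); split => //; first exact: measurableC.
rewrite torusS_pushforward//; last exact: measurableC.
apply: (subset_measure0 _ mN AN N0); rewrite -[X in measurable X]setTI.
exact: (@measurable_rV_cons R n measurableT _ (measurableC mA)).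
Qed.

Lemma ae_crd_itv n L : {ae cyl L n, forall z, forall o, 0 < crd o z < len L o}.
Proof.
have := ae_fst (torus R n) (ae_time_measure_itv L).
have := ae_snd (time_measure L) (ae_torus_itv n).
apply: filterS2 => z z2 z1 o.
by case: (unliftP ord0 o) => [j|] ->; rewrite ?crdS ?lenS ?crd0 ?len0.
Qed.

(** [step] deduces the formula on a cylinder of any length from the one on its torus factor. As a
    torus is itself a cylinder of length 1 over a smaller torus, [step] serves both in the induction
    and in the final passage to length [L]. *)
Lemma Rintegral_cyl_prod n L (f : 'I_n.+1 -> R -> R) : (forall o, bmeas (f o)) ->
  \int[cyl L n]_z \prod_o f o (crd o z) =
  \prod_o \int[time_measure (len L o)]_t f o t.
Proof.
have step m M (g : 'I_m.+1 -> R -> R) : (forall o, bmeas (g o)) ->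
    \int[torus R m]_x \prod_(i < m) g (lift ord0 i) (x 0 i) =
      \prod_(i < m) \int[time_measure 1]_t g (lift ord0 i) t ->
    \int[cyl M m]_z \prod_o g o (crd o z) =
      \prod_o \int[time_measure (len M o)]_t g o t.
  move=> bg IH; under eq_Rintegral => z _.
    rewrite big_ord_recl crd0.
    under eq_bigr do rewrite crdS.
    over.
  have I1 : (time_measure M).-integrable setT (EFin \o g ord0).
    by apply: bmeas_integrable; [exact: time_measure_fin|exact: bg].
  have I2 : (torus R m).-integrable setT
      (EFin \o (fun x : 'rV[R]_m => \prod_(i < m) g (lift ord0 i) (x 0 i))).
    apply: bmeas_integrable; first exact: torus_fin.
    by apply: bmeas_prod => i; exact: bmeas_comp (bg _) (measurable_coord i).
  rewrite (Rintegral_prodM I1 I2).2 IH big_ord_recl len0; congr (_ * _).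
  by apply: eq_bigr => i _; rewrite lenS.
move=> bf; apply: (step) => //.
move: {L} n f bf; elim=> [|n IH] f bf.
  by rewrite integral_torus0 !big_ord0.
set g := fun i => f (lift ord0 i); rewrite -/(g _).
have bg i : bmeas (g i) by exact: bf.
have mG : measurable_fun setT (fun x : 'rV[R]_n.+1 => \prod_(i < n.+1) g i (x 0 i)).
  by apply: (bmeas_prod _ _).1 => i; exact: bmeas_comp (bg _) (measurable_coord i).
have IG : (cyl 1 n).-integrable setT
    (EFin \o ((fun x : 'rV[R]_n.+1 => \prod_(i < n.+1) g i (x 0 i)) \o @rV_cons R n)).
  apply: bmeas_integrable; first exact: cylinder_fin.
  by apply: bmeas_prod => i; exact: bmeas_comp (bg _) (measurable_crd i).
rewrite (integral_torusS mG IG).2.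
rewrite -[RHS](_ : \prod_o \int[time_measure (len 1 o)]_t g o t = _); last first.
  apply: eq_bigr => o _.
  by case: (unliftP ord0 o) => [j|] ->; rewrite ?lenS ?len0.
by apply: (step n 1 g bg); exact: IH.
Qed.

End coordinates.

(** * The Hartley basis *)

Section orthogonal_family.
Context d (X : measurableType d) (R : realType).
Variable mu : {measure set X -> \bar R}.
Hypothesis fin_mu : mu setT \is a fin_num.
Variables (I : eqType) (e : I -> X -> R) (c : R).

Local Notation Lsq f := (f \in Lfun mu 2%:E).
Local Notation ip := (ip mu).

Hypothesis sqe : forall i, Lsq (e i).
Hypothesis c_gt0 : 0 < c.
Hypothesis orth : forall i j, ip (e i) (e j) = c * (i == j)%:R.

Implicit Types (f g : X -> R) (s : seq I).

Definition proj s f : X -> R := fun x => \sum_(i <- s) (c^-1 * ip f (e i)) * e i x.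

Lemma Lsq_proj s f : Lsq (proj s f).
Proof. by apply: Lsq_sum => i; exact: LsqZ. Qed.

Lemma ip_projl s f g : Lsq g ->
  ip (proj s f) g = \sum_(i <- s) c^-1 * ip f (e i) * ip g (e i).
Proof.
move=> sg; rewrite ip_suml//; last by move=> i; exact: LsqZ.
by apply: eq_bigr => i _; rewrite ipZl// (ipC mu g).
Qed.

Lemma ip_proj_basis s f i : uniq s -> i \in s -> ip (proj s f) (e i) = ip f (e i).
Proof.
move=> us si; rewrite ip_projl// (bigD1_seq i)//= orth eqxx mulr1.
rewrite big1 => [|j ji]; first by rewrite addr0 mulrAC mulVf ?mul1r// gt_eqF.
by rewrite orth eq_sym (negbTE ji) !mulr0.
Qed.

Lemma ip_proj_proj s t f : uniq t -> {subset s <= t} ->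
  ip (proj s f) (proj t f) = \sum_(i <- s) c^-1 * ip f (e i) ^+ 2.
Proof.
move=> ut st; rewrite ip_projl; last exact: Lsq_proj.
by apply: eq_big_seq => i si; rewrite ip_proj_basis ?st// expr2 mulrA.
Qed.

Lemma bessel s f : uniq s -> Lsq f ->
  \sum_(i <- s) c^-1 * ip f (e i) ^+ 2 <= ip f f.
Proof.
move=> us sf; have sp := Lsq_proj s f.
have := ip_ge0 mu (f - proj s f).
rewrite ip_sqrB// (ip_proj_proj f us (fun _ => id)) ipC ip_projl//.
rewrite (eq_bigr (fun i => c^-1 * ip f (e i) ^+ 2)) => [|i _]; first lra.
by rewrite expr2 mulrA.
Qed.

Hypothesis total : forall f, Lsq f -> (forall i, ip f (e i) = 0) ->
  f = cst 0 %[ae mu].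

Variable s : nat -> seq I.
Hypothesis uniq_s : forall n, uniq (s n).
Hypothesis s_incr : forall n m, (n <= m)%N -> {subset s n <= s m}.
Hypothesis s_cover : forall i, exists n, i \in s n.

(** By Bessel's inequality the partial sums form a Cauchy sequence. Their limit has the same
    coefficients as [f], hence equals [f] a.e. by totality. *)
Lemma proj_cvg f : Lsq f -> L2cvg mu (fun n => proj (s n) f) f.
Proof.
move=> sf; pose r n := \sum_(i <- s n) c^-1 * ip f (e i) ^+ 2.
have rE n m : (n <= m)%N ->
    ip (proj (s m) f - proj (s n) f) (proj (s m) f - proj (s n) f) = r m - r n.
  move=> nm; rewrite ip_sqrB; [|exact: Lsq_proj..].
  rewrite (ip_proj_proj f (uniq_s m) (fun _ => id)).
  rewrite (ip_proj_proj f (uniq_s n) (fun _ => id)).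
  rewrite ipC (ip_proj_proj f (uniq_s m) (s_incr nm)) /r; ring.
have rnd : {homo r : n m / (n <= m)%N >-> n <= m}.
  by move=> n m nm; rewrite -subr_ge0 -rE// ip_ge0.
have cr : cvgn r.
  by apply: nondecreasing_is_cvgn => //; exists (ip f f) => _ [n _ <-]; exact: bessel.
have rl n : r n <= limn r by exact: nondecreasing_cvgn_le.
have [g [sg pg]] : exists g, Lsq g /\ L2cvg mu (fun n => proj (s n) f) g.
  apply: Lsq_complete => // [n|eps eps0]; first exact: Lsq_proj.
  have /cvgrPdist_lt/(_ _ eps0)[N _ HN] := cr.
  exists N => n m Nn Nm; wlog nm : n m Nn Nm / (n <= m)%N.
    move=> H; have [/H->//|/ltnW mn] := leqP n m.
    rewrite -opprB (_ : ip _ _ = ip (proj (s m) f - proj (s n) f)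
      (proj (s m) f - proj (s n) f)); first exact: H.
    by apply: eq_Rintegral => x _; rewrite mulrNN.
  rewrite -opprB (_ : ip _ _ = ip (proj (s m) f - proj (s n) f)
      (proj (s m) f - proj (s n) f)); last first.
    by apply: eq_Rintegral => x _; rewrite mulrNN.
  rewrite rE//; have := HN n Nn; rewrite ger0_norm ?subr_ge0//.
  have := rl m; lra.
have fg : f - g = cst 0 %[ae mu].
  apply: total => [|i]; first exact: LsqB.
  rewrite ipBl//; apply/eqP; rewrite subr_eq0; apply/eqP.
  have [N iN] := s_cover i.
  have := cvg_ipl (fun n => Lsq_proj (s n) f) sg (sqe i) pg.
  move=> /(cvg_lim (@Rhausdorff R)) <-; apply/esym/cvg_lim => //.
  apply: cvg_near_cst; exists N => // n Nn; rewrite ip_proj_basis//.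
  exact: s_incr Nn _ iN.
rewrite /L2cvg; suff -> : (fun n => ip (proj (s n) f - f) (proj (s n) f - f)) =
          (fun n => ip (proj (s n) f - g) (proj (s n) f - g)) by [].
apply/funext => n; apply: ae_eq_Rintegral.
- by apply: measurable_funM; apply: Lsq_measurable (LsqB (Lsq_proj _ _) sf).
- by apply: measurable_funM; apply: Lsq_measurable (LsqB (Lsq_proj _ _) sg).
- apply: filterS fg => x fgx _.
  have {}fgx : f x = g x by apply/eqP; rewrite -subr_eq0; apply/eqP; exact: fgx.
  change ((proj (s n) f x - f x) * (proj (s n) f x - f x) =
          (proj (s n) f x - g x) * (proj (s n) f x - g x)).
  by rewrite fgx.
Qed.

Lemma parseval f g : Lsq f -> Lsq g ->
  ip (proj (s n) f) g @[n --> \oo] --> ip f g.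
Proof.
by move=> sf sg; apply: cvg_ipl => //; [move=> n; exact: Lsq_proj|exact: proj_cvg].
Qed.

End orthogonal_family.

(* The Hartley functions cos + sin: an orthogonal real basis indexed by the
   integers, each of whose derivatives is a multiple of a single basis function. *)
Section hartley.
Context (R : realType).
Implicit Types (L x : R) (k l : int).

Definition freq L k : R := 2 * pi * k%:~R / L.

Definition cas L k x : R := cos (freq L k * x) + sin (freq L k * x).

Lemma freqN L k : freq L (- k) = - freq L k.
Proof. by rewrite /freq mulrNz mulrN mulNr. Qed.

Lemma freqD L k l : freq L (k + l) = freq L k + freq L l.
Proof. by rewrite /freq mulrzDr mulrDr mulrDl. Qed.

Lemma cas0 L x : cas L 0 x = 1.
Proof. by rewrite /cas /freq mulr0z mulr0 !mul0r cos0 sin0 addr0. Qed.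

(** The product of cas a and cas b is [cos (a - b) + sin (a + b)]; the even and odd parts of cas are
    recovered from its values at opposite arguments. The span of the basis is thus closed under
    products. *)
Lemma casM L k l x : cas L k x * cas L l x =
  2^-1 * (cas L (k - l) x + cas L (l - k) x + cas L (k + l) x - cas L (- k - l) x).
Proof.
rewrite /cas !freqD !freqN !mulrDl !mulNr !cosD !sinD !cosN !sinN.
by field.
Qed.

Lemma cas_le2 L k x : `|cas L k x| <= 2.
Proof.
apply: le_trans (ler_normD _ _) _.
by rewrite (_ : 2 = 1 + 1)// lerD ?cos_max ?sin_max.
Qed.

Lemma is_derive_cas L k x :
  is_derive x 1 (cas L k) (freq L k * cas L (- k) x).
Proof.
have dl : is_derive x 1 (fun y => freq L k * y) (freq L k).
  by apply: is_derive_eq; rewrite /GRing.scale/= mulr1.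
have dc := @is_derive1_comp _ cos (fun y => freq L k * y) x _ _ _ dl.
have ds := @is_derive1_comp _ sin (fun y => freq L k * y) x _ _ _ dl.
apply: (@is_derive_eq _ _ _ _ _ _ _ _ (is_deriveD (dc _ _) (ds _ _))).
by rewrite /cas freqN [- freq L k * x]mulNr cosN sinN; ring.
Qed.

Lemma continuous_cas L k : continuous (cas L k).
Proof.
move=> x; apply: differentiable_continuous; apply/derivable1_diffP.
by have [] := is_derive_cas L k x.
Qed.

Lemma measurable_cas L k : measurable_fun setT (cas L k).
Proof. by apply: continuous_measurable_fun; exact: continuous_cas. Qed.

Lemma bmeas_cas L k : bmeas (cas L k).
Proof. by split; [exact: measurable_cas|exists 2 => x; exact: cas_le2]. Qed.

Lemma cas_period L k x : L != 0 -> cas L k (x + L) = cas L k x.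
Proof.
move=> L0; rewrite /cas mulrDr.
have -> : freq L k * L = pi *+ 2 * k%:~R.
  by rewrite /freq divfK// mulr2n; ring.
have per (f : R -> R) y : periodic f (pi *+ 2) -> f (y + pi *+ 2 * k%:~R) = f y.
  move=> pf; case: k => n.
    by rewrite -pmulrn mulr_natr periodicn.
  rewrite NegzE mulrNz mulrN -[in RHS](subrK (pi *+ 2 * n.+1%:~R) y).
  by rewrite -pmulrn mulr_natr [RHS]periodicn.
by rewrite !per//; [exact: sinD2pi|exact: cosD2pi].
Qed.

Lemma integral_cas L k : 0 < L ->
  \int[time_measure L]_t cas L k t = L * (k == 0)%:R.
Proof.
move=> L0; have [->|k0] := eqVneq k 0.
  under eq_Rintegral do rewrite cas0.
  by rewrite Rintegral_cst// [X in fine X]time_measure_setT ?(ltW L0)// mul1r mulr1.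
have w0 : freq L k != 0.
  by rewrite /freq !mulf_neq0 ?invr_eq0 ?intr_eq0// gt_eqF// pi_gt0.
rewrite mulr0 /Rintegral integral_time_measure; last first.
  by apply/measurable_EFinP; exact: measurable_cas.
(* The antiderivative is a multiple of [cas L (- k)], so it takes equal values at both ends of a
   period. *)
pose F x : R := - (freq L k)^-1 * cas L (- k) x.
have dF x : is_derive x 1 F (cas L k x).
  have := is_deriveM (is_derive_cst (- (freq L k)^-1) x 1) (is_derive_cas L (- k) x).
  move=> h; apply: is_derive_eq.
  by rewrite /= scaler0 addr0 opprK freqN /GRing.scale/= mulrA mulrNN mulVf ?mul1r.
have cF x : {for x, continuous F}.
  by apply: differentiable_continuous; apply/derivable1_diffP; have [] := dF x.
rewrite (continuous_FTC2 (F := F) L0).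
- by rewrite /F -[in X in cas _ _ X](add0r L) cas_period ?gt_eqF// subee.
- exact/continuous_subspaceT/continuous_cas.
- split.
  + by move=> x _; have [] := dF x.
  + by apply: cvg_at_right_filter; exact: cF.
  + by apply: cvg_at_left_filter; exact: cF.
- by move=> x _; rewrite derive1E; have [_ ->] := dF x.
Qed.

(** In the product formula the indices [k - l] and [l - k] each give half of the Kronecker delta,
    while the terms with indices [k + l] and [- k - l] have equal integrals and opposite signs. *)
Lemma orthogonal_cas L k l : 0 < L ->
  \int[time_measure L]_t (cas L k t * cas L l t) = L * (k == l)%:R.
Proof.
move=> L0; under eq_Rintegral do rewrite casM.
have Ic f : bmeas f -> (time_measure L).-integrable setT (EFin \o f).
  by apply: bmeas_integrable; exact: time_measure_fin.
have bD j j' := bmeasD (bmeas_cas L j) (bmeas_cas L j').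
have bDD j j' j'' := bmeasD (bD j j') (bmeas_cas L j'').
have bDDB j j' j'' i := bmeasB (bDD j j' j'') (bmeas_cas L i).
rewrite RintegralZl//; last by apply: Ic; exact: bDDB.
rewrite RintegralB//; [|by apply: Ic; exact: bDD|by apply: Ic; exact: bmeas_cas].
rewrite RintegralD//; [|by apply: Ic; exact: bD|by apply: Ic; exact: bmeas_cas].
rewrite RintegralD//; [|by apply: Ic; exact: bmeas_cas..].
rewrite !integral_cas// -[- k - l]opprD oppr_eq0 !subr_eq0 (eq_sym l).
by rewrite addrK; field.
Qed.

End hartley.

(** * Functions determined by their integrals over boxes *)

Section boxes.
Context (R : realType) (n : nat).

Let ray_box (c : 'I_n.+1 -> R) : set (spacetime R n) :=
  [set z | forall o, crd o z < c o].

Let ray_boxes : set (set (spacetime R n)) := range ray_box.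

Let ray_boxes_setI : setI_closed ray_boxes.
Proof.
move=> _ _ [c _ <-] [e _ <-]; exists (fun o => Num.min (c o) (e o)) => //.
rewrite predeqE => z; split => [h|[h1 h2] o]; last by rewrite lt_min h1 h2.
by split => o; have := h o; rewrite lt_min => /andP[].
Qed.

Let measurable_ray_boxes :
  @measurable _ (spacetime R n) = <<s ray_boxes >>.
Proof.
apply/seteqP; split; last first.
  apply: smallest_sub; first exact: sigma_algebra_measurable.
  move=> _ [c _ <-].
  rewrite (_ : ray_box c = \bigcap_(o in [set: 'I_n.+1])
      (setT `&` @crd R n o @^-1` `]-oo, c o[)); last first.
    rewrite predeqE => z; split => [h o _|h o].
      by split => //=; rewrite in_itv/=; exact: h.
    by have [_] := h o Logic.I; rewrite /= in_itv.
  apply: fin_bigcap_measurable => // o _.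
  by apply: measurable_crd => //; exact: measurable_itv.
move=> A mA.
pose Y := g_sigma_algebraType ray_boxes.
suff mid : measurable_fun setT (id : Y -> spacetime R n).
  by have := mid measurableT A mA; rewrite setTI preimage_id.
have mcrd (o : 'I_n.+1) : measurable_fun setT (crd o : Y -> R).
  apply: (measurability (RGenInftyO.G (R:=R))).
    exact: RGenInftyO.measurableE.
  move=> _ [_ [x ->] <-]; rewrite setTI.
  (* A half-space is the union of the boxes whose remaining sides are bounded by [k]. The witness
     for a given point exceeds the sum of the absolute values of its coordinates. *)
  rewrite (_ : _ @^-1` _ = \bigcup_k ray_box (fun o' => if o' == o then x else k%:R)).
    by apply: bigcup_measurable => k _; apply: sub_gen_smallest; eexists.
  rewrite predeqE => z; split => [|[k _] h]; last first.
    by rewrite /= in_itv/=; have := h o; rewrite eqxx.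
  rewrite /= in_itv/= => zx.
  exists (Num.truncn (\sum_(o' : 'I_n.+1) `|crd o' z|)).+1 => // o'.
  case: ifPn => [/eqP ->//|_].
  apply: le_lt_trans (_ : _ <= \sum_(o' : 'I_n.+1) `|crd o' z|) (truncnS_gt _).
  rewrite (bigD1 o')//= (le_trans (ler_norm _))// lerDl.
  by apply: sumr_ge0 => *; exact: normr_ge0.
apply/measurable_fun_pairP; split.
  by have := mcrd ord0; congr measurable_fun; apply/funext => z; rewrite crd0.
apply: measurable_fun_rVP => i.
by have := mcrd (lift ord0 i); congr measurable_fun; apply/funext => z; rewrite crdS.
Qed.

Variable mu : {measure set (spacetime R n) -> \bar R}.

(** The boxes are stable under intersection and generate the sigma-algebra, and the sets over which
    [f] integrates to 0 form a Dynkin class, the vanishing of the full integral giving complements.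
    So [f] integrates to 0 over every measurable set. *)
Lemma ae_eq0_ray_boxes (f : spacetime R n -> R) :
  mu.-integrable setT (EFin \o f) -> \int[mu]_z f z = 0 ->
  (forall c : 'I_n.+1 -> R,
    \int[mu]_z (f z * \prod_o (crd o z < c o)%R%:R) = 0) ->
  f = cst 0 %[ae mu].
Proof.
move=> If f0 fbox.
have finE (A : set (spacetime R n)) : measurable A -> mu.-integrable A (EFin \o f).
  by move=> mA; apply: integrableS If.
have P S : measurable S -> (\int[mu]_(x in S) (f x)%:E = 0)%E.
  rewrite {1}measurable_ray_boxes => sS.
  apply: (@dynkin_induction _ (spacetime R n) ray_boxes
     (fun S => (\int[mu]_(x in S) (f x)%:E = 0)%E)) sS => //.
  - by rewrite -[LHS]fineK ?integrable_fin_num//; congr EFin.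
  - move=> _ [c _ <-]; have mB : measurable (ray_box c).
      by rewrite measurable_ray_boxes; apply: sub_gen_smallest; exists c.
    rewrite -[LHS]fineK; last by apply: integrable_fin_num => //; exact: finE.
    congr EFin; rewrite -[RHS](fbox c) -/(Rintegral mu (ray_box c) f).
    rewrite Rintegral_mkcond; apply: eq_Rintegral => z _.
    rewrite patchE; case: ifPn => zc.
      rewrite big1 ?mulr1// => o _; move: zc; rewrite inE => ->//.
    have [j zj] : exists j, ~~ (crd j z < c j)%R.
      apply: contrapT => H; move: zc; rewrite notin_setE; apply => o.
      by apply: contrapT => /negP ?; apply: H; exists o.
    by rewrite (bigD1 j)//= (negbTE zj) mul0r mulr0.
  - move=> A mA A0.
    have := @integral_setU_EFin _ _ _ mu A (~` A) f mA (measurableC mA).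
    rewrite setUv => /(_ ((measurable_EFinP _ _).1 (measurable_int mu If))).
    rewrite A0 add0e => <-; last by rewrite disj_set2E setICr.
    by rewrite -[LHS]fineK ?integrable_fin_num//; congr EFin.
  - move=> F mF tF F0; rewrite integral_bigcup//; last first.
      by apply: finE; exact: bigcup_measurable.
    by rewrite eseries0.
have := integral_ae_eq measurableT If (measurable_cst (0%:E : \bar R)) (mu := mu).
have H : forall E : set (spacetime R n), E `<=` setT -> measurable E ->
    (\int[mu]_(x in E) (EFin \o f) x = \int[mu]_(x in E) cst 0%:E x)%E.
  by move=> E _ mE; rewrite P// integral0.
by move=> /(_ H); apply: filterS => z /= h Tz; have [] := h Tz.
Qed.

End boxes.

(** * Polynomials converging to a step function *)

Section step_polynomials.
Context (R : realType).
Implicit Types (x y r u : R) (n m : nat).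

(** With [q = (1 - u) / 2] this is [(1 - q^n)^(n 2^n)], a variant of the polynomials used in
    elementary proofs of the Stone-Weierstrass theorem. The base 2 puts the jump at [q = 1/2], that
    is [u = 0], and the factor [n] forces the limit 0 at the jump itself. *)
Definition step_poly n u : R :=
  (1 - (2^-1 - 2^-1 * u) ^+ n) ^+ (n * 2 ^ n).

Lemma bernoulli_ge x m : 0 <= x -> 1 + m%:R * x <= (1 + x) ^+ m.
Proof.
move=> x0; elim: m => [|m IH]; first by rewrite mul0r addr0 expr0.
rewrite exprS; have := mulr_ge0 (ler0n R m) x0.
have : 0 <= x * ((1 + x) ^+ m - (1 + m%:R * x)) by rewrite mulr_ge0// subr_ge0.
rewrite -natr1 => H1 H2; have : 0 <= x * (m%:R * x) by rewrite mulr_ge0.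
by rewrite !mulrDl !mul1r; move: IH H1; rewrite mulrBr mulrDr mulr1; lra.
Qed.

Lemma bernoulli_le x m : 0 <= x <= 1 -> 1 - m%:R * x <= (1 - x) ^+ m.
Proof.
move=> /andP[x0 x1]; elim: m => [|m IH]; first by rewrite mul0r subr0 expr0.
have H : (1 - x) * (1 - m%:R * x) <= (1 - x) * (1 - x) ^+ m.
  by rewrite ler_wpM2l// subr_ge0.
rewrite exprS; apply: le_trans H; rewrite -natr1.
have : 0 <= x * (m%:R * x) by rewrite !mulr_ge0.
by rewrite mulrDl mul1r mulrBr mulrBl mul1r mulr1; lra.
Qed.

(** Write [r = s^2]. Bernoulli's inequality for [s^-1] bounds [n s^n], and the other factor [s^n]
    tends to 0. *)
Lemma cvg_n_expr r : 0 <= r < 1 -> n%:R * r ^+ n @[n --> \oo] --> (0 : R).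
Proof.
move=> /andP[r0 r1]; have [->|rn0] := eqVneq r 0.
  apply: cvg_near_cst; exists 1%N => // -[|n]// _.
  by rewrite expr0n/= mulr0.
pose s := Num.sqrt r; have s0 : 0 < s by rewrite sqrtr_gt0 lt_neqAle eq_sym rn0.
have s1 : s < 1 by rewrite -(@ltr_pXn2r _ 2) ?nnegrE ?ltW// sqr_sqrtr// expr1n.
pose h := s^-1 - 1; have h0 : 0 < h by rewrite subr_gt0 invf_gt1.
have bnd n : n%:R * s ^+ n <= h^-1.
  rewrite -[h^-1]mul1r ler_pdivlMr//.
  have h1 : 1 + h = s^-1 by rewrite /h addrC subrK.
  have := bernoulli_ge n (ltW h0); rewrite h1 => H.
  apply: (@le_trans _ _ (s^-1 ^+ n * s ^+ n)).
    by rewrite mulrAC ler_wpM2r ?exprn_ge0 ?(ltW s0)//; lra.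
  by rewrite -exprMn mulVf ?expr1n// gt_eqF.
apply: (@squeeze_cvgr _ _ _ _ (cst 0) (fun n => h^-1 * s ^+ n)).
- apply: nearW => n; rewrite mulr_ge0 ?exprn_ge0//=.
  rewrite -(sqr_sqrtr r0) -/s -exprM mul2n -addnn exprD mulrA.
  by rewrite ler_wpM2r// exprn_ge0// ltW.
- exact: cvg_cst.
- rewrite -[X in _ --> X](mulr0 h^-1); apply: cvgM; first exact: cvg_cst.
  by apply: cvg_expr; rewrite ger0_norm ?ltW.
Qed.

Lemma step_poly_ge0_le1 n u : -1 <= u <= 1 -> 0 <= step_poly n u <= 1.
Proof.
move=> /andP[u1 u2]; set q := 2^-1 - 2^-1 * u.
have q0 : 0 <= q by rewrite /q; lra.
have q1 : q <= 1 by rewrite /q; lra.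
have qn0 : 0 <= q ^+ n by rewrite exprn_ge0.
have qn1 : q ^+ n <= 1 by rewrite exprn_ile1.
by rewrite /step_poly -/q exprn_ge0 ?exprn_ile1//; lra.
Qed.

(** Both cases rest on Bernoulli's inequality. If [u > 0] the value is at least [1 - n (2q)^n] with
    [2q < 1]; otherwise [2q >= 1] and the value is at most [1 / (1 + n (2q)^n)], hence at most
    [1 / (n + 1)]. *)
Lemma step_poly_cvg u : -1 <= u <= 1 ->
  step_poly n u @[n --> \oo] --> ((0 < u)%R%:R : R).
Proof.
move=> /[dup] u11 /andP[u1 u2]; set q := 2^-1 - 2^-1 * u.
have q0 : 0 <= q by rewrite /q; lra.
have q1 : q <= 1 by rewrite /q; lra.
have qn0 n : 0 <= q ^+ n by rewrite exprn_ge0.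
have qn1 n : q ^+ n <= 1 by rewrite exprn_ile1.
have E n : (n * 2 ^ n)%:R * q ^+ n = n%:R * (2 * q) ^+ n.
  by rewrite natrM natrX exprMn mulrA.
have [up|un] := ltP 0 u.
  apply: (@squeeze_cvgr _ _ _ _ (fun n => 1 - n%:R * (2 * q) ^+ n) (cst 1)).
  - apply: nearW => n; case/andP: (step_poly_ge0_le1 n u11) => _ -> /=.
    by rewrite andbT -E bernoulli_le// qn0 qn1.
  - rewrite -[X in _ --> X]subr0; apply: cvgB; first exact: cvg_cst.
    by apply: cvg_n_expr; rewrite /q; lra.
  - exact: cvg_cst.
apply: (@squeeze_cvgr _ _ _ _ (cst 0) (fun n => n.+1%:R^-1)).
- apply: nearW => n; case/andP: (step_poly_ge0_le1 n u11) => -> _ /=.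
  have q2 : 1 <= 2 * q by rewrite /q; lra.
  have b0 : 0 < 1 + (n * 2 ^ n)%:R * q ^+ n.
    by rewrite ltr_pwDl// mulr_ge0.
  apply: (@le_trans _ _ (1 + (n * 2 ^ n)%:R * q ^+ n)^-1); last first.
    rewrite lef_pV2 ?posrE// -natr1 addrC lerD2l E.
    by rewrite ler_peMr// exprn_ege1.
  rewrite -[leRHS]mul1r ler_pdivlMr//.
  (* After multiplication by [(1 + q^n)^(n 2^n)] the value becomes a power of [1 - q^(2n)], which is
     at most 1. *)
  apply: (@le_trans _ _ (step_poly n u * (1 + q ^+ n) ^+ (n * 2 ^ n))).
    rewrite ler_wpM2l ?bernoulli_ge//.
    by case/andP: (step_poly_ge0_le1 n u11).
  rewrite /step_poly -/q -exprMn.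
  have -> : (1 - q ^+ n) * (1 + q ^+ n) = 1 - (q ^+ n) ^+ 2 by ring.
  rewrite exprn_ile1//; last by rewrite gerBl sqr_ge0.
  by rewrite subr_ge0 exprn_ile1.
- exact: cvg_cst.
- exact: cvg_harmonic.
Qed.

End step_polynomials.

(** * Orthogonality and totality of the Hartley functions *)

Section space_time_basis.
Context (R : realType) (n : nat) (L : R).
Hypothesis L_gt0 : 0 < L.

Local Notation X := (spacetime R n).
Local Notation mu := (time_measure L \x torus R n)%E.
Local Notation idx := {ffun 'I_n.+1 -> int}.
Implicit Types (K : idx) (o : 'I_n.+1) (z : X) (f g h : X -> R).

Definition hart K z : R := \prod_o cas (len L o) (K o) (crd o z).

Definition upd K o (v : int) : idx := [ffun i => if i == o then v else K i].

Lemma len_gt0 o : 0 < len L o.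
Proof. by case: (unliftP ord0 o) => [j|] ->; rewrite ?lenS ?len0. Qed.

Lemma hart_upd K o v z : hart (upd K o v) z =
  cas (len L o) v (crd o z) * \prod_(i | i != o) cas (len L i) (K i) (crd i z).
Proof.
rewrite /hart (bigD1 o)//= ffunE eqxx; congr (_ * _).
by apply: eq_bigr => i /negbTE io; rewrite ffunE io.
Qed.

Lemma hartE K o z : hart K z =
  cas (len L o) (K o) (crd o z) * \prod_(i | i != o) cas (len L i) (K i) (crd i z).
Proof. by rewrite /hart (bigD1 o). Qed.

Lemma hartM K o j z : hart K z * cas (len L o) j (crd o z) =
  2^-1 * (hart (upd K o (K o - j)) z + hart (upd K o (j - K o)) z
          + hart (upd K o (K o + j)) z - hart (upd K o (- K o - j)) z).
Proof. by rewrite (hartE K o) !hart_upd mulrAC casM; ring. Qed.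

Lemma bmeas_hart K : bmeas (hart K).
Proof.
by apply: bmeas_prod => o; apply: bmeas_comp (bmeas_cas _ _) (measurable_crd o).
Qed.

Lemma hart_Lsq K : hart K \in Lfun mu 2%:E.
Proof. by apply: bmeas_Lsq; [exact: cylinder_fin|exact: bmeas_hart]. Qed.

Lemma hart0 z : hart [ffun => 0] z = 1.
Proof. by rewrite /hart big1// => o _; rewrite ffunE cas0. Qed.

Lemma hart_orthogonal K K' : ip mu (hart K) (hart K') = L * (K == K')%:R.
Proof.
rewrite /ip; under eq_Rintegral do rewrite /hart -big_split/=.
rewrite (Rintegral_cyl_prod (n := n) L
  (f := fun o t => cas (len L o) (K o) t * cas (len L o) (K' o) t)); last first.
  by move=> o; apply: bmeasM; exact: bmeas_cas.
under eq_bigr do rewrite orthogonal_cas ?len_gt0//.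
rewrite big_split/=; congr (_ * _).
  by rewrite big_ord_recl len0 big1 ?mulr1// => i _; rewrite lenS.
have [->|KK'] := eqVneq K K'; first by rewrite big1// => o _; rewrite eqxx.
have [j Kj] : exists j, K j != K' j.
  apply/existsP; rewrite -negb_forall; apply: contra KK' => /forallP h.
  by apply/eqP/ffunP => j; exact/eqP.
by rewrite (bigD1 j)//= (negbTE Kj) mul0r.
Qed.

Section totality.
Variable f : X -> R.
Hypothesis If : mu.-integrable setT (EFin \o f).

(** [null g] says that [f g] is orthogonal to the whole basis, and [stab h] that multiplication by
    [h] preserves this. The stable functions form an algebra closed under bounded a.e. limits; it
    contains the Hartley functions of one coordinate, hence the indicators of half-spaces. Starting
    from [g = 1], products of these reach all boxes. *)
Let null g := bmeas g /\ forall K, \int[mu]_z (f z * (g z * hart K z)) = 0.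

Let stab h := bmeas h /\ forall g, null g -> null (fun z => g z * h z).

Let If_mul g : bmeas g -> mu.-integrable setT (EFin \o (fun z => f z * g z)).
Proof. by move=> [mg [C gC]]; apply: integrableMb (aeW _ gC). Qed.

Let stabD h h' : stab h -> stab h' -> stab (fun z => h z + h' z).
Proof.
move=> [bh Sh] [bh' Sh']; split=> [|g Ng]; first exact: bmeasD.
have [bgh igh] := Sh _ Ng; have [bgh' igh'] := Sh' _ Ng.
split=> [|K]; first by apply: bmeasM; [exact: Ng.1|exact: bmeasD].
under eq_Rintegral do rewrite mulrDr mulrDl mulrDr.
rewrite RintegralD ?igh ?igh' ?addr0//; apply: If_mul;
  by apply: bmeasM => //; exact: bmeas_hart.
Qed.

Let stabM h h' : stab h -> stab h' -> stab (fun z => h z * h' z).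
Proof.
move=> [bh Sh] [bh' Sh']; split=> [|g /Sh/Sh'[bg ig]]; first exact: bmeasM.
split=> [|K].
  by under eq_fun do rewrite mulrA.
by under eq_Rintegral do rewrite mulrA -[_ * _ * hart _ _]mulrA mulrA; rewrite -(ig K);
  apply: eq_Rintegral => z _; rewrite !mulrA.
Qed.

Let stab_cst c : stab (cst c).
Proof.
split=> [|g [bg ig]]; first exact: bmeas_cst.
split=> [|K]; first by apply: bmeasM => //; exact: bmeas_cst.
transitivity (\int[mu]_z (c * (f z * (g z * hart K z)))).
  by apply: eq_Rintegral => z _ /=; ring.
rewrite RintegralZl ?ig ?mulr0//; apply: If_mul.
by apply: bmeasM => //; exact: bmeas_hart.
Qed.

(** A basis function times a Hartley function of one coordinate is a combination of four basis
    functions, to each of which [null] applies. *)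
Let stab_cas o j : stab (fun z => cas (len L o) j (crd o z)).
Proof.
have bc : bmeas (fun z => cas (len L o) j (crd o z)).
  exact: bmeas_comp (bmeas_cas _ _) (measurable_crd o).
split=> [//|g [bg ig]]; split=> [|K]; first exact: bmeasM.
have I K' : mu.-integrable setT (EFin \o (fun z => f z * (g z * hart K' z))).
  by apply: If_mul; apply: bmeasM => //; exact: bmeas_hart.
pose G K' z := f z * (g z * hart K' z).
transitivity (\int[mu]_z (2^-1 * (G (upd K o (K o - j)) z + G (upd K o (j - K o)) z
          + G (upd K o (K o + j)) z - G (upd K o (- K o - j)) z))).
  apply: eq_Rintegral => z _; rewrite /G -[g z * _ * _]mulrA [cas _ _ _ * _]mulrC hartM.
  ring.
have bG K' := bmeasM bg (bmeas_hart K').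
have I2 K1 K2 := integrableD measurableT (I K1) (I K2).
have I3 K1 K2 K3 := integrableD measurableT (I2 K1 K2) (I K3).
have I4 K1 K2 K3 K4 := integrableB measurableT (I3 K1 K2 K3) (I K4).
rewrite RintegralZl//; last exact: I4.
rewrite RintegralB//; [|exact: I3|exact: I].
rewrite RintegralD//; [|exact: I2|exact: I].
rewrite RintegralD//; [|exact: I..].
by rewrite !ig !addr0 subr0 mulr0.
Qed.

(** Dominated convergence, the dominating function being [C] times the absolute value of the
    integrand without [hn]. *)
Let stab_lim (hn : nat -> X -> R) h (C : R) : bmeas h -> (forall k, stab (hn k)) ->
  (forall k z, `|hn k z| <= C) ->
  {ae mu, forall z, hn k z @[k --> \oo] --> h z} -> stab h.
Proof.
move=> bh Sh hC hcv; split=> // g Ng.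
have bg := Ng.1; split=> [|K]; first exact: bmeasM.
have bgK := bmeasM bg (bmeas_hart K).
have mf : measurable_fun setT f by apply/measurable_EFinP; exact: (measurable_int mu If).
pose u k z := f z * (g z * hn k z * hart K z).
have u0 k : \int[mu]_z u k z = 0 by exact: ((Sh k).2 _ Ng).2.
have Iu k : mu.-integrable setT (EFin \o u k).
  by apply: If_mul; apply: bmeasM; [exact: ((Sh k).2 _ Ng).1|exact: bmeas_hart].
have Id : mu.-integrable setT (fun z => (C * `|f z * (g z * hart K z)|)%:E).
  under eq_fun do rewrite EFinM.
  apply: integrableZl => //; have := integrable_abse (If_mul bgK).
  by apply: eq_integrable => // z _; rewrite /= .
have [||||_ _] := @dominated_convergence _ _ _ mu setT measurableT (fun k => EFin \o u k)
  (fun z => (f z * (g z * h z * hart K z))%:E) _ _ _ _ Id.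
- by move=> k; exact: (measurable_int mu (Iu k)).
- apply/measurable_EFinP; apply: measurable_funM => //.
  by apply: (bmeasM (bmeasM bg bh) (bmeas_hart K)).1.
- apply: filterS hcv => z hz _; apply: cvg_EFin; first exact: nearW.
  apply: cvgM; first exact: cvg_cst.
  apply: cvgM; last exact: cvg_cst.
  by apply: cvgM => //; exact: cvg_cst.
- apply: aeW => z k _; rewrite /= lee_fin /u.
  rewrite (_ : f z * _ = hn k z * (f z * (g z * hart K z))); last ring.
  by rewrite normrM ler_wpM2r.
rewrite [X in X @ \oo --> _](_ : _ = cst 0%E); last first.
  apply/funext => k /=; rewrite -[LHS]fineK; last first.
    by apply: integrable_fin_num => //; exact: Iu.
  by congr EFin; exact: u0.
move=> /(cvg_lim (@ereal_hausdorff R)); rewrite lim_cst// => E.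
by rewrite /Rintegral -E.
Qed.

(** For [c] outside the open period interval the indicator is a.e. constant. Otherwise it is the
    limit of [step_poly] evaluated at a trigonometric polynomial [u] which, on the period interval,
    is positive exactly to the left of [c]. *)
Let stab_ray o (c : R) : stab (fun z => (crd o z < c)%R%:R).
Proof.
have mray (p : R) : bmeas (fun z : X => (crd o z < p)%R%:R : R).
  split; last by exists 1 => z; case: (_ < _); rewrite ?normr1 ?normr0.
  rewrite (_ : (fun _ => _) = \1_[set z | crd o z < p]); last first.
    by apply/funext => z; rewrite indicE/=; congr (_%:R); rewrite mem_setE.
  apply: measurable_indic; rewrite -[X in measurable X]setTI.
  rewrite (_ : [set z | _] = crd o @^-1` `]-oo, p[); last first.
    by rewrite predeqE => z /=; rewrite in_itv.
  by apply: measurable_crd => //; exact: measurable_itv.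
have ae01 := ae_crd_itv n L.
have [c0|c0] := leP c 0.
  apply: (@stab_lim (fun _ => cst 0) _ 0) => // [k z|]; first by rewrite normr0.
  apply: filterS ae01 => z /(_ o) /andP[z0 _].
  by rewrite ltNge (le_trans c0 (ltW z0))/=; exact: cvg_cst.
have [cL|cL] := leP (len L o) c.
  apply: (@stab_lim (fun _ => cst 1) _ 1) => // [k z|]; first by rewrite normr1.
  apply: filterS ae01 => z /(_ o) /andP[_ z1].
  by rewrite (lt_le_trans z1 cL)/=; exact: cvg_cst.
pose l := len L o; have l0 : 0 < l by exact: len_gt0.
(* On []0, l[] the first sine is positive and the second has the sign of [c - t]. Each has half the
   basic frequency, which the basis lacks, but their product involves only the frequencies 0 and 1,
   as [uE] makes explicit. *)
pose u (t : R) := sin (pi * t / l) * sin (pi * (c - t) / l).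
have u1 t : -1 <= u t <= 1.
  by rewrite -ler_norml normrM mulr_ile1 ?sin_max.
have uE t : u t = 2^-1 * (cos (pi * c / l) * (2^-1 * (cas l 1 t + cas l (-1) t))
  + sin (pi * c / l) * (2^-1 * (cas l 1 t + (-1) * cas l (-1) t))
  + (-1) * cos (pi * c / l)).
  rewrite /u /cas; set A := pi * t / l; set p := pi * c / l.
  have -> : freq l 1 * t = A + A by rewrite /freq /A; ring.
  have -> : freq l (-1) * t = - (A + A) by rewrite /freq /A mulrN1z; ring.
  have -> : pi * (c - t) / l = p - A by rewrite /A /p; ring.
  rewrite cosN sinN sinB cosD sinD; apply/eqP; rewrite -subr_eq0; apply/eqP.
  transitivity (- 2^-1 * cos p * (cos A ^+ 2 + sin A ^+ 2 - 1)); first by field.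
  by rewrite cos2Dsin2 subrr mulr0.
have stab_u : stab (fun z => u (crd o z)).
  under eq_fun do rewrite uE.
  apply: stabM; first exact: stab_cst.
  apply: stabD; last exact: stab_cst.
  apply: stabD; apply: stabM; [exact: stab_cst| |exact: stab_cst|];
    apply: stabM; [exact: stab_cst| |exact: stab_cst|]; apply: stabD.
  - exact: stab_cas.
  - exact: stab_cas.
  - exact: stab_cas.
  - by apply: stabM; [exact: stab_cst|exact: stab_cas].
have stab_exp h k : stab h -> stab (fun z => h z ^+ k).
  move=> sh; elim: k => [|k IH].
    by under eq_fun do rewrite expr0; exact: stab_cst.
  by under eq_fun do rewrite exprS; exact: stabM.
have stab_sub h h' : stab h -> stab h' -> stab (fun z => h z - h' z).
  move=> sh sh'; under eq_fun do rewrite -mulN1r.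
  by apply: stabD => //; apply: stabM => //; exact: stab_cst.
apply: (@stab_lim (fun k z => step_poly k (u (crd o z))) _ 1) => //.
- move=> k; apply: (stab_exp); apply: (stab_sub); first exact: stab_cst.
  apply: (stab_exp); apply: (stab_sub); first exact: stab_cst.
  by apply: stabM => //; exact: stab_cst.
- move=> k z; have /andP[p0 p1] := step_poly_ge0_le1 k (u1 (crd o z)).
  by rewrite ger0_norm.
- apply: filterS ae01 => z /(_ o) /andP[z0 z1].
  have -> : (crd o z < c) = (0 < u (crd o z)); last exact: step_poly_cvg.
  set t := crd o z in z0 z1 *.
  have pl0 : 0 < pi / l :> R by rewrite divr_gt0// pi_gt0.
  have s0 : 0 < sin (pi * t / l).
    rewrite sin_gt0_pi// mulrAC mulr_gt0//= -[ltRHS]mulr1 mulrAC -mulrA.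
    by rewrite ltr_pM2l ?pi_gt0// ltr_pdivrMr// mul1r.
  rewrite /u pmulr_rgt0//; have [tc|ct] := ltP t c.
    apply/esym/sin_gt0_pi; rewrite mulrAC mulr_gt0 ?subr_gt0//=.
    rewrite -[ltRHS]mulr1 mulrAC -mulrA ltr_pM2l ?pi_gt0// ltr_pdivrMr// mul1r -/l.
    by rewrite ltrBlDr (lt_le_trans cL)// lerDl ltW.
  apply/esym/negbTE; rewrite -leNgt -oppr_ge0 -sinN.
  have -> : - (pi * (c - t) / l) = pi / l * (t - c) by ring.
  apply: sin_ge0_pi; rewrite mulr_ge0 ?subr_ge0 ?(ltW pl0)//=.
  rewrite -[leRHS]mulr1 -mulrA ler_pM2l ?pi_gt0// mulrC ler_pdivrMr// mul1r.
  by rewrite lerBlDr (le_trans (ltW z1))// lerDl ltW.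
Qed.

(** Stated for integrable [f], a generality that the recognition of functions constant in time
    relies on. *)
Lemma hart_total_integrable : (forall K, \int[mu]_z (f z * hart K z) = 0) ->
  f = cst 0 %[ae mu].
Proof.
move=> fK.
have null1 : null (cst 1).
  by split=> [|K]; [exact: bmeas_cst|under eq_Rintegral do rewrite mul1r].
apply: ae_eq0_ray_boxes => //.
  by rewrite -[RHS](fK [ffun => 0]); apply: eq_Rintegral => z _; rewrite hart0 mulr1.
move=> c; suff [_ /(_ [ffun => 0]) <-] :
    null (fun z => \prod_(o <- index_enum 'I_n.+1) (crd o z < c o)%R%:R).
  by apply: eq_Rintegral => z _; rewrite hart0 mulr1.
elim: index_enum => [|o s IH]; first by under eq_fun do rewrite big_nil.
under eq_fun do rewrite big_cons mulrC.
by have [_] := stab_ray o (c o); apply.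
Qed.

End totality.

Lemma hart_total f : f \in Lfun mu 2%:E ->
  (forall K, ip mu f (hart K) = 0) -> f = cst 0 %[ae mu].
Proof.
by move=> sf; apply: hart_total_integrable; apply: Lsq_integrable => //; exact: cylinder_fin.
Qed.

End space_time_basis.

(** * Parseval's identity, Poincare's inequality and the orthogonality of gradients *)

Lemma cvg_bigsum (R : realType) (I : Type) (s : seq I) (u : I -> nat -> R) (l : I -> R) :
  (forall i, u i n @[n --> \oo] --> l i) ->
  \sum_(i <- s) u i n @[n --> \oo] --> \sum_(i <- s) l i.
Proof.
move=> ul; elim: s => [|i s IH].
  by rewrite big_nil; under eq_fun do rewrite big_nil; exact: cvg_cst.
by rewrite big_cons; under eq_fun do rewrite big_cons; exact: cvgD.
Qed.

Section fourier_series.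
Context (R : realType) (n : nat) (L : R).
Hypothesis L_gt0 : 0 < L.

Local Notation X := (spacetime R n).
Local Notation mu := (time_measure L \x torus R n)%E.
Local Notation idx := {ffun 'I_n.+1 -> int}.
Local Notation ip := (ip mu).
Local Notation Lsq f := (f \in Lfun mu 2%:E).
Local Notation hart := (hart L).
Implicit Types (K : idx) (o : 'I_n.+1) (f g : X -> R).

(** Cubes centred at 0 exhaust the frequencies and are invariant under a change of sign of one
    coordinate. Differentiation changes such a sign, so partial sums over these cubes can be
    reindexed. *)
Definition freq_box (N : nat) : seq idx :=
  [seq [ffun o => (nat_of_ord (f o))%:Z - N%:Z] | f : {ffun 'I_n.+1 -> 'I_(N + N).+1}].

Lemma mem_freq_box N K :
  reflect (forall o, (`|K o| <= N)%N) (K \in freq_box N).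
Proof.
apply: (iffP mapP) => [[f _ ->] o|h].
  by rewrite ffunE; move: (nat_of_ord (f o)) (ltn_ord (f o)) => m; lia.
exists [ffun o => inord (absz (K o + N%:Z))]; first by rewrite mem_enum.
apply/ffunP => o; rewrite !ffunE; move: (K o) (h o) => k hk.
by rewrite inordK; lia.
Qed.

Lemma uniq_freq_box N : uniq (freq_box N).
Proof.
rewrite map_inj_uniq ?enum_uniq// => f g /ffunP fg; apply/ffunP => o.
by apply/val_inj; have := fg o; rewrite !ffunE => /addIr [].
Qed.

Lemma freq_box_incr N M : (N <= M)%N -> {subset freq_box N <= freq_box M}.
Proof.
move=> NM K /mem_freq_box h; apply/mem_freq_box => o; exact: leq_trans (h o) NM.
Qed.

Lemma freq_box_cover K : exists N, K \in freq_box N.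
Proof.
exists (\sum_o `|K o|)%N; apply/mem_freq_box => o.
by rewrite (bigD1 o)//= leq_addr.
Qed.

Definition flip K o : idx := upd K o (- K o).

Lemma flipK o : involutive (flip^~ o).
Proof.
move=> K; apply/ffunP => i; rewrite !ffunE eqxx; case: eqP => [->|//].
by rewrite opprK.
Qed.

Lemma flipE K o : flip K o o = - K o.
Proof. by rewrite ffunE eqxx. Qed.

Lemma sum_freq_box_flip N o (F : idx -> R) :
  \sum_(K <- freq_box N) F (flip K o) = \sum_(K <- freq_box N) F K.
Proof.
rewrite -(big_map (flip^~ o) xpredT F); apply: perm_big; apply: uniq_perm.
- by rewrite map_inj_uniq ?uniq_freq_box//; exact: inv_inj (flipK o).
- exact: uniq_freq_box.
have flip_box K : (K \in freq_box N) -> flip K o \in freq_box N.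
  move=> /mem_freq_box h; apply/mem_freq_box => i; rewrite ffunE.
  by case: ifP => _; rewrite ?abszN; exact: h.
move=> K; apply/mapP/idP => [[K' K'N ->]|KN]; first exact: flip_box.
by exists (flip K o); [exact: flip_box|rewrite flipK].
Qed.

Lemma hart_parseval f g : Lsq f -> Lsq g ->
  \sum_(K <- freq_box N) L^-1 * ip f (hart K) * ip g (hart K) @[N --> \oo] --> ip f g.
Proof.
move=> sf sg.
have := parseval (cylinder_fin L n) (hart_Lsq L (n := n)) L_gt0 (hart_orthogonal L_gt0)
  (hart_total L_gt0 (n := n)) uniq_freq_box freq_box_incr freq_box_cover sf sg.
rewrite (_ : (fun N => ip (proj mu hart L (freq_box N) f) g) = (fun N =>
  \sum_(K <- freq_box N) L^-1 * ip f (hart K) * ip g (hart K)))//.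
by apply/funext => N; rewrite ip_projl//; exact: hart_Lsq.
Qed.

(* [G] is the derivative of [u] in the direction [o], read off on the basis *)
Definition hart_deriv o u G := forall K,
  ip G (hart K) = - (freq (len L o) (K o) * ip u (hart (flip K o))).

Lemma freq_ge1 (k : int) : k != 0 -> 1 <= freq 1 k ^+ 2 :> R.
Proof.
move=> k0; have k1 : 1 <= `|k%:~R| :> R.
  by rewrite -intr_norm -[1]/(1%:~R) ler_int; lia.
rewrite -real_normK ?num_real// exprn_ege1// /freq divr1 normrM.
rewrite [X in X * _]ger0_norm ?mulr_ge0 ?pi_ge0// mulr_ege1//.
by have := pi_ge2 R; lra.
Qed.

(** Compare the partial sums frequency by frequency. On a torus of period 1 a nonzero frequency has
    [freq] at least 1 in absolute value, which gives the constant 1; frequencies with no spatial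
    part are excluded by the last hypothesis. *)
Lemma hart_poincare u (G : 'I_n -> X -> R) : Lsq u -> (forall i, Lsq (G i)) ->
  (forall i, hart_deriv (lift ord0 i) u (G i)) ->
  (forall K, (forall i, K (lift ord0 i) = 0) -> ip u (hart K) = 0) ->
  ip u u <= \sum_i ip (G i) (G i).
Proof.
move=> su sG uG u0.
have cu := hart_parseval su su.
have cG : \sum_i \sum_(K <- freq_box N) L^-1 * ip (G i) (hart K) * ip (G i) (hart K)
    @[N --> \oo] --> \sum_i ip (G i) (G i).
  by apply: cvg_bigsum => i; exact: hart_parseval.
rewrite -(cvg_lim (@Rhausdorff R) cu) -(cvg_lim (@Rhausdorff R) cG).
apply: ler_lim; [by apply/cvg_ex; eexists; exact: cu|by apply/cvg_ex; eexists; exact: cG|].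
apply: nearW => N.
have -> : \sum_i \sum_(K <- freq_box N) L^-1 * ip (G i) (hart K) * ip (G i) (hart K) =
    \sum_(K <- freq_box N) L^-1 * (ip u (hart K) ^+ 2 * \sum_i freq 1 (K (lift ord0 i)) ^+ 2).
  under [RHS]eq_bigr do rewrite mulr_sumr mulr_sumr.
  rewrite [RHS]exchange_big/=; apply: eq_bigr => i _.
  rewrite -[RHS](sum_freq_box_flip N (lift ord0 i)); apply: eq_bigr => K _.
  by rewrite uG lenS flipE freqN; ring.
apply: ler_sum => K _; rewrite -mulrA ler_wpM2l ?invr_ge0 ?(ltW L_gt0)// -expr2.
have [Kall|] := boolP [forall i, K (lift ord0 i) == 0].
  rewrite u0; first by rewrite expr2 !mul0r.
  by move=> i; exact/eqP/(forallP Kall).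
rewrite negb_forall => /existsP[i Ki]; rewrite ler_peMr ?sqr_ge0//.
rewrite (bigD1 i)//=; apply: le_trans (freq_ge1 Ki) _.
by rewrite lerDl; apply: sumr_ge0 => j _; exact: sqr_ge0.
Qed.

(** Each partial sum of the Parseval series already vanishes: after a flip of indices the
    coefficient of [u] factors out, and what it multiplies is the divergence of [g] at that
    frequency. *)
Lemma hart_div_grad_orthogonal u (G g : 'I_n -> X -> R) :
  Lsq u -> (forall i, Lsq (G i)) -> (forall i, Lsq (g i)) ->
  (forall i, hart_deriv (lift ord0 i) u (G i)) ->
  (forall K, \sum_i freq 1 (K (lift ord0 i)) * ip (g i) (hart (flip K (lift ord0 i))) = 0) ->
  \sum_i ip (g i) (G i) = 0.
Proof.
move=> su sG sg uG divg.
have cG : \sum_i \sum_(K <- freq_box N) L^-1 * ip (g i) (hart K) * ip (G i) (hart K)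
    @[N --> \oo] --> \sum_i ip (g i) (G i).
  by apply: cvg_bigsum => i; exact: hart_parseval.
rewrite -(cvg_lim (@Rhausdorff R) cG).
apply: cvg_lim => //; apply: cvg_near_cst; apply: nearW => N.
transitivity (\sum_(K <- freq_box N) L^-1 * (ip u (hart K) *
  \sum_i freq 1 (K (lift ord0 i)) * ip (g i) (hart (flip K (lift ord0 i))))).
  under [RHS]eq_bigr do rewrite mulr_sumr mulr_sumr.
  rewrite [RHS]exchange_big/=; apply: eq_bigr => i _.
  rewrite -[LHS](sum_freq_box_flip N (lift ord0 i)); apply: eq_bigr => K _.
  by rewrite uG lenS flipE freqN flipK; ring.
by rewrite big1// => K _; rewrite divg !mulr0.
Qed.

End fourier_series.

(** * Test functions *)

Section smooth_functions.
Context (R : realType) (U : normedModType R).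
Implicit Types (f g : U -> R) (u v : U).

Lemma smooth_differentiable f : smooth f -> forall x, differentiable f x.
Proof. by move=> sf x; exact: (sf [::]). Qed.

Lemma smooth_derive f v : smooth f -> smooth ('D_v f : U -> R).
Proof. by move=> sf vs x; rewrite -foldr_rcons; exact: sf. Qed.

(** A finite-order form of [smooth] that supports induction: by the Leibniz rule, a product at order
    [m + 1] asks for order [m] of the factors and of their derivatives. *)
Fixpoint smooth_upto m f : Prop :=
  (forall x, differentiable f x) /\
  if m is m'.+1 then forall v, smooth_upto m' ('D_v f : U -> R) else True.

Lemma smooth_uptoP f : (forall m, smooth_upto m f) -> smooth f.
Proof.
move=> sf vs; elim/last_ind: vs f sf => [|vs v IH] f sf.
  by have [] := sf 0%N.
by rewrite foldr_rcons; apply: IH => m; have [_] := sf m.+1; apply.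
Qed.

Lemma smooth_upto_smooth f m : smooth f -> smooth_upto m f.
Proof.
elim: m f => [|m IH] f sf; split=> //; try exact: smooth_differentiable.
by move=> v; apply: IH; exact: smooth_derive.
Qed.

Lemma smooth_uptoW m f : smooth_upto m.+1 f -> smooth_upto m f.
Proof.
elim: m f => [|m IH] f [df Df]; split=> // v.
exact: IH.
Qed.

Lemma smooth_uptoD m f g : smooth_upto m f -> smooth_upto m g -> smooth_upto m (f + g).
Proof.
elim: m f g => [|m IH] f g [df Df] [dg Dg]; split=> //; try by move=> x; exact: differentiableD.
move=> v; rewrite (_ : 'D_v (f + g) = ('D_v f : U -> R) + ('D_v g : U -> R)).
  by apply: IH; [exact: Df|exact: Dg].
by apply/funext => x; rewrite deriveD//; exact: diff_derivable.
Qed.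

Lemma smooth_uptoM m f g : smooth_upto m f -> smooth_upto m g -> smooth_upto m (f * g).
Proof.
elim: m f g => [|m IH] f g.
  by move=> [df _] [dg _]; split=> // x; exact: differentiableM.
move=> /[dup] sf [df Df] /[dup] sg [dg Dg]; split=> [x|v]; first exact: differentiableM.
rewrite (_ : 'D_v (f * g) = f * ('D_v g : U -> R) + g * ('D_v f : U -> R)).
  by apply: smooth_uptoD; apply: IH;
    [exact: smooth_uptoW sf|exact: Dg|exact: smooth_uptoW sg|exact: Df].
by apply/funext => x; rewrite deriveM//; exact: diff_derivable.
Qed.

Lemma smooth_upto_cst m c : smooth_upto m (cst c).
Proof.
elim: m c => [|m IH] c; split => // v.
by rewrite (_ : 'D_v (cst c) = cst 0)//; apply/funext => x; exact: derive_cst.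
Qed.

Lemma smoothM f g : smooth f -> smooth g -> smooth (fun x => f x * g x).
Proof.
by move=> sf sg; apply: smooth_uptoP => m; apply: smooth_uptoM; exact: smooth_upto_smooth.
Qed.

Lemma smooth_cst c : smooth (cst c : U -> R).
Proof. by apply: smooth_uptoP => m; exact: smooth_upto_cst. Qed.

Lemma smooth_prod (I : Type) (s : seq I) (f : I -> U -> R) :
  (forall i, smooth (f i)) -> smooth (fun x => \prod_(i <- s) f i x).
Proof.
move=> sf; elim: s => [|i s IH].
  by under eq_fun do rewrite big_nil; exact: smooth_cst.
by under eq_fun do rewrite big_cons; exact: smoothM.
Qed.

(** The function [a 0] comes with the sequence of all its derivatives, so that the chain rule
    ['D_v (a m \o l) = l v * (a m.+1 \o l)] can be iterated. *)
Lemma smooth_comp_linear (l : U -> R) (a : nat -> R -> R) :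
  (forall u v, l (u + v) = l u + l v) -> (forall h u, l (h *: u) = h * l u) ->
  (forall x, differentiable l x) ->
  (forall m (t : R), is_derive t 1 (a m) (a m.+1 t)) ->
  smooth (a 0%N \o l) /\
  forall v x, 'D_v (a 0%N \o l) x = l v * a 1%N (l x).
Proof.
move=> lD lZ dl da.
have dam m t : differentiable (a m) t by apply/derivable1_diffP; have [] := da m t.
have dal m x : differentiable (a m \o l) x by exact: differentiable_comp.
have Dal m v : 'D_v (a m \o l) = cst (l v) * (a m.+1 \o l).
  apply/funext => x.
  transitivity ('D_(l v) (a m) (l x)).
    rewrite /derive (_ : (fun h => _) =
      (fun h => h^-1 *: ((a m \o shift (l x)) (h *: l v) - a m (l x))))//.
    by apply/funext => h /=; rewrite lD lZ.
  have -> : 'D_(l v) (a m) (l x) = l v *: 'D_1 (a m) (l x).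
    by rewrite !deriveE// -linearZ/= [in RHS]/GRing.scale/= mulr1.
  by have [_ ->] := da m (l x).
split; last by move=> v x; exact: (congr1 (@^~ x) (Dal 0%N v)).
apply: smooth_uptoP => m; elim: m 0%N => [|m IH] k; split => // v.
by rewrite Dal; apply: smooth_uptoM; [exact: smooth_upto_cst|exact: IH].
Qed.

End smooth_functions.

Section coordinate_functions.
Context (R : realType) (n : nat).
Local Notation X := (spacetime R n).

Lemma crdD o (z w : X) : crd o (z + w) = crd o z + crd o w.
Proof.
by case: (unliftP ord0 o) => [j|] ->; rewrite ?crdS ?crd0//= mxE.
Qed.

Lemma crdZ o (h : R) (z : X) : crd o (h *: z) = h * crd o z.
Proof.
by case: (unliftP ord0 o) => [j|] ->; rewrite ?crdS ?crd0//= mxE.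
Qed.

Lemma differentiable_crd (o : 'I_n.+1) (z : X) : differentiable (crd o : X -> R) z.
Proof.
case: (unliftP ord0 o) => [j|] ->.
  rewrite (_ : crd _ = (fun x : 'rV[R]_n => x 0 j) \o snd).
    apply: differentiable_comp; last exact: differentiable_coord.
    by apply: (@linear_differentiable _ _ _ snd) => w; exact: cvg_snd.
  by apply/funext => w; rewrite crdS.
rewrite (_ : crd _ = fst); last by apply/funext => w; rewrite crd0.
by apply: (@linear_differentiable _ _ _ fst) => w; exact: cvg_fst.
Qed.

Lemma crd_dirt o : crd o (dirt R n) = (o == ord0)%:R.
Proof.
by case: (unliftP ord0 o) => [j|] ->; rewrite ?crdS ?crd0//= mxE.
Qed.

Lemma crd_dirx o (i : 'I_n) : crd o (dirx R i) = (o == lift ord0 i)%:R.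
Proof.
case: (unliftP ord0 o) => [j|] ->; rewrite ?crdS ?crd0//= mxE eqxx/=.
by rewrite (inj_eq (lift_inj)).
Qed.

End coordinate_functions.

(* [bump p t = p(1/t) exp(-1/t)] for [t > 0], extended by [0]: this family is
   closed under differentiation. *)
Section bump_function.
Context (R : realType).
Implicit Types (p : {poly R}) (t x : R).

Definition bump p t : R := if 0 < t then p.[t^-1] * expR (- t^-1) else 0.

(** With [s = 1/t], the derivative of [p(s) exp(-s)] in [t] is [s^2 (p(s) - p'(s)) exp(-s)]. *)
Definition bump_step p : {poly R} := 'X^2 * (p - p^`()).

(** Term by term, [x^i] is at most [i! exp(x)]. *)
Lemma poly_expR_bounded p : exists C, forall x, 0 <= x -> `|p.[x]| * expR (- x) <= C.
Proof.
suff [C HC] : exists C, forall x, 0 <= x -> `|p.[x]| <= C * expR x.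
  exists C => x x0; apply: le_trans (ler_wpM2r (ltW (expR_gt0 (- x))) (HC x x0)) _.
  by rewrite -mulrA -expRD subrr expR0 mulr1.
exists (\sum_(i < size p) `|p`_i| * i`!%:R) => x x0.
rewrite horner_coef; apply: le_trans (ler_norm_sum _ _ _) _.
rewrite mulr_suml; apply: ler_sum => i _.
rewrite normrM -mulrA ler_wpM2l// normrX ger0_norm//.
rewrite mulrC -ler_pdivrMr ?ltr0n ?fact_gt0//.
case: (nat_of_ord i) => [|k]; first by rewrite expr0 divr1 -(expR0 R) ler_expR.
by apply: le_trans (expR_ge1Dxn k x0); rewrite lerDr.
Qed.

Lemma is_derive_quadratic (f : R -> R) C : f 0 = 0 ->
  (forall h, `|f h| <= C * h ^+ 2) -> is_derive (0 : R) 1 f 0.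
Proof.
move=> f0 fC; suff cv :
  h^-1 *: ((f \o shift 0) (h *: (1 : R)) - f 0) @[h --> (0 : R)^'] --> (0 : R).
  by apply: DeriveDef; [apply/cvg_ex; exists 0|exact: cvg_lim cv].
have C0 : 0 <= C by have := fC 1; rewrite expr1n mulr1; exact: le_trans.
have C1 : 0 < C + 1 by lra.
apply/cvgr0Pnorm_le => e e0; near=> h.
have h0 : h != 0 by near: h; exact: nbhs_dnbhs_neq.
rewrite /= f0 subr0 addr0 /GRing.scale/= mulr1 normrM normfV.
rewrite ler_pdivrMl ?normr_gt0//; apply: le_trans (fC h) _.
rewrite -real_normK ?num_real// expr2 mulrCA ler_wpM2l//.
apply: (@le_trans _ _ ((C + 1) * `|h|)); first by rewrite ler_wpM2r//; lra.
rewrite mulrC -ler_pdivlMr//.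
by apply: ltW; near: h; apply: dnbhs0_lt; rewrite divr_gt0.
Unshelve. all: by end_near. Qed.

Lemma is_derive_bump p (t : R) : is_derive t 1 (bump p) (bump (bump_step p) t).
Proof.
have [t0|t0|<-] := ltgtP 0 t.
- apply: (@near_eq_is_derive R R R (fun s : R => p.[s^-1] * expR (- s^-1)) (bump p) t 1).
    near=> s; rewrite /bump; suff -> : 0 < s by [].
    by near: s; exact: lt_nbhsr.
  have dV : is_derive t 1 (fun s : R => s^-1) (- t ^- 2).
    have := @is_deriveV R id t 1 1 _ (is_derive_id _ _).
    rewrite gt_eqF//= => /(_ isT) h; apply: is_derive_eq.
    by rewrite /GRing.scale/= mulr1.
  have dp := @is_derive1_comp _ (horner p) (fun s : R => s^-1) t _ _ (is_derive_poly p t^-1) dV.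
  have dE := @is_derive1_comp _ expR (fun s : R => - s^-1) t _ _ (is_derive_expR _) (is_deriveN dV).
  apply: (@is_derive_eq _ _ _ _ _ _ _ _ (is_deriveM dp dE)).
  rewrite /bump t0 /bump_step !hornerE /GRing.scale/=.
  by field; rewrite gt_eqF.
- apply: (@near_eq_is_derive R R R (cst 0) (bump p) t 1).
    near=> s; rewrite /bump; suff -> : (0 < s) = false by [].
    by apply/negbTE; rewrite -leNgt ltW//; near: s; exact: lt_nbhsl.
  by rewrite /bump ltNge (ltW t0)/=; exact: is_derive_cst.
- rewrite {2}/bump ltxx.
  (* At the junction, boundedness of [s^2 p(s) exp(-s)] for [s = 1/h] says that [bump p h] is of
     order [h^2], so its derivative at 0 is 0. *)
  have [C HC] := poly_expR_bounded ('X^2 * p).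
  have C0 : 0 <= C by apply: le_trans (HC 0 (lexx _)); rewrite mulr_ge0 ?expR_ge0.
  apply: (@is_derive_quadratic _ C); first by rewrite /bump ltxx.
  move=> h; rewrite /bump; case: ifPn => [h0|_]; last by rewrite normr0 mulr_ge0 ?sqr_ge0.
  have Hh := HC h^-1; rewrite invr_ge0 (ltW h0) !hornerE in Hh; move: (Hh isT).
  rewrite normrM normrX ger0_norm ?invr_ge0 ?(ltW h0)// exprVn -mulrA.
  by rewrite ler_pdivrMl ?exprn_gt0// (mulrC C) normrM (@ger0_norm _ (expR _)) ?expR_ge0.
Unshelve. all: by end_near. Qed.

End bump_function.

Section smooth_line.
Context (R : realType).

Lemma smooth_seq (a : nat -> R -> R) :
  (forall m (t : R), is_derive t 1 (a m) (a m.+1 t)) ->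
  smooth (a 0%N : R -> R) /\ 'D_1 (a 0%N : R -> R) = a 1%N.
Proof.
move=> da; have idd (x : R) : differentiable (id : R -> R) x by [].
have [sa Da] := @smooth_comp_linear R R id a (fun _ _ => erefl) (fun _ _ => erefl) idd da.
split; first exact: sa.
by apply/funext => x; have [_ ->] := da 0%N x.
Qed.

Lemma smooth_comp_linear_line (U : normedModType R) (l : U -> R) (a : R -> R) :
  (forall u v, l (u + v) = l u + l v) -> (forall h u, l (h *: u) = h * l u) ->
  (forall x, differentiable l x) -> smooth a ->
  smooth (a \o l) /\ forall v x, 'D_v (a \o l) x = l v * 'D_1 a (l x).
Proof.
move=> lD lZ dl sa.
pose A m := iter m (fun f : R -> R => 'D_1 f : R -> R) a.
have dA m (t : R) : is_derive t 1 (A m) (A m.+1 t).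
  have dm : differentiable (A m) t.
    have -> : A m = foldr (fun v f => 'D_v f : R -> R) a (nseq m 1).
      by rewrite /A; elim: m => //= m ->.
    exact: sa.
  by apply: DeriveDef => //; exact/derivable1_diffP.
exact: smooth_comp_linear lD lZ dl dA.
Qed.

Lemma smooth_cas L k : smooth (cas L k : R -> R).
Proof.
pose A := fix A m (j : int) : R -> R :=
  if m is m'.+1 then fun t => freq L j * A m' (- j) t else cas L j.
have dA m : forall j (t : R), is_derive t 1 (A m j) (A m.+1 j t).
  elim: m => [|m IH] j t; first exact: is_derive_cas.
  have := IH (- j) t => h.
  have := is_deriveM (is_derive_cst (freq L j) t 1) h => h'.
  by apply: (is_derive_eq h'); rewrite /= scaler0 addr0.
exact: (smooth_seq (fun m t => dA m k t)).1.
Qed.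

Lemma smooth_bump (p : {poly R}) (al be : R) :
  smooth ((fun t => bump p (al * t + be)) : R -> R) /\
  'D_1 ((fun t => bump p (al * t + be)) : R -> R) =
    (fun t => al * bump (bump_step p) (al * t + be)).
Proof.
pose A m (t : R) := al ^+ m * bump (iter m (@bump_step R) p) (al * t + be).
have dA m (t : R) : is_derive t 1 (A m) (A m.+1 t).
  have dl : is_derive t 1 (fun s : R => al * s + be) al.
    by apply: is_derive_eq; rewrite /GRing.scale/= mulr1 addr0.
  have dB := @is_derive1_comp _ _ (fun s : R => al * s + be) t _ _
    (is_derive_bump (iter m (@bump_step R) p) (al * t + be)) dl.
  have := is_deriveM (is_derive_cst (al ^+ m) t 1) dB => h.
  apply: (is_derive_eq h).
  by rewrite /= scaler0 addr0 /A exprSr /GRing.scale/=; ring.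
have [] := smooth_seq dA.
rewrite (_ : A 0%N = (fun t => bump p (al * t + be))); last first.
  by apply/funext => t; rewrite /A expr0 mul1r.
move=> s0 ->; split=> //; apply/funext => t; by rewrite /A expr1.
Qed.

End smooth_line.

(** * Test functions of product form *)

Section tensor_tests.
Context (R : realType) (n : nat).
Local Notation X := (spacetime R n).
Implicit Types (f : 'I_n.+1 -> R -> R) (a : R -> R) (k : 'I_n -> int) (z : X).

Definition dir (o : 'I_n.+1) : X := oapp (@dirx R n) (dirt R n) (unlift ord0 o).

Lemma dir0 : dir ord0 = dirt R n. Proof. by rewrite /dir unlift_none. Qed.

Lemma dirS i : dir (lift ord0 i) = dirx R i. Proof. by rewrite /dir liftK. Qed.

Lemma crd_dir (o o' : 'I_n.+1) : crd o' (dir o) = (o' == o)%:R.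
Proof.
by case: (unliftP ord0 o) => [j|] ->; rewrite ?dirS ?dir0 ?crd_dirx ?crd_dirt.
Qed.

Lemma smooth_comp_crd a (o : 'I_n.+1) : smooth a ->
  smooth (fun z : X => a (crd o z)) /\
  forall v z, 'D_v (fun z : X => a (crd o z)) z = crd o v * 'D_1 a (crd o z).
Proof.
move=> sa; apply: (@smooth_comp_linear_line _ _ (crd o : X -> R)) => //.
- exact: crdD.
- exact: crdZ.
- exact: differentiable_crd.
Qed.

Lemma smooth_crd_prod f (P : pred 'I_n.+1) : (forall o, smooth (f o)) ->
  smooth (fun z : X => \prod_(o | P o) f o (crd o z)).
Proof.
move=> sf; under eq_fun do rewrite big_mkcond; apply: smooth_prod => o.
by case: (P o); [exact: (smooth_comp_crd o (sf o)).1|exact: smooth_cst].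
Qed.

Lemma derive_crd_prod_other f o z : (forall o, smooth (f o)) ->
  'D_(dir o) (fun z : X => \prod_(j | j != o) f j (crd j z)) z = 0.
Proof.
move=> sf; rewrite /index_enum; move: (Finite.enum _) => s.
suff : smooth (fun z : X => \prod_(j <- s | j != o) f j (crd j z)) /\
    'D_(dir o) (fun z : X => \prod_(j <- s | j != o) f j (crd j z)) z = 0 by case.
elim: s => [|j s [sF DF]].
  under eq_fun do rewrite big_nil.
  by split; [exact: smooth_cst|exact: derive_cst].
have [jo|jo] := eqVneq j o.
  rewrite (_ : (fun z : X => \prod_(i <- j :: s | i != o) f i (crd i z)) =
    (fun z : X => \prod_(i <- s | i != o) f i (crd i z)))//.
  by apply/funext => w; rewrite big_cons jo eqxx.
under eq_fun do rewrite big_cons jo.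
have [sj Dj] := smooth_comp_crd j (sf j).
split; first exact: smoothM.
rewrite deriveM; [|exact/diff_derivable/smooth_differentiable..].
by rewrite DF scaler0 add0r Dj crd_dir (negbTE jo) mul0r scaler0.
Qed.

Lemma derive_crd_prod f o z : (forall o, smooth (f o)) ->
  'D_(dir o) (fun z : X => \prod_j f j (crd j z)) z =
  'D_1 (f o) (crd o z) * \prod_(j | j != o) f j (crd j z).
Proof.
move=> sf; under eq_fun do rewrite (bigD1 o)//=.
have [so Do] := smooth_comp_crd o (sf o).
rewrite deriveM; [|apply/diff_derivable/smooth_differentiable..] => //.
- by rewrite derive_crd_prod_other// scaler0 add0r Do crd_dir eqxx mul1r mulrC.
- exact: smooth_crd_prod.
Qed.

Definition tens_factor a k (o : 'I_n.+1) : R -> R :=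
  oapp (fun i => cas 1 (k i)) a (unlift ord0 o).

(** Hartley functions in space provide periodicity, and the time factor [a] is left free so that
    compact support in time can be imposed on it. *)
Definition tens a k z : R := \prod_o tens_factor a k o (crd o z).

Definition flips k i : 'I_n -> int := fun j => if j == i then - k j else k j.

Lemma tens_factor0 a k : tens_factor a k ord0 = a.
Proof. by rewrite /tens_factor unlift_none. Qed.

Lemma tens_factorS a k i : tens_factor a k (lift ord0 i) = cas 1 (k i).
Proof. by rewrite /tens_factor liftK. Qed.

Lemma smooth_tens_factor a k o : smooth a -> smooth (tens_factor a k o).
Proof.
move=> sa; case: (unliftP ord0 o) => [j|] ->; rewrite ?tens_factorS ?tens_factor0//.
exact: smooth_cas.
Qed.

Lemma tensE a k z : tens a k z = a z.1 * \prod_(i < n) cas 1 (k i) (z.2 0 i).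
Proof.
rewrite /tens big_ord_recl tens_factor0 crd0; congr (_ * _).
by apply: eq_bigr => i _; rewrite tens_factorS crdS.
Qed.

Lemma derive_tens_x a k i z : smooth a ->
  'D_(dirx R i) (tens a k) z = freq 1 (k i) * tens a (flips k i) z.
Proof.
move=> sa; rewrite -dirS derive_crd_prod; last by move=> o; exact: smooth_tens_factor.
rewrite tens_factorS; have [_ ->] := is_derive_cas 1 (k i) (crd (lift ord0 i) z).
rewrite /tens [in RHS](bigD1 (lift ord0 i))//=.
rewrite tens_factorS /flips eqxx mulrA; congr (_ * _); apply: eq_bigr => o oi.
case: (unliftP ord0 o) oi => [j|] -> oi; rewrite ?tens_factorS ?tens_factor0//.
by rewrite (inj_eq lift_inj) in oi; rewrite (negbTE oi).
Qed.

Lemma derive_tens_t a k z : smooth a ->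
  'D_(dirt R n) (tens a k) z = tens ('D_1 a) k z.
Proof.
move=> sa; rewrite -dir0 derive_crd_prod; last by move=> o; exact: smooth_tens_factor.
rewrite tens_factor0 /tens [in RHS](bigD1 ord0)//= tens_factor0; congr (_ * _).
apply: eq_bigr => o; case: (unliftP ord0 o) => [j|] ->; last by rewrite eqxx.
by rewrite !tens_factorS.
Qed.

Lemma cyl_test_tens L a k (al be : R) : smooth a -> 0 < al -> be < L ->
  (forall t, ~~ (al <= t <= be) -> a t = 0) -> cyl_test L (tens a k).
Proof.
move=> sa al0 beL a0; split.
- by apply: smooth_crd_prod => o; exact: smooth_tens_factor.
- move=> i z; rewrite !tensE/= addr0; congr (_ * _).
  apply: eq_bigr => j _; rewrite !mxE eqxx/= eq_sym.
  by case: eqP => _; [rewrite cas_period|rewrite addr0].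
- by exists al, be; split => // t x h; rewrite tensE/= a0// mul0r.
Qed.

Lemma bmeas_tens a k : bmeas a -> bmeas (tens a k).
Proof.
move=> ba; apply: bmeas_prod => o.
have bf : bmeas (tens_factor a k o).
  case: (unliftP ord0 o) => [j|] ->; rewrite ?tens_factorS ?tens_factor0//.
  exact: bmeas_cas.
exact: bmeas_comp bf (measurable_crd o).
Qed.

Lemma hart_tens L (K : {ffun 'I_n.+1 -> int}) :
  hart L K = tens (cas L (K ord0)) (fun i => K (lift ord0 i)).
Proof.
apply/funext => z; apply: eq_bigr => o _.
by case: (unliftP ord0 o) => [j|] ->; rewrite ?tens_factorS ?tens_factor0 ?lenS ?len0.
Qed.

Lemma flip_flips (K : {ffun 'I_n.+1 -> int}) i :
  (fun j => flip K (lift ord0 i) (lift ord0 j)) = flips (fun j => K (lift ord0 j)) i.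
Proof.
by apply/funext => j; rewrite ffunE (inj_eq lift_inj) /flips; case: eqP => [->|].
Qed.

End tensor_tests.

Lemma bounded_cvg_Rintegral d (X : measurableType d) (R : realType)
    (mu : {measure set X -> \bar R}) (f h : X -> R) (hn : nat -> X -> R) (C : R) :
  mu.-integrable setT (EFin \o f) ->
  (forall N, measurable_fun setT (hn N)) -> measurable_fun setT h ->
  {ae mu, forall x, forall N, `|hn N x| <= C} ->
  {ae mu, forall x, hn N x @[N --> \oo] --> h x} ->
  \int[mu]_x (f x * hn N x) @[N --> \oo] --> \int[mu]_x (f x * h x).
Proof.
move=> If mhn mh hC hcv.
have mf : measurable_fun setT f by apply/measurable_EFinP; exact: measurable_int If.
have hnC N : {ae mu, forall x, `|hn N x| <= C} by apply: filterS hC => x; apply.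
have IN N : mu.-integrable setT (EFin \o (fun x => f x * hn N x)).
  exact: integrableMb (hnC N).
have Id : mu.-integrable setT (fun x => (C * `|f x|)%:E).
  under eq_fun do rewrite EFinM.
  apply: integrableZl => //; have := integrable_abse If.
  exact: eq_integrable.
have [||||If' _ cv] := @dominated_convergence _ _ _ mu setT measurableT
  (fun N => EFin \o (fun x => f x * hn N x)) (fun x => (f x * h x)%:E) _ _ _ _ Id.
- by move=> N; exact: (measurable_int mu (IN N)).
- by apply/measurable_EFinP; exact: measurable_funM.
- apply: filterS hcv => x hx _; apply: cvg_EFin; first exact: nearW.
  by apply: cvgM => //; exact: cvg_cst.
- apply: filterS hC => x hx N _; rewrite /= lee_fin normrM mulrC.
  by rewrite ler_wpM2r.
by apply: fine_cvg; rewrite fineK//; exact: integrable_fin_num If'.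
Qed.

(** * Cutoff functions in time *)

Section time_cutoffs.
Context (R : realType) (L : R).
Hypothesis L_gt0 : 0 < L.
Implicit Types (t s x : R) (N : nat).

Let e := @bump R 1.
Let e' := @bump R (bump_step 1).

Lemma bump1_ge0_le1 s : 0 <= e s <= 1.
Proof.
rewrite /e /bump; case: ifPn => [s0|_]; last by rewrite lexx ler01.
by rewrite hornerC mul1r expR_ge0/= expRN invf_le1 ?expR_gt0// -(expR0 R) ler_expR invr_ge0 ltW.
Qed.

Lemma bump1'E s : e' s = if 0 < s then s^-1 ^+ 2 * expR (- s^-1) else 0.
Proof.
by rewrite /e' /bump /bump_step -polyC1 derivC subr0 !hornerE.
Qed.

Lemma bump1'_ge0 s : 0 <= e' s.
Proof.
by rewrite bump1'E; case: ifP => // s0; rewrite mulr_ge0 ?expR_ge0 ?sqr_ge0.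
Qed.

(** At [s = N t - 1] the quantity [(1 + s) e'(s)] is [N t e'(N t - 1)]: the growth of the derivative
    of a cutoff is absorbed by a factor vanishing linearly at the end of the interval. *)
Lemma bump1'_bound : exists C, forall s, (1 + s) * e' s <= C.
Proof.
have [C HC] := poly_expR_bounded ('X ^+ 2 + 'X : {poly R}).
exists C => s; rewrite bump1'E; case: ifPn => [s0|_].
  have y0 : 0 <= s^-1 by rewrite invr_ge0 ltW.
  have Hs := HC _ y0; rewrite !hornerE in Hs.
  apply: le_trans Hs; rewrite (@ger0_norm _ (_ + _)) ?addr_ge0 ?sqr_ge0//.
  rewrite mulrA ler_wpM2r ?expR_ge0// mulrDl mul1r lerD2l.
  by rewrite expr2 mulrA mulfV ?mul1r// gt_eqF.
rewrite mulr0; apply: le_trans (HC 0 (lexx _)).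
by rewrite mulr_ge0 ?expR_ge0.
Qed.

Lemma bump1'_decay s : 0 < s -> (1 + s) * e' s <= s^-1 ^+ 2 + s^-1.
Proof.
move=> s0; rewrite bump1'E s0.
have E1 : expR (- s^-1) <= 1.
  by rewrite expRN invf_le1 ?expR_gt0// -(expR0 R) ler_expR invr_ge0 ltW.
rewrite mulrA -[leRHS]mulr1 ler_pM ?expR_ge0 ?mulr_ge0 ?addr_ge0 ?invr_ge0 ?sqr_ge0 ?(ltW s0)//.
by rewrite mulrDl mul1r lerD2l expr2 mulrA mulfV ?mul1r// gt_eqF.
Qed.

(** It vanishes within [1 / (N + 1)] of both ends and tends to 1 in the interior, because
    [exp(-1/s)] tends to 1 as [s] grows. It has no plateau; pointwise convergence with values in
    [[0, 1]] is all that dominated convergence asks for. *)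
Definition cutoff N t : R :=
  e (N.+1%:R * t + (-1)) * e (- N.+1%:R * t + (N.+1%:R * L - 1)).

Definition cutoff' N t : R :=
  e (N.+1%:R * t + (-1)) * (- N.+1%:R * e' (- N.+1%:R * t + (N.+1%:R * L - 1))) +
  e (- N.+1%:R * t + (N.+1%:R * L - 1)) * (N.+1%:R * e' (N.+1%:R * t + (-1))).

Lemma smooth_cutoff N : smooth (cutoff N : R -> R).
Proof. by apply: smoothM; exact: (smooth_bump 1 _ _).1. Qed.

Lemma is_derive_cutoff N t : is_derive t 1 (cutoff N) (cutoff' N t).
Proof.
have [s1 d1] := smooth_bump (1 : {poly R}) N.+1%:R (-1).
have [s2 d2] := smooth_bump (1 : {poly R}) (- N.+1%:R) (N.+1%:R * L - 1).
have D1 : is_derive t 1 (fun t => e (N.+1%:R * t + (-1)))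
    (N.+1%:R * e' (N.+1%:R * t + (-1))).
  apply: DeriveDef; first exact/diff_derivable/smooth_differentiable.
  exact: (congr1 (@^~ t) d1).
have D2 : is_derive t 1 (fun t => e (- N.+1%:R * t + (N.+1%:R * L - 1)))
    (- N.+1%:R * e' (- N.+1%:R * t + (N.+1%:R * L - 1))).
  apply: DeriveDef; first exact/diff_derivable/smooth_differentiable.
  exact: (congr1 (@^~ t) d2).
exact: is_deriveM D1 D2.
Qed.

Lemma cutoff_supp N t : ~~ (N.+1%:R^-1 <= t <= L - N.+1%:R^-1) -> cutoff N t = 0.
Proof.
rewrite negb_and -!ltNge => /orP[h|h]; rewrite /cutoff /e /bump.
  rewrite [X in if X then _ else _](_ : _ = false) ?mul0r//.
  apply/negbTE; rewrite -leNgt subr_le0 -ler_pdivlMl// mulr1; exact: ltW.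
rewrite [X in _ * (if X then _ else _)](_ : _ = false) ?mulr0//.
have H : N.+1%:R * (L - t) <= 1.
  by rewrite -ler_pdivlMl// mulr1 lerBlDr addrC -lerBlDr; exact: ltW.
by apply/negbTE; rewrite -leNgt mulNr; rewrite mulrBr in H; lra.
Qed.

Lemma cutoff_ge0_le1 N t : 0 <= cutoff N t <= 1.
Proof.
have /andP[a0 a1] := bump1_ge0_le1 (N.+1%:R * t + (-1)).
have /andP[b0 b1] := bump1_ge0_le1 (- N.+1%:R * t + (N.+1%:R * L - 1)).
by rewrite /cutoff mulr_ge0//= mulr_ile1.
Qed.

Lemma affine_large (c : R) : 0 < c -> \forall N \near \oo,
  0 < N.+1%:R * c - 1 /\ (N.+1%:R * c - 1)^-1 <= 2 / c * N.+1%:R^-1.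
Proof.
move=> c0; have c2 : 0 < c / 2 by rewrite divr_gt0.
have /cvgr0Pnorm_lt/(_ _ c2) := @cvg_harmonic R.
apply: filterS => N; rewrite /harmonic/= ger0_norm ?invr_ge0// => H.
have N2 : 2 < N.+1%:R * c.
  by rewrite -[_^-1]mul1r ltr_pdivrMr// in H; lra.
split; first lra.
rewrite (_ : 2 / c * _ = (N.+1%:R * c / 2)^-1).
  by rewrite lef_pV2 ?posrE; lra.
by rewrite !invfM invrK; ring.
Qed.

Lemma cvg_harmonicZ (c : R) : c * N.+1%:R^-1 @[N --> \oo] --> (0 : R).
Proof.
by rewrite -[X in _ --> X](mulr0 c); apply: cvgM; [exact: cvg_cst|exact: cvg_harmonic].
Qed.

Lemma cvg_affine_bump (c : R) : 0 < c ->
  e (N.+1%:R * c - 1) @[N --> \oo] --> (1 : R).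
Proof.
move=> c0; apply: (@squeeze_cvgr _ _ _ _ (fun N => 1 - 2 / c * N.+1%:R^-1) (cst 1)).
- have := affine_large c0; apply: filterS => N [s0 sN].
  have /andP[_ ->] := bump1_ge0_le1 (N.+1%:R * c - 1); rewrite andbT.
  rewrite /e /bump s0 hornerC mul1r; apply: le_trans (expR_ge1Dx _).
  by rewrite lerD2l lerN2.
- by rewrite -[X in _ --> X]subr0; apply: cvgB; [exact: cvg_cst|exact: cvg_harmonicZ].
- exact: cvg_cst.
Qed.

Lemma cutoff_reflect N t :
  - N.+1%:R * t + (N.+1%:R * L - 1) = N.+1%:R * (L - t) - 1.
Proof. by ring. Qed.

Lemma cutoff_cvg t : 0 < t < L -> cutoff N t @[N --> \oo] --> (1 : R).
Proof.
move=> /andP[t0 tL]; rewrite -[X in _ --> X]mulr1; apply: cvgM.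
  exact: cvg_affine_bump.
under eq_fun do rewrite cutoff_reflect.
by apply: cvg_affine_bump; rewrite subr_gt0.
Qed.

Lemma cvg_affine_bump' (c : R) : 0 < c ->
  (N.+1%:R * c) * e' (N.+1%:R * c - 1) @[N --> \oo] --> (0 : R).
Proof.
move=> c0; pose r N := 2 / c * N.+1%:R^-1.
apply: (@squeeze_cvgr _ _ _ _ (cst 0) (fun N => r N * r N + r N)).
- have := affine_large c0; apply: filterS => N [s0 sN].
  rewrite mulr_ge0 ?bump1'_ge0 ?mulr_ge0 ?(ltW c0)//=.
  have := bump1'_decay s0; rewrite [1 + _]addrC subrK => H.
  apply: le_trans H _; apply: lerD => //.
  by rewrite expr2 ler_pM ?invr_ge0 ?(ltW s0).
- exact: cvg_cst.
- have : r N * r N + r N @[N --> \oo] --> (0 * 0 + 0 : R).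
    by apply: cvgD; [apply: cvgM|]; exact: cvg_harmonicZ.
  by rewrite mulr0 addr0.
Qed.

(** Each half of [cutoff'] is paired with the estimate of [Q] at the end where it concentrates. The
    resulting terms are uniformly bounded and tend to 0 at interior points, which the next two
    lemmas extract. *)
Lemma cutoff'_mul_le (Q : R -> R) (D : R) : 0 <= D ->
  (forall t, 0 <= t <= L -> `|Q t| <= D * t /\ `|Q t| <= D * (L - t)) ->
  forall N t, 0 <= t <= L -> `|cutoff' N t * Q t| <=
    D * (N.+1%:R * t * e' (N.+1%:R * t - 1)) +
    D * (N.+1%:R * (L - t) * e' (N.+1%:R * (L - t) - 1)).
Proof.
move=> D0 QD N t tL; have [Q1 Q2] := QD t tL.
rewrite /cutoff' cutoff_reflect.
have /andP[a0 a1] := bump1_ge0_le1 (N.+1%:R * t + (-1)).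
have /andP[b0 b1] := bump1_ge0_le1 (N.+1%:R * (L - t) - 1).
have d0 := bump1'_ge0 (N.+1%:R * t + (-1)).
have f0 := bump1'_ge0 (N.+1%:R * (L - t) - 1).
rewrite mulrDl addrC; apply: le_trans (ler_normD _ _) _; apply: lerD.
  rewrite !normrM !(ger0_norm a0, ger0_norm b0, ger0_norm d0, ger0_norm f0) normr_nat.
  rewrite -mulrA -[leRHS]mul1r ler_pM ?mulr_ge0//.
  rewrite (_ : D * _ = N.+1%:R * e' (N.+1%:R * t - 1) * (D * t)); last by ring.
  by rewrite ler_wpM2l// mulr_ge0.
rewrite !normrM normrN !(ger0_norm a0, ger0_norm b0, ger0_norm d0, ger0_norm f0) normr_nat.
rewrite -mulrA -[leRHS]mul1r ler_pM ?mulr_ge0//.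
rewrite (_ : D * _ = N.+1%:R * e' (N.+1%:R * (L - t) - 1) * (D * (L - t))); last by ring.
by rewrite ler_wpM2l// mulr_ge0.
Qed.

Lemma cutoff'_mul_bounded (Q : R -> R) (D : R) : 0 <= D ->
  (forall t, 0 <= t <= L -> `|Q t| <= D * t /\ `|Q t| <= D * (L - t)) ->
  exists C, forall N t, 0 <= t <= L -> `|cutoff' N t * Q t| <= C.
Proof.
move=> D0 QD; have [C HC] := bump1'_bound; exists (D * C + D * C) => N t tL.
apply: le_trans (cutoff'_mul_le D0 QD N tL) _; apply: lerD; rewrite ler_wpM2l//.
- by have := HC (N.+1%:R * t - 1); rewrite [1 + _]addrC subrK.
- by have := HC (N.+1%:R * (L - t) - 1); rewrite [1 + _]addrC subrK.
Qed.

Lemma cutoff'_mul_cvg (Q : R -> R) (D : R) t : 0 <= D ->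
  (forall t, 0 <= t <= L -> `|Q t| <= D * t /\ `|Q t| <= D * (L - t)) ->
  0 < t < L -> cutoff' N t * Q t @[N --> \oo] --> (0 : R).
Proof.
move=> D0 QD /andP[t0 tL]; apply/cvgr0Pnorm_le => eps eps0.
have cv : D * (N.+1%:R * t * e' (N.+1%:R * t - 1)) +
    D * (N.+1%:R * (L - t) * e' (N.+1%:R * (L - t) - 1)) @[N --> \oo] --> D * 0 + D * (0 : R).
  apply: cvgD; apply: cvgM; [exact: cvg_cst| |exact: cvg_cst|]; apply: cvg_affine_bump' => //.
  by rewrite subr_gt0.
rewrite mulr0 addr0 in cv; move/cvgr0Pnorm_le : cv => /(_ _ eps0).
apply: filterS => N; apply: le_trans; apply: le_trans (ler_norm _).
by apply: cutoff'_mul_le => //; rewrite !ltW.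
Qed.

End time_cutoffs.

(** * Measurability and integrability of continuous functions *)

Section continuous_spacetime.
Context (R : realType) (n : nat).
Local Notation X := (spacetime R n).
Implicit Types (f : X -> R) (z : X).

Definition grid N (t : R) : R := N.+1%:R^-1 * (Num.floor (N.+1%:R * t))%:~R.

Lemma grid_dist N t : `|t - grid N t| <= N.+1%:R^-1.
Proof.
have /andP[h1 h2] := floor_itv (N.+1%:R * t); rewrite intrD1 in h2.
have N0 : 0 < N.+1%:R :> R by [].
rewrite /grid -[X in `|X - _|](mulKf (lt0r_neq0 N0)) -mulrBr normrM.
rewrite ger0_norm ?invr_ge0// -[leRHS]mulr1 ler_wpM2l ?invr_ge0//.
by rewrite ger0_norm; lra.
Qed.

Definition grid_point N z : X := (grid N z.1, \row_i grid N (z.2 0 i)).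

Lemma grid_point_cvg z : grid_point N z @[N --> \oo] --> z.
Proof.
have cg (t : R) : grid N t @[N --> \oo] --> t.
  apply/cvgrPdist_le => e e0.
  have /cvgr0Pnorm_le/(_ _ e0) := @cvg_harmonic R.
  apply: filterS => N; rewrite /harmonic/= ger0_norm ?invr_ge0//.
  exact: le_trans (grid_dist N t).
have cx : (\row_i grid N (z.2 ord0 i) : 'rV[R]_n) @[N --> \oo] --> z.2; last first.
  by case: z cx => t x cx; exact: (cvg_pair (cg t) cx).
apply/cvg_ballP => e e0.
have /cvgr0Pnorm_lt/(_ _ e0) := @cvg_harmonic R.
apply: filterS => N; rewrite /harmonic/= ger0_norm ?invr_ge0// => Ne; split=> // i j.
by rewrite ord1 mxE /ball/=; apply: le_lt_trans Ne; exact: grid_dist.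
Qed.

(* ['rV_n] carries the product sigma-algebra, not a priori the Borel one: a
   continuous function is the limit of its compositions with [grid_point N],
   which has countably many values. *)
Lemma continuous_measurable_spacetime f : continuous f -> measurable_fun setT f.
Proof.
move=> cf; apply: (measurable_fun_cvg (h := fun N => f \o grid_point N)); last first.
  by move=> z _; exact: (@cvg_comp _ _ _ (fun N => grid_point N z) f _ _ _
    (@grid_point_cvg z) (cf z)).
move=> N _ Y mY; rewrite setTI.
pose kap z : {ffun 'I_n.+1 -> int} := [ffun o => Num.floor (N.+1%:R * crd o z)].
pose pt (m : {ffun 'I_n.+1 -> int}) : X :=
  (N.+1%:R^-1 * (m ord0)%:~R, \row_i (N.+1%:R^-1 * (m (lift ord0 i))%:~R)).
have ptE z : grid_point N z = pt (kap z).
  rewrite /grid_point /pt /grid !ffunE crd0; congr pair.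
  by apply/rowP => i; rewrite !mxE ffunE crdS.
have mkap (m : {ffun 'I_n.+1 -> int}) : measurable (kap @^-1` [set m]).
  rewrite (_ : kap @^-1` _ = \bigcap_(o in [set: 'I_n.+1]) (setT `&`
     @crd R n o @^-1` [set` `[N.+1%:R^-1 * (m o)%:~R, N.+1%:R^-1 * (m o + 1)%:~R[])); last first.
    rewrite predeqE => z; split => [<- o _|h].
      split => //=; rewrite in_itv/= ffunE.
      by rewrite ler_pdivrMl// ltr_pdivlMl//; exact: floor_itv.
    apply/ffunP => o; rewrite ffunE; apply: floor_def.
    by have [_] := h o Logic.I; rewrite /= in_itv/= ler_pdivrMl// ltr_pdivlMl.
  apply: fin_bigcap_measurable => // o _.
  by apply: measurable_crd => //; exact: measurable_itv.
rewrite (_ : _ @^-1` Y = \bigcup_(m in [set: {ffun 'I_n.+1 -> int}])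
    (kap @^-1` [set m] `&` [set _ | Y (f (pt m))])); last first.
  rewrite predeqE => z; split => [h|[m _ [<-]]]; last by rewrite /= ptE.
  by exists (kap z) => //; split => //; rewrite -ptE.
apply: countable_bigcupT_measurable => [|m]; first exact: countableP.
apply: measurableI => //.
have [h|h] := pselect (Y (f (pt m))).
  by rewrite (_ : [set _ | _] = setT) ?predeqE.
by rewrite (_ : [set _ | _] = set0)// predeqE.
Qed.

(** Almost every point lies in the compact set [[0, T] x [0, 1]^n]. *)
Lemma continuous_bounded_cylinder f T : continuous f ->
  exists C, {ae (time_measure T \x torus R n)%E, forall z, `|f z| <= C}.
Proof.
move=> cf.
pose A : set X := (`[0, T]%classic : set R) `*`
  [set v : 'rV[R]_n | forall i, (`[0, 1]%classic : set R) (v ord0 i)].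
have cA : compact A.
  apply: compact_setX; first exact: segment_compact.
  by apply: (@rV_compact R n (fun=> (`[0, 1]%classic : set R))) => _; exact: segment_compact.
have /compact_bounded[C [_ HC]] : compact (f @` A).
  by apply: continuous_compact => //; exact: continuous_subspaceT.
exists (C + 1); have := ae_crd_itv n T; apply: filterS => z hz.
apply: (HC (C + 1)); first by rewrite ltrDl.
exists z => //; split => /=.
  by have := hz ord0; rewrite crd0 len0 in_itv/= => /andP[/ltW -> /ltW ->].
by move=> i; have := hz (lift ord0 i); rewrite crdS lenS in_itv/= => /andP[/ltW -> /ltW ->].
Qed.

Lemma smooth_continuous (phi : X -> R) : smooth phi -> continuous phi.
Proof. by move=> sp z; apply: differentiable_continuous; exact: smooth_differentiable. Qed.

Lemma smooth_Lsq T (phi : X -> R) : smooth phi ->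
  phi \in Lfun (time_measure T \x torus R n)%E 2%:E.
Proof.
move=> /smooth_continuous cp; have [C HC] := continuous_bounded_cylinder T cp.
apply: Lsq_bounded HC; [exact: cylinder_fin|exact: continuous_measurable_spacetime].
Qed.

End continuous_spacetime.

(** * Weak derivatives *)

Section weak_derivatives.
Context (R : realType) (n : nat) (T : R).
Hypothesis T_gt0 : 0 < T.

Local Notation X := (spacetime R n).
Local Notation mu := (time_measure T \x torus R n)%E.
Local Notation idx := {ffun 'I_n.+1 -> int}.
Local Notation ip := (ip mu).
Local Notation Lsq f := (f \in Lfun mu 2%:E).
Local Notation hart := (hart T).
Implicit Types (K : idx) (f g u w : X -> R) (a : R -> R) (k : 'I_n -> int).

Lemma bmeas_smooth_cutoff N : bmeas (cutoff T N).
Proof.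
split; last by exists 1 => t; have /andP[h0 h1] := cutoff_ge0_le1 T N t; rewrite ger0_norm.
apply: continuous_measurable_fun => t; apply: differentiable_continuous.
by apply: smooth_differentiable; exact: smooth_cutoff.
Qed.

Lemma cyl_test_cutoff N a k : smooth a -> cyl_test T (tens (fun t => cutoff T N t * a t) k).
Proof.
move=> sa; apply: (@cyl_test_tens _ _ _ _ _ N.+1%:R^-1 (T - N.+1%:R^-1)).
- by apply: smoothM => //; exact: smooth_cutoff.
- by rewrite invr_gt0.
- by rewrite gtrBl invr_gt0.
- by move=> t /cutoff_supp ->; rewrite mul0r.
Qed.

Lemma tens_cutoff N a k z :
  tens (fun t => cutoff T N t * a t) k z = tens a k z * cutoff T N z.1.
Proof. by rewrite !tensE; ring. Qed.

Lemma integrable_mul_tens f a k : mu.-integrable setT (EFin \o f) -> bmeas a ->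
  mu.-integrable setT (EFin \o (fun z => f z * tens a k z)).
Proof.
by move=> If ba; have [mt [C tC]] := bmeas_tens k ba; apply: integrableMb (aeW _ tC).
Qed.

Lemma cvg_tens_cutoff f a k : mu.-integrable setT (EFin \o f) -> bmeas a ->
  \int[mu]_z (f z * tens (fun t => cutoff T N t * a t) k z) @[N --> \oo] -->
  \int[mu]_z (f z * tens a k z).
Proof.
move=> If ba; under eq_fun do under eq_Rintegral do rewrite tens_cutoff mulrA.
have -> : \int[mu]_z (f z * tens a k z) = \int[mu]_z (f z * tens a k z * 1).
  by apply: eq_Rintegral => z _; rewrite mulr1.
apply: (bounded_cvg_Rintegral (C := 1) (integrable_mul_tens k If ba)).
- by move=> N; exact: measurableT_comp (bmeas_smooth_cutoff N).1 measurable_fst.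
- exact: measurable_cst.
- apply: aeW => z N; have /andP[h0 h1] := cutoff_ge0_le1 T N z.1.
  by rewrite ger0_norm.
- have := ae_crd_itv n T; apply: filterS => z /(_ ord0); rewrite crd0 len0.
  exact: cutoff_cvg.
Qed.

(** A Hartley function multiplied by a cutoff in time is a test function. As the cutoffs tend to 1,
    orthogonality passes to the whole basis, which is total. *)
Lemma test_total f : mu.-integrable setT (EFin \o f) ->
  (forall phi, cyl_test T phi -> \int[mu]_z (f z * phi z) = 0) -> f = cst 0 %[ae mu].
Proof.
move=> If f0; apply: (hart_total_integrable T_gt0) => // K.
have := cvg_tens_cutoff (k := fun i => K (lift ord0 i)) If (bmeas_cas T (K ord0)).
rewrite -hart_tens => /(cvg_lim (@Rhausdorff R)) <-.
apply: cvg_lim => //; apply: cvg_near_cst; apply: nearW => N.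
by apply: f0; apply: cyl_test_cutoff; exact: smooth_cas.
Qed.

(** The cutoff depends on time only, so a space derivative commutes with it and no error term arises
    when it is removed. *)
Lemma wderiv_hart_deriv i u g : Lsq u -> Lsq g -> is_wderiv T (dirx R i) u g ->
  hart_deriv T (lift ord0 i) u g.
Proof.
move=> su sg ug K; rewrite !lenS.
have fT := cylinder_fin T n.
set k := fun j => K (lift ord0 j); set a := cas T (K ord0).
have cg := cvg_tens_cutoff (k := k) (Lsq_integrable fT sg) (bmeas_cas T (K ord0)).
have cu := cvg_tens_cutoff (k := flips k i) (Lsq_integrable fT su) (bmeas_cas T (K ord0)).
rewrite /ip hart_tens -/a -/k.
rewrite (_ : hart (flip K (lift ord0 i)) = tens a (flips k i)); last first.
  by rewrite hart_tens flip_flips ffunE.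
rewrite -(cvg_lim (@Rhausdorff R) cg); apply: cvg_lim => //.
rewrite (_ : (fun N => \int[mu]_z (g z * tens (fun t => cutoff T N t * a t) k z)) = fun N =>
  - (freq 1 (K (lift ord0 i)) *
     \int[mu]_z (u z * tens (fun t => cutoff T N t * a t) (flips k i) z))).
  by apply: cvgN; apply: cvgM => //; exact: cvg_cst.
apply/funext => N.
have sca : smooth ((fun t => cutoff T N t * a t) : R -> R).
  by apply: smoothM; [exact: smooth_cutoff|exact: smooth_cas].
have := ug _ (cyl_test_cutoff N k (smooth_cas T (K ord0))).
move/(congr1 -%R); rewrite opprK => <-; congr (- _).
rewrite -RintegralZl//; last first.
  apply: integrable_mul_tens; first exact: Lsq_integrable.
  by apply: bmeasM; [exact: bmeas_smooth_cutoff|exact: bmeas_cas].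
by apply: eq_Rintegral => z _; rewrite derive_tens_x//; ring.
Qed.

Lemma derive_supp a (al be t : R) : (forall t, ~~ (al <= t <= be) -> a t = 0) ->
  ~~ (al <= t <= be) -> 'D_1 a t = 0.
Proof.
move=> a0 tn; rewrite (@near_eq_derive R R R a (cst 0) t 1); first exact: derive_cst.
move: tn; rewrite negb_and -!ltNge => /orP[h|h]; near=> s; apply: a0.
- by rewrite negb_and -!ltNge; apply/orP; left; near: s; exact: lt_nbhsl.
- by rewrite negb_and -!ltNge; apply/orP; right; near: s; exact: lt_nbhsr.
Unshelve. all: by end_near. Qed.

(** The divergence constraint is applied to the time derivative of a test function. Time and space
    derivatives commute on tensor products, so this moves one derivative onto [lam] and shows [g]
    divergence free at every frequency. *)
Lemma div_free_dt_hart (lam : X -> 'rV[R]_n) (g : 'I_n -> X -> R) K :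
  (forall i, Lsq (component lam i)) -> (forall i, Lsq (g i)) ->
  (forall i, is_wderiv T (dirt R n) (component lam i) (g i)) -> div_free T lam ->
  \sum_i freq 1 (K (lift ord0 i)) * ip (g i) (hart (flip K (lift ord0 i))) = 0.
Proof.
move=> sl sg lg dl; have fT := cylinder_fin T n.
set k := fun j => K (lift ord0 j); set a := cas T (K ord0).
pose b N t := cutoff T N t * a t.
have sb N : smooth (b N : R -> R).
  by apply: smoothM; [exact: smooth_cutoff|exact: smooth_cas].
have cv : \sum_i freq 1 (k i) * \int[mu]_z (g i z * tens (b N) (flips k i) z)
    @[N --> \oo] --> \sum_i freq 1 (k i) * \int[mu]_z (g i z * tens a (flips k i) z).
  apply: cvg_bigsum => i; apply: cvgM; first exact: cvg_cst.
  by apply: cvg_tens_cutoff (bmeas_cas T (K ord0)); exact: Lsq_integrable.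
transitivity (\sum_i freq 1 (k i) * \int[mu]_z (g i z * tens a (flips k i) z)).
  apply: eq_bigr => i _; rewrite (_ : hart (flip K (lift ord0 i)) = tens a (flips k i))//.
  by rewrite hart_tens flip_flips ffunE.
rewrite -(cvg_lim (@Rhausdorff R) cv); apply: cvg_lim => //.
apply: cvg_near_cst; apply: nearW => N.
have sDb : smooth ('D_1 (b N) : R -> R) by exact: smooth_derive.
have tD k' : cyl_test T (tens ('D_1 (b N) : R -> R) k').
  apply: (@cyl_test_tens _ _ _ _ _ N.+1%:R^-1 (T - N.+1%:R^-1)).
  - exact: sDb.
  - by rewrite invr_gt0.
  - by rewrite gtrBl invr_gt0.
  - move=> t; apply: derive_supp => s /cutoff_supp.
    by rewrite /b => ->; rewrite mul0r.
apply/eqP; rewrite -oppr_eq0; apply/eqP; rewrite -[RHS](dl _ (tD k)) -sumrN.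
have It i k' : mu.-integrable setT (EFin \o (fun z =>
    lam z 0 i * tens ('D_1 (b N) : R -> R) k' z)).
  apply: (integrableM (sl i)); apply: smooth_Lsq.
  by have [] : cyl_test T (tens ('D_1 (b N) : R -> R) k'); first exact: tD.
rewrite Rintegral_sum; last first.
  move=> i; apply: eq_integrable (_ : mu.-integrable setT (EFin \o (fun z =>
    freq 1 (k i) * (lam z 0 i * tens ('D_1 (b N) : R -> R) (flips k i) z)))) => //.
    by move=> z _; rewrite /= derive_tens_x//; congr EFin; ring.
  exact: (integrableZl measurableT (freq 1 (k i)) (It i (flips k i))).
apply: eq_bigr => i _; rewrite -mulrN.
have := lg i _ (cyl_test_cutoff N (flips k i) (smooth_cas T (K ord0))).
rewrite -/(b N) => <-.
rewrite -RintegralZl//; last first.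
  apply: eq_integrable (_ : mu.-integrable setT (EFin \o (fun z =>
    lam z 0 i * tens ('D_1 (b N) : R -> R) (flips k i) z))) => //.
    by move=> z _; rewrite /= derive_tens_t.
apply: eq_Rintegral => z _; rewrite derive_tens_t// derive_tens_x// /component; ring.
Qed.

End weak_derivatives.

(** * Functions with vanishing weak time derivative *)

Section constant_in_time.
Context (R : realType) (n : nat) (T : R).
Hypothesis T_gt0 : 0 < T.

Local Notation X := (spacetime R n).
Local Notation mu := (time_measure T \x torus R n)%E.
Implicit Types (w : X -> R) (k : 'I_n -> int) (m : int).

Lemma cas_lipschitz m s t : s <= t ->
  `|cas T m t - cas T m s| <= `|freq T m| * 2 * (t - s).
Proof.
move=> st.
have [r _ ->] := @MVT_segment R (cas T m) (fun x => freq T m * cas T (- m) x) s t st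
  (fun x _ => is_derive_cas T m x) (continuous_subspaceT (@continuous_cas R T m)).
rewrite !normrM ler_pM// ?ler_pM ?mulr_ge0// ?cas_le2// ger0_norm// subr_ge0//.
Qed.

(** The antiderivative of [cas T m] normalized to vanish at 0; by periodicity it vanishes at [T] as
    well. *)
Definition cas_primitive m t := - (freq T m)^-1 * (cas T (- m) t - cas T (- m) 0).

Lemma freq_neq0 m : m != 0 -> freq T m != 0.
Proof.
move=> m0; rewrite /freq; apply: mulf_neq0; last by rewrite invr_eq0 gt_eqF.
by apply: mulf_neq0; [rewrite gt_eqF ?mulr_gt0 ?pi_gt0|rewrite intr_eq0].
Qed.

Lemma is_derive_cas_primitive m (t : R) : m != 0 ->
  is_derive t 1 (cas_primitive m) (cas T m t).
Proof.
move=> m0; have := is_derive_cas T (- m) t; rewrite opprK freqN => h.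
have h1 := @is_deriveB R R R _ (cst (cas T (- m) 0)) t 1 _ _ h (is_derive_cst _ _ _).
have h2 := @is_deriveZ R R R _ (- (freq T m)^-1) t 1 _ h1.
apply: is_derive_eq h2 _; rewrite subr0 /GRing.scale/= mulrA mulrNN mulVf ?mul1r//.
exact: freq_neq0.
Qed.

Lemma smooth_antiderivative (Q q : R -> R) :
  (forall t : R, is_derive t 1 Q (q t)) -> smooth (q : R -> R) -> smooth (Q : R -> R).
Proof.
move=> Qq sq; have dQ t : differentiable (Q : R -> R) t.
  by apply/derivable1_diffP; have [] := Qq t.
move=> vs x; case/lastP: vs => [|vs v]; first exact: dQ.
rewrite foldr_rcons (_ : 'D_v _ = fun t : R => cst v t * q t).
  by apply: smoothM => //; exact: smooth_cst.
apply/funext => t; rewrite -[X in 'D_X _ _]mulr1 deriveE// linearZ -deriveE//=.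
by have [_ ->] := Qq t.
Qed.

Lemma smooth_cas_primitive m : m != 0 -> smooth (cas_primitive m : R -> R).
Proof.
move=> m0; apply: (smooth_antiderivative (fun t => is_derive_cas_primitive t m0)).
exact: smooth_cas.
Qed.

Lemma cas_primitive_bound m t : m != 0 -> 0 <= t <= T ->
  `|cas_primitive m t| <= 2 * t /\ `|cas_primitive m t| <= 2 * (T - t).
Proof.
move=> m0 /andP[t0 tT]; have f0 := freq_neq0 m0.
have nf : `|freq T (- m)| = `|freq T m| by rewrite freqN normrN.
rewrite /cas_primitive normrM normrN normfV; split.
  rewrite ler_pdivrMl ?normr_gt0//; have := cas_lipschitz (- m) t0.
  by rewrite nf subr0 mulrA.
rewrite -(cas_period (- m) 0 (lt0r_neq0 T_gt0)) add0r distrC.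
rewrite ler_pdivrMl ?normr_gt0//; have := cas_lipschitz (- m) tT.
by rewrite nf mulrA.
Qed.

(* For [m != 0], [cas T m] is the derivative of a function vanishing at both 0
   and [T], hence is reached by derivatives of compactly supported functions. *)
Lemma wderiv_dt0_osc w m k : mu.-integrable setT (EFin \o w) ->
  is_wderiv T (dirt R n) w (cst 0) -> m != 0 ->
  \int[mu]_z (w z * tens (cas T m) k z) = 0.
Proof.
move=> Iw w0 m0.
pose Q := cas_primitive m; pose b N t := cutoff T N t * Q t.
have sb N : smooth (b N : R -> R).
  by apply: smoothM; [exact: smooth_cutoff|exact: smooth_cas_primitive m0].
(* The second term of the product rule stays bounded and tends to 0, since [Q] vanishes linearly at
   both ends; the first tends to [cas T m]. *)
have Db N t : 'D_1 (b N) t = cutoff T N t * cas T m t + cutoff' T N t * Q t.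
  have h := @is_deriveM R R (cutoff T N) Q t 1 _ _ (is_derive_cutoff T N t)
    (is_derive_cas_primitive t m0).
  by rewrite (@derive_val _ _ _ _ _ _ _ h)/= /GRing.scale/= [Q t * _]mulrC.
have mDb N : measurable_fun setT ('D_1 (b N) : R -> R).
  apply: continuous_measurable_fun => t; apply: differentiable_continuous.
  by apply: smooth_differentiable; exact: smooth_derive.
have [C HC] := cutoff'_mul_bounded (ler0n _ _) (fun t => cas_primitive_bound m0).
pose f z := w z * tens (cst 1) k z.
have If : mu.-integrable setT (EFin \o f) by apply: integrable_mul_tens => //; exact: bmeas_cst.
have cv : \int[mu]_z (f z * 'D_1 (b N) z.1) @[N --> \oo] -->
    \int[mu]_z (f z * cas T m z.1).
  apply: (bounded_cvg_Rintegral (C := 2 + C) If).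
  - by move=> N; exact: measurableT_comp (mDb N) measurable_fst.
  - exact: measurableT_comp (measurable_cas T m) measurable_fst.
  - have := ae_crd_itv n T; apply: filterS => z /(_ ord0); rewrite crd0 len0.
    move=> /andP[z0 zT] N; rewrite Db (le_trans (ler_normD _ _))// lerD//.
      rewrite normrM -[leRHS]mul1r ler_pM// ?cas_le2//.
      by have /andP[h0 h1] := cutoff_ge0_le1 T N z.1; rewrite ger0_norm.
    by apply: HC; rewrite !ltW.
  - have := ae_crd_itv n T; apply: filterS => z /(_ ord0); rewrite crd0 len0 => zT.
    under eq_fun do rewrite Db.
    have c1 : cutoff T N z.1 * cas T m z.1 @[N --> \oo] --> 1 * cas T m z.1.
      by apply: cvgM; [exact: cutoff_cvg|exact: cvg_cst].
    have c2 : cutoff' T N z.1 * Q z.1 @[N --> \oo] --> (0 : R).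
      exact: (cutoff'_mul_cvg (ler0n _ _) (fun t => @cas_primitive_bound m t m0) zT).
    by have := cvgD c1 c2; rewrite mul1r addr0; apply.
rewrite (_ : \int[mu]_z _ = \int[mu]_z (f z * cas T m z.1)); last first.
  by apply: eq_Rintegral => z _; rewrite /f !tensE/=; ring.
rewrite -(cvg_lim (@Rhausdorff R) cv); apply: cvg_lim => //.
apply: cvg_near_cst; apply: nearW => N.
have := w0 _ (cyl_test_cutoff T N k (smooth_cas_primitive m0)).
rewrite [X in _ = - X](_ : _ = 0); last first.
  by under eq_Rintegral do rewrite mul0r; rewrite Rintegral_cst// mul0r.
rewrite oppr0 => <-; apply: eq_Rintegral => z _.
by rewrite derive_tens_t; [rewrite /f !tensE/= -/(b N); ring|exact: (sb N)].
Qed.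

Definition time_mean w (x : 'rV[R]_n) : R := T^-1 * \int[time_measure T]_t w (t, x).

(** The difference of [w] and its time mean is orthogonal to the basis: modes oscillating in time
    are orthogonal to [w] and integrate to 0 against a function of [x], and on modes constant in
    time [w] and its mean agree by Fubini's theorem. *)
Lemma wderiv_dt0 w : mu.-integrable setT (EFin \o w) ->
  is_wderiv T (dirt R n) w (cst 0) -> w = time_mean w \o snd %[ae mu].
Proof.
move=> Iw w0; set c := time_mean w.
have [I1 I2] := Rfubini2 Iw.
have Ic : (torus R n).-integrable setT (EFin \o c) by exact: (integrableZl measurableT T^-1 I1).
have I0 : (time_measure T).-integrable setT (EFin \o cst 1).
  by apply: bmeas_integrable; [exact: time_measure_fin|exact: bmeas_cst].
have [Ics _] := Rintegral_prodM I0 Ic.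
have Icm : mu.-integrable setT (EFin \o (c \o snd)).
  by apply: eq_integrable Ics => // z _; rewrite /= mul1r.
suff : (fun z => w z - c z.2) = cst 0 %[ae mu].
  by apply: filterS => z h _; apply/eqP; rewrite -subr_eq0; apply/eqP; exact: h.
apply: (hart_total_integrable T_gt0); first by have := integrableB measurableT Iw Icm.
move=> K; have fT := cylinder_fin T n.
have bh := bmeas_hart T K.
pose h (x : 'rV[R]_n) := \prod_(i < n) cas 1 (K (lift ord0 i)) (x 0 i).
have hE z : hart T K z = cas T (K ord0) z.1 * h z.2 by rewrite hart_tens tensE.
have bh' : bmeas h.
  apply: bmeas_prod => i; apply: (bmeas_comp (bmeas_cas 1 _)).
  exact: measurable_coord.
have Im f : mu.-integrable setT (EFin \o f) ->
  mu.-integrable setT (EFin \o (fun z => f z * hart T K z)).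
  by move=> If; case: bh => mh [C hC]; exact: integrableMb (aeW _ hC).
have Ich : (torus R n).-integrable setT (EFin \o (fun x => c x * h x)).
  by case: bh' => mh [C hC]; exact: integrableMb (aeW _ hC).
under eq_Rintegral do rewrite mulrBl.
rewrite RintegralB//; [|exact: Im|exact: Im].
have cK : \int[mu]_z (c z.2 * hart T K z) = T * (K ord0 == 0)%:R * \int[torus R n]_x (c x * h x).
  rewrite -(integral_cas _ T_gt0).
  have Ik : (time_measure T).-integrable setT (EFin \o cas T (K ord0)).
    by apply: bmeas_integrable; [exact: time_measure_fin|exact: bmeas_cas].
  have [_ <-] := Rintegral_prodM Ik Ich.
  by apply: eq_Rintegral => z _; rewrite hE; ring.
rewrite cK; have [K0|K0] := eqVneq (K ord0) 0; last first.
  rewrite mulr0 mul0r subr0 hart_tens; exact: wderiv_dt0_osc.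
rewrite mulr1; apply/eqP; rewrite subr_eq0; apply/eqP.
have [I3 ->] := Rfubini2 (Im _ Iw).
rewrite -RintegralZl//.
apply: ae_eq_Rintegral.
- by have /integrableP[/measurable_EFinP] := I3.
- by have /integrableP[/measurable_EFinP mm _] := Ich; exact: measurable_funM.
- have := ae_integrable2 Iw; apply: filterS => x Ix _.
  rewrite mulrA /c /time_mean mulVKf ?gt_eqF// -RintegralZr//.
  by apply: eq_Rintegral => t _; rewrite hE K0 cas0 mul1r.
Qed.

End constant_in_time.

(** * Primitives in time and traces *)

(** Tonelli's theorem applied to the positive and negative parts gives measurability in [y] without
    integrability of the slices. *)
Lemma measurable_Rintegral_fst d1 d2 (X : measurableType d1) (Y : measurableType d2)
    (R : realType) (m : {sigma_finite_measure set X -> \bar R}) (f : X * Y -> R) :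
  measurable_fun setT f -> measurable_fun setT (fun y => \int[m]_x f (x, y)).
Proof.
move=> mf; have mF : measurable_fun setT (EFin \o f) by exact/measurable_EFinP.
rewrite /Rintegral; apply: measurableT_comp => //.
rewrite (_ : (fun _ => _) = fun y => (fubini_G m (fun z => (EFin \o f)^\+ z) y -
    fubini_G m (fun z => (EFin \o f)^\- z) y)%E); last first.
  by apply/funext => y; rewrite integralE /fubini_G; congr (_ - _)%E;
  apply: eq_integral => x _; rewrite ?funeposE ?funenegE.
apply: emeasurable_funB; apply: measurable_fun_fubini_tonelli_G => //.
- exact: measurable_funepos.
- exact: measurable_funeneg.
Qed.

Lemma ae_le_integrable d (X : measurableType d) (R : realType)
    (mu : {measure set X -> \bar R}) (f g : X -> R) : measurable_fun setT f ->
  mu.-integrable setT (EFin \o g) -> {ae mu, forall x, 0 <= f x <= g x} ->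
  mu.-integrable setT (EFin \o f) /\ \int[mu]_x f x <= \int[mu]_x g x.
Proof.
move=> mf Ig fg; have /integrableP[/measurable_EFinP mg _] := Ig.
(* Clipping turns the a.e. inequalities into inequalities valid everywhere and keeps
   measurability. *)
pose h x := Num.max 0 (Num.min (f x) (g x)).
pose g' x := Num.max 0 (g x).
have mh : measurable_fun setT h.
  by apply: measurable_maxr => //; exact: measurable_minr.
have mg' : measurable_fun setT g' by exact: measurable_maxr.
have hf : h = f %[ae mu].
  apply: filterS fg => x /andP[f0 fgx] _; rewrite /h (min_idPl fgx).
  exact/max_idPr.
have gg' : g = g' %[ae mu].
  apply: filterS fg => x /andP[f0 fgx] _; rewrite /g'; apply/esym/max_idPr.
  exact: le_trans fgx.
have Ig' := integrable_ae_eq mg' gg' Ig.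
have hg' x : `|h x| <= g' x.
  rewrite ger0_norm /h /g'; last by rewrite le_max lexx.
  by rewrite ge_max !le_max !ge_min !lexx !orbT.
have Ih : mu.-integrable setT (EFin \o h).
  apply: (le_integrable measurableT _ _ Ig'); first exact/measurable_EFinP.
  by move=> x _; rewrite /= lee_fin (le_trans (hg' x))// ler_norm.
have If := integrable_ae_eq mf hf Ih.
split => //; rewrite -(ae_eq_Rintegral mh mf hf) (ae_eq_Rintegral mg mg' gg').
apply: le_Rintegral => // x _; exact: le_trans (ler_norm _) (hg' x).
Qed.

Lemma Lnorm2E d (X : measurableType d) (R : realType) (mu : {measure set X -> \bar R})
    (f : X -> R) : f \in Lfun mu 2%:E ->
  Lnorm mu 2%:E (fun x => (f x)%:E) = (Num.sqrt (ip mu f f))%:E.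
Proof.
move=> /LsqP[mf If]; rewrite unlock -powR12_sqrt ?ip_ge0// -poweR_EFin; congr (_ `^ _)%E.
rewrite /ip /Rintegral fineK; last first.
  have := integrable_fin_num measurableT If; rewrite /=.
  by under eq_integral do rewrite expr2.
by apply: eq_integral => x _; rewrite /= powR_mulrn// -normrX ger0_norm ?expr2// sqr_ge0.
Qed.

(** * Full-measure sets of times and the fundamental theorem of calculus *)

Section time_slices.
Context (R : realType) (T : R).
Hypothesis T_gt0 : 0 < T.

Lemma time_measure_itv_co (s t : R) : 0 <= s -> s <= t -> t <= T ->
  time_measure T `[s, t[%classic = (t - s)%:E.
Proof.
move=> s0 st tT; rewrite /time_measure /mfrestr/= /mrestr setIidl; last first.
  move=> x /=; rewrite !in_itv/= => /andP[sx xt].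
  by rewrite (le_trans s0 sx) (le_trans (ltW xt) tT).
rewrite [LHS]lebesgue_measure_itv/= lte_fin; case: ltP => // ts.
by congr EFin; apply/eqP; rewrite eq_sym subr_eq0 eq_le ts st.
Qed.

(** Otherwise an interval of positive length next to [t] would be null. It is taken to the right of
    [t], except at [t = T], where it lies to the left. *)
Lemma ae_time_dense (P : R -> Prop) (t e : R) : {ae time_measure T, forall s, P s} ->
  0 <= t <= T -> 0 < e -> exists s, [/\ 0 <= s <= T, `|s - t| < e & P s].
Proof.
move=> aeP /andP[t0 tT] e0; apply: contrapT => /forallNP noP.
have [a [b [a0 ab bT abt]]] : exists a b, [/\ 0 <= a, a < b, b <= T &
    forall s, a <= s -> s < b -> `|s - t| < e].
  have [tT'|Tt] := ltP t T.
    exists t, (Num.min T (t + e)); split => //.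
    - by rewrite lt_min tT' ltrDl.
    - by rewrite ge_min lexx.
    - by move=> s ts; rewrite lt_min => /andP[_ h]; rewrite ger0_norm ?subr_ge0//; lra.
  exists (Num.max 0 (t - e / 2)), t; split => //.
  - by rewrite le_max lexx.
  - by rewrite gt_max (lt_le_trans T_gt0 Tt)/=; lra.
  - move=> s; rewrite ge_max => /andP[_ h] st; rewrite ler0_norm ?subr_le0 ?ltW//; lra.
have [A [mA A0 PA]] := aeP.
have : (time_measure T `[a, b[%classic <= time_measure T A)%E.
  apply: le_measure; rewrite ?inE//.
  move=> s /=; rewrite in_itv/= => /andP[as_ sb]; apply: PA => Ps; apply: (noP s); split => //.
    by rewrite (le_trans a0 as_) (le_trans (ltW sb) bT).
  exact: abt.
rewrite time_measure_itv_co ?(ltW ab)//.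
rewrite [X in (_ <= X)%E](_ : _ = 0%E)// lee_fin subr_le0 leNgt ab//.
Qed.

Lemma Rintegral_time_lt (f : R -> R) (s : R) : continuous f -> 0 < s < T ->
  \int[time_measure T]_t ((t <= s)%R%:R * f t) =
  fine (\int[lebesgue_measure]_(t in `[0%R, s]) (f t)%:E)%E.
Proof.
move=> cf /andP[s0 sT]; rewrite /Rintegral integral_time_measure; last first.
  apply/measurable_EFinP/measurable_funM; last exact: continuous_measurable_fun.
  rewrite (_ : (fun _ => _) = \1_(`]-oo, s]%classic)); last first.
    apply/funext => t; rewrite indicE; congr (nat_of_bool _)%:R.
    by apply/idP/idP; rewrite ?inE /= in_itv.
  exact: measurable_indic.
congr fine; have -> : `[0, s]%classic = (`[0, T] `&` `]-oo, s])%classic :> set R.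
  rewrite predeqE => t; rewrite /= !in_itv/=; split => [/andP[t0 ts]|[/andP[t0 _] ts]].
    by rewrite t0 (le_trans ts (ltW sT)).
  by rewrite t0 ts.
rewrite integral_mkcondr; apply: eq_integral => t _; rewrite patchE.
case: (leP t s) => ts; first by rewrite mem_set ?mul1r//= in_itv.
by rewrite memNset ?mul0r//= in_itv/= leNgt ts.
Qed.

Lemma FTC_time (f f' : R -> R) (s : R) : (forall t : R, is_derive t 1 f (f' t)) ->
  continuous f' -> 0 < s < T ->
  \int[time_measure T]_t ((t <= s)%R%:R * f' t) = f s - f 0.
Proof.
move=> df cf' sT; rewrite Rintegral_time_lt//; have /andP[s0 _] := sT.
have cF (x : R) : {for x, continuous f}.
  by apply: differentiable_continuous; apply/derivable1_diffP; have [] := df x.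
rewrite (continuous_FTC2 (F := f) s0)//.
- exact/continuous_subspaceT.
- split.
  + by move=> x _; have [] := df x.
  + by apply: cvg_at_right_filter; exact: cF.
  + by apply: cvg_at_left_filter; exact: cF.
- by move=> x _; rewrite derive1E; have [_ ->] := df x.
Qed.

End time_slices.

(** * The primitive in time vanishing at the final time *)

Section primitive.
Context (R : realType) (n : nat) (T : R).
Hypothesis T_gt0 : 0 < T.

Local Notation X := (spacetime R n).
Local Notation tm := (time_measure T).
Local Notation tor := (torus R n).
Local Notation mu := (time_measure T \x torus R n)%E.
Local Notation Lsq f := (f \in Lfun mu 2%:E).
Implicit Types (g u w : X -> R) (c : 'rV[R]_n -> R).

#[local] Existing Instance ae_time_filter.

(** This is minus the integral of [g] from [t] to [T]. The indicator under an integral over the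
    whole interval makes measurability in [(t, x)] an instance of the theorem on parameter
    integrals. *)
Definition prim g (z : X) : R := - \int[tm]_s ((z.1 <= s)%R%:R * g (s, z.2)).

Local Notation mR := (measurableTypeR R).

Lemma measurable_le : measurable_fun setT (fun p : mR * mR => (p.1 <= p.2)%R%:R : R).
Proof.
rewrite (_ : (fun _ => _) = \1_([set p : mR * mR | (p.1 <= p.2)%R])); last first.
  by apply/funext => p; rewrite indicE; congr (nat_of_bool _)%:R; apply/idP/idP; rewrite inE.
apply: measurable_indic.
have := @measurable_fun_ler _ _ R setT (@fst mR mR) (@snd mR mR) measurable_fst measurable_snd.
by move=> /(_ measurableT [set true] I); rewrite setTI.
Qed.

Lemma bmeas_le_l (t : R) : bmeas (fun s : mR => (t <= s)%R%:R : R).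
Proof.
split; last by exists 1 => s; case: (t <= s); rewrite ?normr1 ?normr0.
exact: measurableT_comp measurable_le (pair1_measurable t).
Qed.

Lemma measurable_prim g : measurable_fun setT g -> measurable_fun setT (prim g).
Proof.
move=> mg; apply: measurable_funN.
apply: (@measurable_Rintegral_fst _ _ _ _ _ tm
  (fun p : mR * X => (p.2.1 <= p.1)%R%:R * g (p.1, p.2.2))).
apply: measurable_funM.
  have h : measurable_fun setT (fun p : mR * X => (p.2.1, p.1)).
    apply/measurable_fun_pair => //; exact: measurableT_comp measurable_fst measurable_snd.
  exact: measurableT_comp measurable_le h.
have h : measurable_fun setT (fun p : mR * X => (p.1, p.2.2)).
  apply/measurable_fun_pair => //; exact: measurableT_comp measurable_snd measurable_snd.
exact: measurableT_comp mg h.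
Qed.

Lemma ae_slice_Lsq g : Lsq g -> {ae tor, forall x, (fun s => g (s, x)) \in Lfun tm 2%:E}.
Proof.
move=> /LsqP[mg Ig]; have := ae_integrable2 Ig; apply: filterS => x Igx.
apply/LsqP; split => //.
exact: measurable_fun_pair1.
Qed.

Definition slice_energy g x : R := \int[tm]_s (g (s, x) * g (s, x)).

Lemma slice_energy_integrable g : Lsq g ->
  tor.-integrable setT (EFin \o slice_energy g) /\
  ip mu g g = \int[tor]_x slice_energy g x.
Proof. by move=> sg; exact: (Rfubini2 (integrableM sg sg)). Qed.

Lemma slice_energy_ge0 g x : 0 <= slice_energy g x.
Proof. exact: ip_ge0. Qed.

(** Cauchy-Schwarz against the indicator of [[s, t[], whose squared norm is [t - s]. *)
Lemma prim_dist g x (s t : R) : (fun s => g (s, x)) \in Lfun tm 2%:E ->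
  0 <= s -> s <= t -> t <= T ->
  (prim g (t, x) - prim g (s, x)) ^+ 2 <= (t - s) * slice_energy g x.
Proof.
move=> sg s0 st tT; have fin := time_measure_fin T.
have Le r : (fun q : R => (r <= q)%R%:R : R) \in Lfun tm 2%:E.
  by apply: bmeas_Lsq => //; exact: bmeas_le_l.
have -> : prim g (t, x) - prim g (s, x) =
    ip tm ((fun q : R => (s <= q)%R%:R) - (fun q : R => (t <= q)%R%:R)) (fun s => g (s, x)).
  by rewrite ipBl// /prim opprK addrC.
have Ld := LsqB (Le s) (Le t).
rewrite (le_trans (ip_CS Ld sg))// ler_wpM2r ?ip_ge0//.
rewrite /ip (_ : (fun q => _) = \1_(`[s, t[%classic)); last first.
  apply/funext => q; rewrite !fctE indicE.
  have [sq|qs] := leP s q; have [tq|qt] := leP t q.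
  + by rewrite subrr mulr0 memNset//= in_itv/= sq ltNge tq.
  + by rewrite mem_set/= ?in_itv/= ?sq ?qt// subr0 mulr1.
  + by rewrite leNgt (lt_le_trans qs st) in tq.
  + by rewrite subrr mulr0 memNset//= in_itv/= leNgt qs.
rewrite /Rintegral integral_indic//.
by rewrite setIT [X in fine X](_ : _ = (t - s)%:E)//; exact: time_measure_itv_co.
Qed.

Lemma prim_sqr_le g x (t : R) : (fun s => g (s, x)) \in Lfun tm 2%:E ->
  0 <= t <= T -> prim g (t, x) ^+ 2 <= (T - t) * slice_energy g x.
Proof.
move=> sg /andP[t0 tT]; have := prim_dist sg t0 tT (lexx T).
rewrite (_ : prim g (T, x) = 0) ?sub0r ?sqrrN//.
rewrite /prim -[RHS]oppr0; congr -%R.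
transitivity (\int[tm]_s (0 : R)); last by rewrite Rintegral_cst// mul0r.
apply: ae_eq_Rintegral => //.
- apply: measurable_funM; first exact: (bmeas_le_l T).1.
  exact: Lsq_measurable sg.
- have := ae_time_measure_itv T; apply: filterS => s /andP[_ sT] _ /=.
  by rewrite leNgt sT mul0r.
Qed.

Lemma prim_Lsq g : Lsq g -> Lsq (prim g) /\ ip mu (prim g) (prim g) <= T ^+ 2 * ip mu g g.
Proof.
move=> sg; have mp := measurable_prim (Lsq_measurable sg).
have [Is E] := slice_energy_integrable sg.
have I1 : tm.-integrable setT (EFin \o cst T).
  by apply: bmeas_integrable; [exact: time_measure_fin|exact: bmeas_cst].
have [Ic Ec] := Rintegral_prodM I1 Is.
have B : {ae mu, forall z, prim g z ^+ 2 <= T * slice_energy g z.2}.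
  have h1 := ae_fst (torus R n) (ae_time_measure_itv T).
  have h2 := ae_snd (time_measure T) (ae_slice_Lsq sg).
  apply: filterS2 h1 h2 => -[t x]/= /andP[t0 tT] sx.
  have tT' : 0 <= t <= T by rewrite !ltW.
  by rewrite (le_trans (prim_sqr_le sx tT'))// ler_wpM2r ?slice_energy_ge0// gerBl ltW.
have [I2 le2] := ae_le_integrable (measurable_funX 2 mp) Ic
  (filterS (fun z h => introT andP (conj (sqr_ge0 (prim g z)) h)) B).
split; first exact/LsqP.
rewrite /ip; under eq_Rintegral do rewrite -expr2.
rewrite (le_trans le2)// Ec -E Rintegral_cst// [X in fine X]time_measure_setT ?(ltW T_gt0)//.
Qed.

Lemma continuous_time_integrable (h : R -> R) : continuous h ->
  tm.-integrable setT (EFin \o h).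
Proof.
move=> ch; have /compact_bounded[C [_ HC]] : compact (h @` `[0, T]).
  by apply: continuous_compact; [exact: continuous_subspaceT|exact: segment_compact].
have fin := time_measure_fin T.
apply: (Lsq_integrable fin); apply: (@Lsq_bounded _ _ _ _ fin _ (C + 1)).
  exact: continuous_measurable_fun.
have := ae_time_measure_itv T; apply: filterS => t /andP[t0 tT].
apply: (HC (C + 1)); first by rewrite ltrDl.
by exists t => //=; rewrite in_itv/= !ltW.
Qed.

Lemma is_derive_slice (phi : X -> R) (t : R) x : differentiable phi (t, x) ->
  is_derive t 1 (fun s : R => phi (s, x)) ('D_(dirt R n) phi (t, x)).
Proof.
move=> dphi; have /cvg_ex[l hl] := diff_derivable (v := dirt R n) dphi.
have E : (fun h : R => h^-1 *: ((phi \o shift (t, x)) (h *: dirt R n) - phi (t, x))) =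
    (fun h : R => h^-1 *: (((fun s : R => phi (s, x)) \o shift t) (h *: (1 : R)) - phi (t, x))).
  apply/funext => h; rewrite /= /dirt /shift/=; congr (_ *: (phi _ - _)).
  by congr pair; rewrite /= ?scaler0 ?add0r.
split; first by apply/cvg_ex; exists l; rewrite /= -E.
by rewrite /derive -E.
Qed.

(** On almost every slice the integrals over the triangle [t <= s] are exchanged. The inner integral
    of the time derivative of [phi] up to time [s] is [phi (s, x)], because [phi] vanishes at time
    0. *)
Lemma prim_wderiv g : Lsq g -> is_wderiv T (dirt R n) (prim g) g.
Proof.
move=> sg phi [sphi _ [a [b [a0 bT supp]]]].
have fin := time_measure_fin T.
have sD : smooth ('D_(dirt R n) phi) by exact: smooth_derive.
have [sp _] := prim_Lsq sg.
have [I1 ->] := Rfubini2 (integrableM sp (smooth_Lsq T sD)).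
have [I2 ->] := Rfubini2 (integrableM sg (smooth_Lsq T sphi)).
have cs (h : X -> R) x : smooth h -> continuous (fun t : R => h (t, x)).
  move=> sh t; have hd := is_derive_slice (smooth_differentiable sh (t, x)).
  by apply: differentiable_continuous; apply/derivable1_diffP; have [] := hd.
rewrite -mulN1r -RintegralZl//; apply: ae_eq_Rintegral.
- by have /integrableP[/measurable_EFinP] := I1.
- apply: measurable_funM => //.
  by have /integrableP[/measurable_EFinP] := I2.
have := ae_slice_Lsq sg; apply: filterS => x sx _.
pose D (t : R) := 'D_(dirt R n) phi (t, x).
have ID : tm.-integrable setT (EFin \o D) by apply: continuous_time_integrable; exact: (cs _ x sD).
have Ig := Lsq_integrable fin sx.
have [IgD _] := Rintegral_prodM Ig ID.
have If : (tm \x tm)%E.-integrable setT (EFin \o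
    (fun p : mR * mR => g (p.1, x) * D p.2 * (p.2 <= p.1)%R%:R)).
  apply: (integrableMb (C := 1)) => //.
    have h : measurable_fun setT (fun p : mR * mR => (p.2, p.1)) by exact/measurable_fun_pair.
    exact: measurableT_comp measurable_le h.
  by apply: aeW => p; case: (p.2 <= p.1); rewrite ?normr1 ?normr0.
have [J1 E1] := Rfubini1 If.
have [J2 E2] := Rfubini2 If.
rewrite mulN1r.
transitivity (- \int[tm]_t \int[tm]_s (g (s, x) * D t * (t <= s)%R%:R)).
  rewrite -mulN1r -RintegralZl//; apply: eq_Rintegral => t _.
  rewrite /prim mulN1r mulNr -RintegralZr//; last first.
    have [mb [C hC]] := bmeas_le_l t.
    apply: eq_integrable (integrableMb Ig mb (aeW _ hC)) => //.
    by move=> s _; rewrite /= mulrC.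
  by congr -%R; apply: eq_Rintegral => s _ /=; rewrite -/(D t); ring.
rewrite -E2 E1; congr -%R; apply: ae_eq_Rintegral.
- by have /integrableP[/measurable_EFinP] := J1.
- apply: measurable_funM; first exact: Lsq_measurable sx.
  by apply: continuous_measurable_fun; exact: (cs _ x sphi).
have := ae_time_measure_itv T; apply: filterS => s s0T _.
transitivity (\int[tm]_t (g (s, x) * (D t * (t <= s)%R%:R))).
  by apply: eq_Rintegral => t _; rewrite /= mulrA.
rewrite RintegralZl//; last first.
  apply: (integrableMb (C := 1) ID).
    apply: (measurableT_comp measurable_le (pair2_measurable s)).
  by apply: aeW => t; case: (t <= s); rewrite ?normr1 ?normr0.
congr (_ * _); under eq_Rintegral do rewrite mulrC.
have dphi (t : R) : is_derive t 1 (fun t : R => phi (t, x)) (D t).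
  by apply: is_derive_slice; exact: smooth_differentiable.
rewrite (FTC_time dphi (cs _ x sD) s0T).
by rewrite (supp 0)// ?subr0// lt_geF.
Qed.

Lemma prim_slice_Lsq g t : Lsq g -> 0 <= t <= T ->
  (fun x => prim g (t, x)) \in Lfun tor 2%:E.
Proof.
move=> sg t0T; have [Is _] := slice_energy_integrable sg.
have mp : measurable_fun setT (fun x => prim g (t, x)).
  exact: measurableT_comp (measurable_prim (Lsq_measurable sg)) (pair1_measurable (t : mR)).
apply/LsqP; split => //.
have I2 : tor.-integrable setT (EFin \o (fun x => (T - t) * slice_energy g x)).
  exact: (integrableZl measurableT (T - t) Is).
have [] // := ae_le_integrable (measurable_funX 2 mp) I2.
have := ae_slice_Lsq sg; apply: filterS => x sx.
by rewrite sqr_ge0 prim_sqr_le.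
Qed.

Lemma prim_slice_dist g s t : Lsq g -> 0 <= s <= T -> 0 <= t <= T ->
  ip tor ((fun x => prim g (s, x)) - (fun x => prim g (t, x)))
    ((fun x => prim g (s, x)) - (fun x => prim g (t, x))) <= `|s - t| * ip mu g g.
Proof.
move=> sg s0T t0T; set dp := (_ - _); have [Is ->] := slice_energy_integrable sg.
rewrite -RintegralZl//.
have sd : dp \in Lfun tor 2%:E by apply: LsqB; exact: prim_slice_Lsq.
have I2 : tor.-integrable setT (EFin \o (fun x => `|s - t| * slice_energy g x)).
  exact: (integrableZl measurableT _ Is).
have mdp : measurable_fun setT (fun x => dp x * dp x).
  by apply: measurable_funM; exact: (Lsq_measurable sd).
have [] // := ae_le_integrable mdp I2.
have := ae_slice_Lsq sg; apply: filterS => x sx.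
rewrite -expr2 sqr_ge0/= /dp !fctE.
have /andP[s0 sT] := s0T; have /andP[t0 tT] := t0T.
have [st|ts] := leP s t.
  rewrite distrC (ger0_norm (_ : 0 <= t - s)) ?subr_ge0// -sqrrN opprB.
  exact: prim_dist.
move/ltW: ts => ts; rewrite (ger0_norm (_ : 0 <= s - t)) ?subr_ge0//.
exact: prim_dist.
Qed.

End primitive.

(** * Continuous representatives and traces *)

Section traces.
Context (R : realType) (n : nat) (T : R).
Hypothesis T_gt0 : 0 < T.

Local Notation X := (spacetime R n).
Local Notation tm := (time_measure T).
Local Notation tor := (torus R n).
Local Notation mu := (time_measure T \x torus R n)%E.
Local Notation Lsq f := (f \in Lfun mu 2%:E).
Local Notation sq h := (ip tor h h).
Implicit Types (g u v w : X -> R) (c : 'rV[R]_n -> R).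
#[local] Existing Instance ae_time_filter.

Definition slice v (t : R) : 'rV[R]_n -> R := fun x => v (t, x).

Lemma C_L2P v : (forall t, 0 <= t <= T -> slice v t \in Lfun tor 2%:E) ->
  (C_L2 T v <-> forall t, 0 <= t <= T -> forall e : R, 0 < e -> exists2 r : R, 0 < r &
    forall s, 0 <= s <= T -> `|s - t| < r -> sq (slice v s - slice v t) < e).
Proof.
move=> sv.
have LE s t : 0 <= s <= T -> 0 <= t <= T ->
    Lnorm tor 2%:E (fun x => (v (s, x) - v (t, x))%:E) =
    (Num.sqrt (sq (slice v s - slice v t)))%:E.
  by move=> hs ht; rewrite -Lnorm2E//; apply: LsqB; exact: sv.
split=> [cv t tT e e0|cv t].
  have [_] := cv t (introT idP tT).
  move=> /fine_cvgP[_] /cvgr0Pnorm_lt/(_ _ (_ : 0 < Num.sqrt e)).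
  rewrite sqrtr_gt0 => /(_ e0); rewrite near_withinE /= => /nbhs_ballP[r r0 H].
  exists r => // s sT st; have := H s; rewrite /ball/= distrC => /(_ st).
  rewrite in_itv/= => /(_ sT); rewrite LE//= ger0_norm ?sqrtr_ge0//.
  by rewrite ltr_sqrt.
rewrite in_itv/= => tT; split; first exact: sv.
apply/fine_cvgP; split.
  rewrite near_withinE; apply: nearW => s; rewrite /= in_itv/= => sT.
  by rewrite LE.
apply/cvgr0Pnorm_lt => e e0.
have [r r0 H] := cv t tT (e ^+ 2) (exprn_gt0 _ e0).
rewrite near_withinE; apply/nbhs_ballP; exists r => //= s.
rewrite /ball/= distrC in_itv/= => st sT; rewrite LE//= ger0_norm ?sqrtr_ge0//.
by rewrite -(ger0_norm (ltW e0)) -sqrtr_sqr ltr_sqrt ?exprn_gt0//; exact: H.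
Qed.

Lemma C_L2_slice v t : C_L2 T v -> 0 <= t <= T -> slice v t \in Lfun tor 2%:E.
Proof. by move=> cv tT; have [] := cv t (introT idP tT). Qed.

Lemma C_L2_prim c g : c \in Lfun tor 2%:E -> Lsq g ->
  C_L2 T (fun z => c z.2 + prim T g z).
Proof.
move=> sc sg; set v := (fun z => _).
have sv t : 0 <= t <= T -> slice v t \in Lfun tor 2%:E.
  by move=> tT; apply: (LsqD sc); exact: prim_slice_Lsq.
apply/C_L2P => // t tT e e0.
have E0 := ip_ge0 mu g; exists (e / (ip mu g g + 1)).
  by rewrite divr_gt0// ltr_wpDl.
move=> s sT st.
have -> : slice v s - slice v t =
    (fun x => prim T g (s, x)) - (fun x => prim T g (t, x)).
  by apply/funext => x; rewrite /slice !fctE /v/=; ring.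
apply: le_lt_trans (prim_slice_dist sg sT tT) _.
move: st; rewrite ltr_pdivlMr ?ltr_wpDl// => st.
by apply: le_lt_trans st; rewrite ler_wpM2l// lerDl.
Qed.

(** By Fubini's theorem the slices agree at almost every time. Such times are dense, and continuity
    in L^2 extends the agreement to every time. *)
Lemma C_L2_ae_eq v v' t : C_L2 T v -> C_L2 T v' -> v = v' %[ae mu] ->
  0 <= t <= T -> slice v t = slice v' t %[ae tor].
Proof.
move=> cv cv' vv' tT.
have sv s : 0 <= s <= T -> slice v s \in Lfun tor 2%:E by exact: C_L2_slice.
have sv' s : 0 <= s <= T -> slice v' s \in Lfun tor 2%:E by exact: C_L2_slice.
have aeE : {ae tm, forall s, slice v s = slice v' s %[ae tor]}.
  have h : {ae mu, forall z, v z = v' z} by apply: filterS vv' => z; exact.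
  by have := ae_product1 h; apply: filterS => s hs; apply: filterS hs => x h' _.
have sd s : 0 <= s <= T -> slice v s - slice v' s \in Lfun tor 2%:E.
  by move=> sT; apply: LsqB; [exact: sv|exact: sv'].
suff d0 : sq (slice v t - slice v' t) = 0.
  have := ip_eq0 (sd t tT) d0; apply: filterS => x /[apply] /=; rewrite !fctE.
  by move/eqP; rewrite subr_eq0 => /eqP.
apply/eqP; rewrite eq_le ip_ge0 andbT; apply/ler_addgt0Pr => e e0; rewrite add0r.
(* Two errors below [e / 4], each doubled when the square of a difference is split, add up to less
   than [e]. *)
have e40 : 0 < e / 4 by rewrite divr_gt0.
have [r r0 H] := (C_L2P sv).1 cv t tT _ e40.
have [r' r0' H'] := (C_L2P sv').1 cv' t tT _ e40.
have m0 : 0 < Num.min r r' by rewrite lt_min r0.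
have [s [sT st ss]] := ae_time_dense T_gt0 aeE tT m0.
move: st; rewrite lt_min => /andP[/(H _ sT) h /(H' _ sT) h'].
set a := slice v s - slice v t in h; set b := slice v' s - slice v' t in h'.
have sa : a \in Lfun tor 2%:E by apply: LsqB; exact: sv.
have sb : b \in Lfun tor 2%:E by apply: LsqB; exact: sv'.
have E : slice v t - slice v' t = b - a %[ae tor].
  apply: filterS ss => x /[apply] E.
  by rewrite /a /b !fctE E; ring.
have sba : b - a \in Lfun tor 2%:E by exact: LsqB.
have m1 := Lsq_measurable (sd t tT); have m2 := Lsq_measurable sba.
rewrite (ip_ae m1 m2 m1 E) ipC (ip_ae m1 m2 m2 E).
have := ip_sqrD_le sb (LsqN sa); have -> : ip tor (- a) (- a) = ip tor a a.
  by rewrite /ip; apply: eq_Rintegral => x _; rewrite !fctE mulrNN.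
rewrite -/(b - a); lra.
Qed.

(** [trace] picks an arbitrary continuous representative; by uniqueness any known one computes
    it. *)
Lemma trace_eq v u t : C_L2 T v -> v = u %[ae mu] -> 0 <= t <= T ->
  trace T u t = slice v t %[ae tor].
Proof.
move=> cv vu tT; rewrite /trace; case: xgetP => [w -> [v' [v'u cv' ->]]|].
  apply: C_L2_ae_eq => //.
  by apply: filterS2 v'u vu => z h h' I; rewrite h// h'.
by move=> /(_ (slice v t)); case; exists v.
Qed.

Lemma prim_T g : Lsq g -> slice (prim T g) T = cst 0 %[ae tor].
Proof.
move=> sg; have TT : 0 <= T <= T by rewrite lexx ltW.
have := ae_slice_Lsq sg; apply: filterS => x sx _.
have := prim_sqr_le sx TT; rewrite subrr mul0r => h.
by apply/eqP; rewrite -sqrf_eq0 eq_le h sqr_ge0.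
Qed.

Lemma prim_0 g : Lsq g -> slice (prim T g) 0 =
  (fun x => - \int[tm]_s g (s, x)) %[ae tor].
Proof.
move=> sg; have := ae_slice_Lsq sg; apply: filterS => x sx _.
rewrite /slice /prim; congr -%R; apply: ae_eq_Rintegral.
- by apply: measurable_funM; [exact: (bmeas_le_l 0).1|exact: Lsq_measurable sx].
- exact: Lsq_measurable sx.
- have := ae_time_measure_itv T; apply: filterS => s /andP[s0 _] _ /=.
  by rewrite (ltW s0) mul1r.
Qed.

Lemma trace_prim u g t : Lsq g -> u = prim T g %[ae mu] -> 0 <= t <= T ->
  trace T u t = slice (prim T g) t %[ae tor].
Proof.
move=> sg ug tT; have := @trace_eq (fun z => cst 0 z.2 + prim T g z) u t.
have c0 : cst 0 \in Lfun tor 2%:E by exact: Lsq0.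
move=> /(_ (C_L2_prim c0 sg)) h.
have ae_u : (fun z => cst 0 z.2 + prim T g z) = u %[ae mu].
  by apply: filterS ug => z /[apply] ->; rewrite add0r.
by apply: filterS (h ae_u tT) => x /[apply] ->; rewrite /slice/= add0r.
Qed.

(** Turns the initial term of the Lagrangian into an inner product with the time derivative, since
    the primitive at 0 is minus the time integral of [g]. The factor [T], from integrating over the
    cylinder a function of [x] only, cancels the [1/T] of the Lagrangian. *)
Lemma ip_prim0 g c : Lsq g -> c \in Lfun tor 2%:E ->
  mu.-integrable setT (EFin \o (fun z => prim T g (0, z.2) * c z.2)) /\
  \int[mu]_z (prim T g (0, z.2) * c z.2) = - (T * ip mu g (c \o snd)).
Proof.
move=> sg sc; have fin := cylinder_fin T n; have finT := torus_fin R n.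
have T0 : (0 : R) <= 0 <= T by rewrite lexx/= ltW.
have I1 : tm.-integrable setT (EFin \o cst 1).
  by apply: bmeas_integrable; [exact: time_measure_fin|exact: bmeas_cst].
have I2 := integrableM (prim_slice_Lsq sg T0) sc.
have scs : Lsq (c \o snd).
  have /LsqP[mc Ic] := sc; apply/LsqP; split; first exact: measurableT_comp mc measurable_snd.
  by have [+ _] := Rintegral_prodM I1 Ic; apply: eq_integrable => // z _; rewrite /= mul1r.
have [I3 E3] := Rintegral_prodM I1 I2.
split; first by apply: eq_integrable I3 => // z _; rewrite /= mul1r.
transitivity (\int[mu]_z (cst 1 z.1 * (prim T g (0, z.2) * c z.2))).
  by apply: eq_Rintegral => z _; rewrite mul1r.
rewrite E3 Rintegral_cst// mul1r [X in fine X]time_measure_setT ?ltW//= -mulrN; congr (_ * _).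
have [I4 E4] := Rfubini2 (integrableM sg scs); rewrite /ip E4.
rewrite -mulN1r -RintegralZl//; apply: ae_eq_Rintegral.
- apply: measurable_funM; first exact: Lsq_measurable (prim_slice_Lsq sg T0).
  exact: Lsq_measurable sc.
- by apply: measurable_funM => //; have /integrableP[/measurable_EFinP] := I4.
have sl := ae_slice_Lsq sg; apply: filterS2 (prim_0 sg) sl => x /[swap] sx /[apply] h.
have := h; rewrite /slice => ->; rewrite /= RintegralZr ?mulN1r ?mulNr//.
by have := Lsq_integrable (time_measure_fin T) sx.
Qed.

(** The difference of [u] and the primitive has zero time derivative, so it is a function [c] of
    [x]. Then [c] plus the primitive is the continuous representative of [u], and its value at [T]
    is [c], which must vanish. *)
Lemma wderiv_trace0 u g : Lsq u -> Lsq g -> is_wderiv T (dirt R n) u g ->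
  trace T u T = cst 0 %[ae tor] -> u = prim T g %[ae mu].
Proof.
move=> su sg ug uT; have fin := cylinder_fin T n.
have [sp _] := prim_Lsq T_gt0 sg.
have sw := LsqB su sp; set w := u - prim T g in sw.
have w0 : is_wderiv T (dirt R n) w (cst 0).
  move=> phi tphi; have [sphi _ _] := tphi.
  have sD : smooth ('D_(dirt R n) phi) by exact: smooth_derive.
  have sD2 := smooth_Lsq T sD.
  have -> : \int[cylinder n T]_z (w z * 'D_(dirt R n) phi z) = ip mu w ('D_(dirt R n) phi) by [].
  rewrite ipBl//; have -> : ip mu u ('D_(dirt R n) phi) = - \int[mu]_z (g z * phi z) by exact: ug.
  have -> : ip mu (prim T g) ('D_(dirt R n) phi) = - \int[mu]_z (g z * phi z).
    exact: prim_wderiv.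
  rewrite subrr; apply/esym/eqP; rewrite oppr_eq0; apply/eqP.
  by under eq_Rintegral do rewrite mul0r; rewrite Rintegral_cst// mul0r.
have wc := wderiv_dt0 T_gt0 (Lsq_integrable fin sw) w0; set c := time_mean T w in wc.
have mw := Lsq_measurable sw.
have mc : measurable_fun setT c.
  by apply: measurable_funM => //; exact: measurable_Rintegral_fst.
have sc : c \in Lfun tor 2%:E.
  have mcs : measurable_fun setT (c \o snd : X -> R) by exact: measurableT_comp mc measurable_snd.
  have /LsqP[_ Ic] := Lsq_ae mcs wc sw.
  have [Ic2 _] := Rfubini2 Ic; apply/LsqP; split => //.
  have := integrableZl measurableT T^-1 Ic2; apply: eq_integrable => // x _ /=.
  rewrite Rintegral_cst//.
  rewrite [X in fine X]time_measure_setT ?ltW//=.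
  by rewrite -EFinM mulrC mulfK// gt_eqF.
pose v z := c z.2 + prim T g z.
have vu : v = u %[ae mu].
  by apply: filterS wc => z /[apply] /= h; rewrite /v -h /w !fctE subrK.
have TT : 0 <= T <= T by rewrite lexx ltW.
have tE := trace_eq (C_L2_prim sc sg) vu TT.
have c0 : {ae tor, forall x, c x = 0}.
  have := prim_T sg; move: uT tE; apply: filterS3 => x /(_ I) + /(_ I) + /(_ I).
  by rewrite /slice /= => -> /esym + h; rewrite h addr0.
apply: filterS2 vu (ae_snd tm c0) => z /[swap] h /[apply].
by rewrite /v h add0r.
Qed.

End traces.

(** * L^2 limits of uniformly bounded functions *)

Section bounded_limits.
Context d (X : measurableType d) (R : realType).
Variable mu : {measure set X -> \bar R}.
Hypothesis fin_mu : mu setT \is a fin_num.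
Local Notation Lsq f := (f \in Lfun mu 2%:E).
Local Notation ip := (ip mu).
Implicit Types (f g s : X -> R) (C : R).

Lemma Lfun_infP f : (f \in Lfun mu +oo%E) <->
  measurable_fun setT f /\ exists C, {ae mu, forall x, `|f x| <= C}.
Proof.
split.
  rewrite inE => /andP[/[!inE] mf] /=; rewrite /finite_norm unlock => nf.
  split => //; move: nf; case: ifPn => [mu0|]; last first.
    rewrite -leNgt measure_le0 => /eqP mu0 _; exists 0.
    by exists setT; split => //; exact: measurableT.
  by move=> /ess_supr_bounded.
move=> [mf [C fC]]; rewrite inE; apply/andP; split; rewrite inE//= /finite_norm unlock.
case: ifPn => // mu0; apply: (@le_lt_trans _ _ C%:E); last exact: ltry.
by apply/ess_supP; apply: filterS fC => x; rewrite lee_fin.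
Qed.

(** Tested against [h], the positive part of [s - C], the inequalities pass to the limit and give
    that the integral of [(s - C) h = h^2] is at most 0. *)
Lemma L2cvg_ae_le (sn : nat -> X -> R) s C : (forall n, Lsq (sn n)) -> Lsq s ->
  L2cvg mu sn s -> (forall n, {ae mu, forall x, sn n x <= C}) ->
  {ae mu, forall x, s x <= C}.
Proof.
move=> ssn ss sns snC.
pose h x := Num.max 0 (s x - C).
have mh : measurable_fun setT h.
  apply: measurable_maxr => //; apply: measurable_funB => //; exact: Lsq_measurable ss.
have sh : Lsq h.
  have /LsqP[_ I2] := LsqB ss (Lsq_cst fin_mu C).
  apply/LsqP; split => //.
  have le : {ae mu, forall x, 0 <= h x ^+ 2 <= (s - cst C) x ^+ 2}.
    apply: aeW => x; rewrite sqr_ge0/= /h !fctE/=.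
    by have [h0|h0] := leP 0 (s x - C); rewrite // expr0n sqr_ge0.
  by have [] := ae_le_integrable (measurable_funX 2 mh) I2 le.
have le n : ip (sn n) h <= \int[mu]_x (C * h x).
  have If := integrableM (ssn n) sh; have Ig := integrableM (Lsq_cst fin_mu C) sh.
  rewrite -subr_ge0 -RintegralB//.
  have m1 : measurable_fun setT (fun x => C * h x - sn n x * h x).
    by apply: measurable_funB; apply: measurable_funM => //; exact: Lsq_measurable (ssn n).
  rewrite (ae_eq_Rintegral (g := fun x => Num.max 0 (C * h x - sn n x * h x)) m1).
  - by apply: Rintegral_ge0 => x _; rewrite le_max lexx.
  - exact: measurable_maxr.
  - apply: filterS (snC n) => x snx _; apply/esym/max_idPr.
    by rewrite -mulrBl mulr_ge0 ?subr_ge0// /h le_max lexx.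
have {}le : ip s h <= \int[mu]_x (C * h x).
  have c := cvg_ipl ssn ss sh sns.
  rewrite -(cvg_lim (@Rhausdorff R) c); apply: limr_le; first by apply/cvg_ex; exists (ip s h).
  by apply: nearW.
have h0 : ip h h = 0.
  apply/eqP; rewrite eq_le ip_ge0 andbT.
  move: le; rewrite -subr_le0 -RintegralB//; last 2 first.
  - exact: integrableM.
  - exact: integrableM (Lsq_cst fin_mu C) sh.
  congr (_ <= _); apply: eq_Rintegral => x _; rewrite -mulrBl /h.
  by case: leP => [_|_]; rewrite ?mulr0.
have := ip_eq0 sh h0; apply: filterS => x /(_ I) /= hx.
have : s x - C <= h x by rewrite /h le_max lexx orbT.
by rewrite hx subr_le0.
Qed.

Lemma L2cvg_ae_norm_le (sn : nat -> X -> R) s C : (forall n, Lsq (sn n)) -> Lsq s ->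
  L2cvg mu sn s -> (forall n, {ae mu, forall x, `|sn n x| <= C}) ->
  {ae mu, forall x, `|s x| <= C}.
Proof.
move=> ssn ss sns snC.
have h1 : {ae mu, forall x, s x <= C}.
  apply: (L2cvg_ae_le ssn ss sns) => n; apply: filterS (snC n) => x.
  exact: le_trans (ler_norm _).
have h2 : {ae mu, forall x, (- s) x <= C}.
  apply: (L2cvg_ae_le (sn := fun n => - sn n)) => [n| | |n].
  - exact: LsqN (ssn n).
  - exact: LsqN.
  - apply: cvg_trans sns; rewrite (_ : (fun n => _) = (fun n => ip (sn n - s) (sn n - s)))//.
    by apply/funext => n; apply: eq_Rintegral => x _; rewrite !fctE; ring.
  - by apply: filterS (snC n) => x; apply: le_trans; rewrite fctE -normrN ler_norm.
by apply: filterS2 h1 h2 => x; rewrite fctE ler_norml lerNl => -> ->.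
Qed.

(** As [f] is only integrable, it is truncated at height [k]: the truncated part is square
    integrable and converges by L^2 convergence, while the uniform bound [C] controls the rest by
    the tail of the integral of [|f|], uniformly in [n]. *)
Lemma L2cvg_mul_integrable (sn : nat -> X -> R) s C f : (forall n, Lsq (sn n)) -> Lsq s ->
  L2cvg mu sn s -> (forall n, {ae mu, forall x, `|sn n x| <= C}) ->
  mu.-integrable setT (EFin \o f) ->
  \int[mu]_x (f x * sn n x) @[n --> \oo] --> \int[mu]_x (f x * s x).
Proof.
move=> ssn ss sns snC If.
have sC := L2cvg_ae_norm_le ssn ss sns snC.
have /integrableP[/measurable_EFinP mf _] := If.
pose b k x : R := (`|f x| <= k%:R)%R%:R.
have mb k : measurable_fun setT (b k).
  rewrite (_ : b k = \1_([set x | `|f x| <= k%:R])); last first.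
    by apply/funext => x; rewrite indicE; congr (nat_of_bool _)%:R; apply/idP/idP; rewrite inE.
  apply: measurable_indic.
  have mn : measurable_fun setT (fun x => `|f x|) by exact: measurableT_comp.
  have := @measurable_fun_ler _ _ R setT (fun x => `|f x|) (cst k%:R) mn (measurable_cst _).
  by move=> /(_ measurableT [set true] I); rewrite setTI.
have b1 k : {ae mu, forall x, `|b k x| <= 1}.
  by apply: aeW => x; rewrite /b; case: (`|f x| <= _); rewrite ?normr1 ?normr0.
pose fk k x := f x * b k x.
have sfk k : Lsq (fk k).
  apply: (@Lsq_bounded _ _ _ _ fin_mu _ k%:R); first exact: measurable_funM.
  apply: aeW => x; rewrite /fk /b; have [h|h] := leP `|f x| k%:R; first by rewrite mulr1.
  by rewrite mulr0 normr0.
have Ia : mu.-integrable setT (EFin \o (fun x => `|f x|)) by exact: integrable_abse If.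
have tail : \int[mu]_x (`|f x| * (1 - b k x)) @[k --> \oo] --> 0.
  have -> : 0 = \int[mu]_x (`|f x| * 0) :> R.
    by under eq_Rintegral do rewrite mulr0; rewrite Rintegral_cst// mul0r.
  apply: (bounded_cvg_Rintegral (C := 1) Ia) => //.
  - by move=> k; apply: measurable_funB.
  - by apply: aeW => x k; rewrite /b; case: (`|f x| <= _); rewrite ?subrr ?subr0 ?normr1 ?normr0.
  - apply: aeW => x; apply: cvg_near_cst; near=> k.
    rewrite /b; suff -> : `|f x| <= k%:R by rewrite subrr.
    by near: k; exact: nbhs_infty_ger.
have Ib k : mu.-integrable setT (EFin \o (fun x => `|f x| * (1 - b k x))).
  apply: (integrableMb (C := 1) Ia) => //; first exact: measurable_funB.
  by apply: aeW => x; rewrite /b; case: (`|f x| <= _); rewrite ?subrr ?subr0 ?normr1 ?normr0.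
have est k r : Lsq r -> {ae mu, forall x, `|r x| <= C} ->
    `|\int[mu]_x (f x * r x) - ip (fk k) r| <= `|C| * \int[mu]_x (`|f x| * (1 - b k x)).
  move=> sr rC; have mr := Lsq_measurable sr.
  have I1 := integrableMb If mr rC; have I2 := integrableM (sfk k) sr.
  rewrite -RintegralB// -RintegralZl//.
  have Id := integrableB measurableT I1 I2.
  apply: le_trans (le_normr_Rintegral _ Id) _ => //.
  have [] // := @ae_le_integrable _ _ _ mu (fun x => `|f x * r x - fk k x * r x|)
     (fun x => `|C| * (`|f x| * (1 - b k x))).
  - apply: measurableT_comp => //; have /integrableP[/measurable_EFinP] := Id; exact.
  - exact: (integrableZl measurableT _ (Ib k)).
  - apply: filterS rC => x rx; rewrite normr_ge0/= /fk -mulrA -mulrBr normrM mulrCA ler_wpM2l//.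
    have -> : r x - b k x * r x = r x * (1 - b k x) by ring.
    rewrite normrM (ger0_norm (_ : 0 <= 1 - b k x)); last first.
      by rewrite /b; case: (`|f x| <= _); rewrite ?subrr ?subr0.
    rewrite ler_wpM2r//; last exact: le_trans rx (ler_norm _).
    by rewrite /b; case: (`|f x| <= _); rewrite ?subrr ?subr0.
apply/cvgrPdist_le => e e0.
have e30 : 0 < e / 3 by rewrite divr_gt0.
have [k hk] : exists k, `|C| * \int[mu]_x (`|f x| * (1 - b k x)) <= e / 3.
  have : `|C| * \int[mu]_x (`|f x| * (1 - b k x)) @[k --> \oo] --> `|C| * 0.
    by apply: cvgM => //; exact: cvg_cst.
  rewrite mulr0 => /cvgr0Pnorm_le/(_ _ e30)[K _ /(_ K (leqnn K))/= h].
  by exists K; exact: le_trans (ler_norm _) h.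
have c := cvg_ipl ssn ss (sfk k) sns.
move/cvgrPdist_le : c => /(_ _ e30); apply: filterS => n.
rewrite (ipC _ s) (ipC _ (sn n)) => hn.
have h1 := est k _ ss sC; have h2 := est k _ (ssn n) (snC n).
have -> : \int[mu]_x (f x * s x) - \int[mu]_x (f x * sn n x) =
   (\int[mu]_x (f x * s x) - ip (fk k) s) + (ip (fk k) s - ip (fk k) (sn n)) -
   (\int[mu]_x (f x * sn n x) - ip (fk k) (sn n)) by ring.
rewrite (le_trans (ler_normB _ _))// (le_trans (lerD (ler_normD _ _) (lexx _)))//.
by have := le_trans h1 hk; have := le_trans h2 hk; lra.
Unshelve. all: by end_near. Qed.

End bounded_limits.

(** * Uniqueness and stability of the constraints *)

Section weak_limits.
Context (R : realType) (n : nat) (T : R).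
Hypothesis T_gt0 : 0 < T.

Local Notation X := (spacetime R n).
Local Notation tm := (time_measure T).
Local Notation tor := (torus R n).
Local Notation mu := (time_measure T \x torus R n)%E.
Local Notation Lsq f := (f \in Lfun mu 2%:E).
Local Notation ip := (ip mu).
Implicit Types (f g u s : X -> R) (lam : X -> 'rV[R]_n).

Let fin_mu := cylinder_fin T n.

(** Linearity holds a.e. only: on a null set of slices the functions may fail to be integrable. *)
Lemma prim_comb (a b : R) f g : Lsq f -> Lsq g ->
  prim T (fun z => a * f z + b * g z) =
  (fun z => a * prim T f z + b * prim T g z) %[ae mu].
Proof.
move=> sf sg; have := ae_snd tm (ae_slice_Lsq sf); have := ae_snd tm (ae_slice_Lsq sg).
apply: filterS2 => z sgz sfz _; rewrite /prim.
have [mb [C hC]] := bmeas_le_l z.1.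
have ft := time_measure_fin T.
have I1 : tm.-integrable setT (EFin \o (fun r : measurableTypeR R => (z.1 <= r)%R%:R * f (r, z.2))).
  have := integrableMb (Lsq_integrable ft sfz) mb (aeW _ hC).
  by apply: eq_integrable => // s _; rewrite /= mulrC.
have I2 : tm.-integrable setT (EFin \o (fun r : measurableTypeR R => (z.1 <= r)%R%:R * g (r, z.2))).
  have := integrableMb (Lsq_integrable ft sgz) mb (aeW _ hC).
  by apply: eq_integrable => // s _; rewrite /= mulrC.
rewrite !mulrN -opprD; congr -%R.
rewrite -RintegralZl// -RintegralZl// -RintegralD//.
- by apply: eq_Rintegral => r _; ring.
- exact: (integrableZl measurableT a I1).
- exact: (integrableZl measurableT b I2).
Qed.

Lemma prim_L2cvg (gn : nat -> X -> R) g : (forall k, Lsq (gn k)) -> Lsq g ->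
  L2cvg mu gn g -> L2cvg mu (fun k => prim T (gn k)) (prim T g).
Proof.
move=> sgn sg gng.
have sd k : Lsq (gn k - g) by exact: LsqB.
have le k : ip (prim T (gn k) - prim T g) (prim T (gn k) - prim T g) <=
    T ^+ 2 * ip (gn k - g) (gn k - g).
  have [sp pT] := prim_Lsq T_gt0 (sd k).
  have [s1 _] := prim_Lsq T_gt0 (sgn k); have [s2 _] := prim_Lsq T_gt0 sg.
  have s12 := LsqB s1 s2.
  have E : prim T (gn k) - prim T g = prim T (gn k - g) %[ae mu].
    have := prim_comb 1 (-1) (sgn k) sg.
    rewrite (_ : (fun z => 1 * gn k z + -1 * g z) = gn k - g); last first.
      by apply/funext => z; rewrite !fctE; ring.
    by apply: filterS => z /[apply] ->; rewrite !fctE; ring.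
  have m1 := Lsq_measurable s12; have m2 := Lsq_measurable sp.
  by rewrite (ip_ae m1 m2 m1 E) ipC (ip_ae m1 m2 m2 E).
have c : T ^+ 2 * ip (gn k - g) (gn k - g) @[k --> \oo] --> (0 : R).
  have : T ^+ 2 * ip (gn k - g) (gn k - g) @[k --> \oo] --> T ^+ 2 * 0.
    by apply: cvgM => //; exact: cvg_cst.
  by rewrite mulr0.
apply: squeeze_cvgr (cvg_cst 0) c.
by apply: nearW => k; rewrite ip_ge0/=; exact: le.
Qed.

Lemma wderiv_unique v u g g' : Lsq g -> Lsq g' -> is_wderiv T v u g ->
  is_wderiv T v u g' -> g = g' %[ae mu].
Proof.
move=> sg sg' ug ug'; have sd := LsqB sg sg'.
have : g - g' = cst 0 %[ae mu].
  apply: (test_total T_gt0 (Lsq_integrable fin_mu sd)) => phi tphi.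
  have [sphi _ _] := tphi; have sp := smooth_Lsq T sphi.
  transitivity (ip (g - g') phi) => //; rewrite ipBl//.
  have e : - ip g phi = - ip g' phi := etrans (esym (ug _ tphi)) (ug' _ tphi).
  by rewrite (oppr_inj e) subrr.
by apply: filterS => z /[apply] /eqP; rewrite !fctE subr_eq0 => /eqP.
Qed.

Lemma wsymgrad_unique lam i j s s' : Lsq s -> Lsq s' -> is_wsymgrad T lam i j s ->
  is_wsymgrad T lam i j s' -> s = s' %[ae mu].
Proof.
move=> sg sg' ug ug'; have sd := LsqB sg sg'.
have : s - s' = cst 0 %[ae mu].
  apply: (test_total T_gt0 (Lsq_integrable fin_mu sd)) => phi tphi.
  have [sphi _ _] := tphi; have sp := smooth_Lsq T sphi.
  transitivity (ip (s - s') phi) => //; rewrite ipBl//.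
  have e : - ip s phi = - ip s' phi := etrans (esym (ug _ tphi)) (ug' _ tphi).
  by rewrite (oppr_inj e) subrr.
by apply: filterS => z /[apply] /eqP; rewrite !fctE subr_eq0 => /eqP.
Qed.

Lemma wsymgrad_sym lam i j s : is_wsymgrad T lam i j s -> is_wsymgrad T lam j i s.
Proof.
move=> h phi tphi; apply: etrans (h phi tphi); apply: eq_Rintegral => z _.
exact: (congr1 (fun r => 2^-1 * r) (addrC _ _)).
Qed.

Lemma smooth_dLsq v phi : cyl_test T phi -> Lsq ('D_v phi).
Proof. by case=> sphi _ _; apply: smooth_Lsq; exact: smooth_derive. Qed.

Lemma ip_half_sum (a b c e : X -> R) : Lsq a -> Lsq b -> Lsq c -> Lsq e ->
  \int[mu]_z (2^-1 * (a z * b z + c z * e z)) = 2^-1 * (ip a b + ip c e).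
Proof.
move=> sa sb sc se; have I1 := integrableM sa sb; have I2 := integrableM sc se.
rewrite /ip -RintegralD// -RintegralZl//.
by have := integrableD measurableT I1 I2.
Qed.

Lemma wsymgrad_ip lam i j s : (forall i, Lsq (component lam i)) ->
  is_wsymgrad T lam i j s <-> forall phi, cyl_test T phi ->
  2^-1 * (ip (component lam i) ('D_(dirx R j) phi) +
          ip (component lam j) ('D_(dirx R i) phi)) = - ip s phi.
Proof.
move=> sl; have E phi : cyl_test T phi -> \int[cylinder n T]_z (2^-1 *
    (lam z 0 i * 'D_(dirx R j) phi z + lam z 0 j * 'D_(dirx R i) phi z)) =
    2^-1 * (ip (component lam i) ('D_(dirx R j) phi) +
          ip (component lam j) ('D_(dirx R i) phi)).
  move=> tphi.
  exact: (ip_half_sum (sl i) (smooth_dLsq _ tphi) (sl j) (smooth_dLsq _ tphi)).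
by split=> h phi tphi; [rewrite -E//; exact: h|rewrite E//; exact: h].
Qed.

Lemma div_free_ip lam : (forall i, Lsq (component lam i)) ->
  div_free T lam <-> forall phi, cyl_test T phi ->
  \sum_i ip (component lam i) ('D_(dirx R i) phi) = 0.
Proof.
move=> sl; have E phi : cyl_test T phi ->
    \int[cylinder n T]_z (\sum_i lam z 0 i * 'D_(dirx R i) phi z) =
    \sum_i ip (component lam i) ('D_(dirx R i) phi).
  move=> tphi; rewrite Rintegral_sum// => i.
  exact: integrableM (sl i) (smooth_dLsq (dirx R i) tphi).
by split=> h phi tphi; [rewrite -E//; exact: h|rewrite E//; exact: h].
Qed.

(** The trace of the symmetric gradient is the divergence in the sense of distributions, and test
    functions separate integrable functions. *)
Lemma wsymgrad_trace0 lam (s : 'I_n -> X -> R) : (forall i, Lsq (component lam i)) ->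
  (forall i, Lsq (s i)) -> (forall i, is_wsymgrad T lam i i (s i)) -> div_free T lam ->
  {ae mu, forall z, \sum_i s i z = 0}.
Proof.
move=> sl ss hs dl; have sS := Lsq_sum (index_enum 'I_n) ss.
have := test_total T_gt0 (Lsq_integrable fin_mu sS); move=> h.
have {}h : (fun z => \sum_i s i z) = cst 0 %[ae mu].
  apply: h => phi tphi; have [sphi _ _] := tphi.
  transitivity (ip (fun z => \sum_i s i z) phi) => //; rewrite ip_suml//; last exact: smooth_Lsq.
  apply/eqP; rewrite -oppr_eq0 -sumrN; apply/eqP.
  rewrite -[RHS]((div_free_ip sl).1 dl _ tphi); apply: eq_bigr => i _.
  rewrite -((wsymgrad_ip i i (s i) sl).1 (hs i) _ tphi).
  lra.
by apply: filterS h => z; apply.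
Qed.

Lemma L2cvg_wderiv v (un gn : nat -> X -> R) u g : (forall k, Lsq (un k)) -> Lsq u ->
  (forall k, Lsq (gn k)) -> Lsq g -> L2cvg mu un u -> L2cvg mu gn g ->
  (forall k, is_wderiv T v (un k) (gn k)) -> is_wderiv T v u g.
Proof.
move=> sun su sgn sg unu gng h phi tphi; have [sphi _ _] := tphi.
have c1 := cvg_ipl sun su (smooth_dLsq v tphi) unu.
have c2 := cvg_ipl sgn sg (smooth_Lsq T sphi) gng.
have /cvgN c3 := c2; apply: (cvg_unique _ c1); first exact: Rhausdorff.
by apply: cvg_trans c3; apply: near_eq_cvg; apply: nearW => k; have := h k _ tphi.
Qed.

Lemma L2cvg_wsymgrad i j (ln : nat -> X -> 'rV[R]_n) (sn : nat -> X -> R) lam s :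
  (forall k i, Lsq (component (ln k) i)) -> (forall i, Lsq (component lam i)) ->
  (forall k, Lsq (sn k)) -> Lsq s ->
  (forall i, L2cvg mu (fun k => component (ln k) i) (component lam i)) ->
  L2cvg mu sn s -> (forall k, is_wsymgrad T (ln k) i j (sn k)) -> is_wsymgrad T lam i j s.
Proof.
move=> sln sl ssn ss lnl sns h; apply/wsymgrad_ip => // phi tphi; have [sphi _ _] := tphi.
have c1 := cvg_ipl (sln ^~ i) (sl i) (smooth_dLsq (dirx R j) tphi) (lnl i).
have c2 := cvg_ipl (sln ^~ j) (sl j) (smooth_dLsq (dirx R i) tphi) (lnl j).
have /cvgN c3 := cvg_ipl ssn ss (smooth_Lsq T sphi) sns.
have c4 : 2^-1 * (ip (component (ln k) i) ('D_(dirx R j) phi) +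
      ip (component (ln k) j) ('D_(dirx R i) phi)) @[k --> \oo] -->
    2^-1 * (ip (component lam i) ('D_(dirx R j) phi) +
      ip (component lam j) ('D_(dirx R i) phi)).
  by apply: cvgM; [exact: cvg_cst|exact: cvgD c1 c2].
apply: (cvg_unique _ c4); first exact: Rhausdorff.
apply: cvg_trans c3; apply: near_eq_cvg; apply: nearW => k.
by have := (wsymgrad_ip i j (sn k) (sln k)).1 (h k) _ tphi.
Qed.

Lemma L2cvg_div_free (ln : nat -> X -> 'rV[R]_n) lam :
  (forall k i, Lsq (component (ln k) i)) -> (forall i, Lsq (component lam i)) ->
  (forall i, L2cvg mu (fun k => component (ln k) i) (component lam i)) ->
  (forall k, div_free T (ln k)) -> div_free T lam.
Proof.
move=> sln sl lnl h; apply/div_free_ip => // phi tphi.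
have c : \sum_i ip (component (ln k) i) ('D_(dirx R i) phi) @[k --> \oo] -->
    \sum_i ip (component lam i) ('D_(dirx R i) phi).
  by apply: cvg_bigsum => i; exact: cvg_ipl (sln ^~ i) (sl i) (smooth_dLsq _ tphi) (lnl i).
rewrite -(cvg_lim (@Rhausdorff R) c); apply: cvg_lim => //.
apply: cvg_near_cst; apply: nearW => k; exact: (div_free_ip (sln k)).1 (h k) _ tphi.
Qed.

(** Pairings with functions of time are visibly stable under midpoints and L^2 limits, unlike the
    a.e. form. For the converse, test with the spatial mean [m] truncated to [[-1, 1]]: the
    truncation [b] satisfies [b^2 <= m b], so it vanishes a.e., and [m] with it. *)
Lemma mean_zeroP g : Lsq g ->
  {ae tm, forall t, \int[tor]_x g (t, x) = 0} <->
  forall b : R -> R, bmeas (b : measurableTypeR R -> R) -> ip g (fun z => b z.1) = 0.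
Proof.
move=> sg; have Ig := Lsq_integrable fin_mu sg.
have [Im _] := Rfubini1 Ig; set m := (fun t => _) in Im.
have E (b : R -> R) : bmeas (b : measurableTypeR R -> R) ->
    ip g (fun z => b z.1) = \int[tm]_t (m t * b t).
  move=> [mb [C hC]].
  have Igb : mu.-integrable setT (EFin \o (fun z => g z * b z.1)).
    apply: (integrableMb (C := C) Ig); first exact: measurableT_comp mb measurable_fst.
    exact: aeW.
  have [I1 E1] := Rfubini1 Igb; rewrite /ip E1; apply: ae_eq_Rintegral.
  - by have /integrableP[/measurable_EFinP] := I1.
  - by apply: measurable_funM => //; have /integrableP[/measurable_EFinP] := Im.
  - have := ae_integrable1 Ig; apply: filterS => t It _.
    by rewrite /= RintegralZr.
have mm : measurable_fun setT m by have /integrableP[/measurable_EFinP] := Im.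
split=> [h b bb|h].
  rewrite E//; transitivity (\int[tm]_t (0 : R)); last by rewrite Rintegral_cst// mul0r.
  apply: ae_eq_Rintegral => //; first by apply: measurable_funM => //; exact: bb.1.
  by apply: filterS h => t ht _; rewrite /m ht mul0r.
pose b t : R := Num.max (-1) (Num.min 1 (m t)).
have bb : bmeas (b : measurableTypeR R -> R).
  split; first by apply: measurable_maxr => //; exact: measurable_minr.
  by exists 1 => t; rewrite ler_norml /b le_max lexx/= ge_max ge_min lexx andbT; lra.
have sb := bmeas_Lsq (time_measure_fin T) bb.
have := h b bb; rewrite E// => mb0.
have Imb : tm.-integrable setT (EFin \o (fun t => m t * b t)).
  by have [mb' [C hC]] := bb; exact: integrableMb Im mb' (aeW _ hC).
have le0 : \int[tm]_t (b t * b t) <= 0.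
  rewrite -mb0; apply: le_Rintegral => //; first exact: (integrableM sb sb).
  move=> t _; rewrite /b; have [h1|h1] := leP 1 (m t); have := h1.
    by rewrite max_r; lra.
  have [h2|h2] := leP (-1) (m t); first by [].
  by nra.
have b0 : \int[tm]_t (b t * b t) = 0 by apply/eqP; rewrite eq_le le0 ip_ge0.
have := ip_eq0 sb b0; apply: filterS => t /(_ I) /=; rewrite -/(m t) /b.
have [h1|h1] := leP 1 (m t).
  by rewrite max_r; lra.
by have [h2|h2] := leP (-1) (m t); [|lra].
Qed.

End weak_limits.

(** * The dual functional *)

Lemma integrable_scale d (X : measurableType d) (R : realType)
    (mu : {measure set X -> \bar R}) (k : R) (f : X -> R) :
  mu.-integrable setT (EFin \o f) -> mu.-integrable setT (EFin \o (fun z => k * f z)).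
Proof. exact: integrableZl. Qed.

Section dual_data.
Context (R : realType) (n : nat) (T aV : R).
Hypotheses (T_gt0 : 0 < T) (aV_gt0 : 0 < aV).

Local Notation X := (spacetime R n).
Local Notation tm := (time_measure T).
Local Notation tor := (torus R n).
Local Notation mu := (time_measure T \x torus R n)%E.
Local Notation Lsq f := (f \in Lfun mu 2%:E).
Local Notation ip := (ip mu).
Local Notation J := ('I_n * option 'I_n + option 'I_n)%type.
Implicit Types (D E : J -> X -> R) (W : 'I_n -> X -> R) (lam V : X -> 'rV[R]_n).

Let fin_mu := cylinder_fin T n.

(** [wderiv] is a choice among representatives; uniqueness a.e. identifies it with any derivative at
    hand. *)
Lemma wderivE v u g : Lsq g -> is_wderiv T v u g ->
  Lsq (wderiv T v u) /\ wderiv T v u = g %[ae mu].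
Proof.
move=> sg ug; rewrite /wderiv; case: xgetP => [g' -> [sg' ug']|].
  by split=> //; exact: wderiv_unique ug' ug.
by move=> /(_ g); case; split.
Qed.

Lemma wsymgradE lam i j s : L2 T s -> Loo T s -> is_wsymgrad T lam i j s ->
  [/\ Lsq (wsymgrad T lam i j), wsymgrad T lam i j = s %[ae mu] &
      exists C, {ae mu, forall z, `|wsymgrad T lam i j z| <= C}].
Proof.
move=> ss bs us; rewrite /wsymgrad; case: xgetP => [s' -> [bs' us']|].
  have [ms' [C sC]] := (Lfun_infP _ _).1 bs'.
  have ss' := Lsq_bounded fin_mu ms' sC.
  by split=> //; [exact: wsymgrad_unique us' us|exists C].
by move=> /(_ s); case; split.
Qed.

Lemma measurable_trace u t : 0 <= t <= T -> measurable_fun setT (@trace R n T u t).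
Proof.
move=> tT; rewrite /trace; case: xgetP => [w -> [v [_ cv ->]]|_].
  exact: Lsq_measurable (C_L2_slice cv tT).
exact: measurable_cst.
Qed.

(* The data attached to a dual variable (lambda, gamma): the time derivatives
   and symmetric gradient of lambda, then gamma and its partial derivatives;
   lambda itself is recovered as the primitive of its time derivative which
   vanishes at time T. *)
Definition dt D i : X -> R := D (inl (i, None)).
Definition sym D i j : X -> R := D (inl (i, Some j)).
Definition pr D : X -> R := D (inr None).
Definition gr D i : X -> R := D (inr (Some i)).
Definition lam_of D : X -> 'rV[R]_n := fun z => \row_i prim T (dt D i) z.

Lemma component_lam_of D i : component (lam_of D) i = prim T (dt D i).
Proof. by apply/funext => z; rewrite /component mxE. Qed.

(** The constraints of the dual class in forms stable under midpoints and limits. Vanishing at time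
    [T] is built into [lam_of]. Boundedness of the symmetric gradient is kept apart in
    [sym_bounded], since its constant has to be followed. *)
Record feasible D : Prop := Feasible {
  feasible_Lsq : forall j, Lsq (D j);
  feasible_div : div_free T (lam_of D);
  feasible_sym : forall i j, is_wsymgrad T (lam_of D) i j (sym D i j);
  feasible_grad : forall i, is_wderiv T (dirx R i) (pr D) (gr D i);
  feasible_mean : forall b : R -> R, bmeas (b : measurableTypeR R -> R) ->
    ip (pr D) (fun z => b z.1) = 0 }.

Definition sym_bounded C D := forall i j, {ae mu, forall z, `|sym D i j z| <= C}.

Context (F Vbar : X -> 'rV[R]_n) (V0 : 'rV[R]_n -> 'rV[R]_n).
Hypothesis sF : forall i, Lsq (component F i).
Hypothesis sVbar : forall i, Lsq (component Vbar i).
Hypothesis sV0 : forall i, component V0 i \in Lfun tor 2%:E.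

Local Notation v0 i := (component V0 i \o snd : X -> R).

Definition dual_force D i : X -> R := fun z => dt D i z + gr D i z - aV * component Vbar i z.

Definition quad D W := \sum_i \sum_j
  2^-1 * \int[mu]_z (W i z * W j z * (2 * sym D i j z + aV * (i == j)%:R)).

(** The last term is the one with the initial datum; its sign comes from lambda at time 0 being
    minus the time integral of its derivative. *)
Definition dual_cost D := 2^-1 * aV * (\sum_i ip (component Vbar i) (component Vbar i)) +
  \sum_i ip (component F i) (prim T (dt D i)) - \sum_i ip (dt D i) (v0 i).

Definition dual_form D W := quad D W + \sum_i ip (W i) (dual_force D i) + dual_cost D.

Lemma dual_force_Lsq D i : (forall j, Lsq (D j)) -> Lsq (dual_force D i).
Proof. by move=> sD; apply: LsqB (LsqZ aV (sVbar i)); apply: LsqD; exact: sD. Qed.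

Lemma v0_Lsq i : Lsq (v0 i).
Proof.
have /LsqP[mc Ic] := sV0 i; apply/LsqP; split; first exact: measurableT_comp mc measurable_snd.
have I1 : tm.-integrable setT (EFin \o cst 1).
  by apply: bmeas_integrable; [exact: time_measure_fin|exact: bmeas_cst].
by have [+ _] := Rintegral_prodM I1 Ic; apply: eq_integrable => // z _; rewrite /= mul1r.
Qed.

Lemma quad_integrable (w w' s : X -> R) C c : Lsq w -> Lsq w' -> Lsq s ->
  {ae mu, forall z, `|s z| <= C} ->
  mu.-integrable setT (EFin \o (fun z => w z * w' z * (2 * s z + c))).
Proof.
move=> sw sw' ss sC; apply: (integrableMb (C := 2 * C + `|c|) (integrableM sw sw')).
  apply: measurable_funD => //; apply: measurable_funM => //; exact: Lsq_measurable ss.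
apply: filterS sC => z sz; rewrite (le_trans (ler_normD _ _))// lerD2r normrM.
by rewrite (ger0_norm (_ : 0 <= 2))// ler_wpM2l.
Qed.

(** The functions [s'], [g'] and [G'] stand for the representatives chosen by [wsymgrad] and
    [wderiv], which agree with the data of [D] only a.e. *)
Lemma lagrangian_quad D C V (s' : 'I_n -> 'I_n -> X -> R) (g' G' : 'I_n -> X -> R) :
  (forall j, Lsq (D j)) -> sym_bounded C D -> (forall i, Lsq (component V i)) ->
  (forall i j, Lsq (s' i j)) -> (forall i, Lsq (g' i)) -> (forall i, Lsq (G' i)) ->
  (forall i j, s' i j = sym D i j %[ae mu]) ->
  (forall i, g' i = dt D i %[ae mu]) -> (forall i, G' i = gr D i %[ae mu]) ->
  \int[mu]_z (\sum_i \sum_j 2^-1 * V z 0 i * V z 0 j *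
       (2 * s' i j z + aV * (i == j)%:R) +
     \sum_i V z 0 i * (g' i z + G' i z - aV * Vbar z 0 i)) =
  quad D (component V) + \sum_i ip (component V i) (dual_force D i).
Proof.
move=> sD sC sV ss' sg' sG' s'E g'E G'E.
have Iq i j : mu.-integrable setT (EFin \o (fun z => 2^-1 *
    (component V i z * component V j z * (2 * sym D i j z + aV * (i == j)%:R)))).
  apply: integrable_scale; exact: quad_integrable (sV i) (sV j) (sD _) (sC i j).
have Il i := integrableM (sV i) (dual_force_Lsq i sD).
transitivity (\int[mu]_z (\sum_i \sum_j 2^-1 *
    (component V i z * component V j z * (2 * sym D i j z + aV * (i == j)%:R)) +
    \sum_i component V i z * dual_force D i z)); last first.
  rewrite RintegralD//; last 2 first.
  - by apply: integrable_Rsum => i; exact: integrable_Rsum.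
  - exact: integrable_Rsum.
  congr (_ + _); last by rewrite Rintegral_sum.
  rewrite Rintegral_sum => [|i]; last exact: integrable_Rsum.
  apply: eq_bigr => i _; rewrite Rintegral_sum//; apply: eq_bigr => j _.
  rewrite RintegralZl//; exact: quad_integrable (sV i) (sV j) (sD _) (sC i j).
have mV i := Lsq_measurable (sV i).
have ms i j := Lsq_measurable (ss' i j).
have mg i := Lsq_measurable (sg' i); have mG i := Lsq_measurable (sG' i).
have mb i := Lsq_measurable (sVbar i); have mD j := Lsq_measurable (sD j).
apply: ae_eq_Rintegral.
- apply: measurable_funD; apply: measurable_sum => i; last first.
    apply: measurable_funM; first exact: (mV i).
    apply: measurable_funB; first exact: measurable_funD (mg i) (mG i).
    exact: measurable_funM (measurable_cst _) (mb i).
  apply: measurable_sum => j; apply: measurable_funM.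
    apply: measurable_funM; last exact: (mV j).
    exact: measurable_funM (measurable_cst _) (mV i).
  by apply: measurable_funD => //; exact: measurable_funM (measurable_cst _) (ms i j).
- apply: measurable_funD; apply: measurable_sum => i; last first.
    apply: measurable_funM; first exact: (mV i).
    by apply: Lsq_measurable; exact: dual_force_Lsq.
  apply: measurable_sum => j; apply: measurable_funM => //.
  apply: measurable_funM; first exact: measurable_funM (mV i) (mV j).
  by apply: measurable_funD => //; apply: measurable_funM => //; exact: mD.
have h1 : {ae mu, forall z, forall i j, s' i j z = sym D i j z}.
  apply: filter_forall => i; apply: filter_forall => j.
  by apply: filterS (s'E i j) => z; apply.
have h2 : {ae mu, forall z, forall i, g' i z = dt D i z}.
  by apply: filter_forall => i; apply: filterS (g'E i) => z; apply.
have h3 : {ae mu, forall z, forall i, G' i z = gr D i z}.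
  by apply: filter_forall => i; apply: filterS (G'E i) => z; apply.
apply: filterS3 h1 h2 h3 => z e1 e2 e3 _.
congr (_ + _); apply: eq_bigr => i _; last by rewrite e2 e3.
by apply: eq_bigr => j _; rewrite e1 !mulrA.
Qed.

Lemma lagrangian_cost D lam (u : 'I_n -> 'rV[R]_n -> R) : (forall j, Lsq (D j)) ->
  (forall i, Lsq (component lam i)) ->
  (forall i, component lam i = prim T (dt D i) %[ae mu]) ->
  (forall i, measurable_fun setT (u i)) ->
  (forall i, u i = slice (prim T (dt D i)) 0 %[ae tor]) ->
  \int[mu]_z (2^-1 * aV * (\sum_i Vbar z 0 i * Vbar z 0 i) +
     \sum_i F z 0 i * lam z 0 i + T^-1 * (\sum_i u i z.2 * V0 z.2 0 i)) = dual_cost D.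
Proof.
move=> sD sl lE mu_ uE.
have sp i := (prim_Lsq T_gt0 (sD (inl (i, None)))).1.
have Ip i := ip_prim0 T_gt0 (sD (inl (i, None))) (sV0 i).
have I1 i := integrableM (sVbar i) (sVbar i).
have I2 i := integrableM (sF i) (sp i).
have I1s : mu.-integrable setT (EFin \o (fun z => 2^-1 * aV *
    \sum_i component Vbar i z * component Vbar i z)).
  by apply: integrable_scale; exact: integrable_Rsum.
have I2s : mu.-integrable setT (EFin \o (fun z => \sum_i component F i z * prim T (dt D i) z)).
  exact: integrable_Rsum.
have I3s : mu.-integrable setT (EFin \o (fun z =>
    \sum_i prim T (dt D i) (0, z.2) * component V0 i z.2)).
  by apply: integrable_Rsum => i; exact: (Ip i).1.
transitivity (\int[mu]_z ((2^-1 * aV * (\sum_i component Vbar i z * component Vbar i z) +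
     \sum_i component F i z * prim T (dt D i) z) +
     T^-1 * (\sum_i prim T (dt D i) (0, z.2) * component V0 i z.2))); last first.
  rewrite RintegralD//; last 2 first.
  - by have := integrableD measurableT I1s I2s.
  - exact: integrable_scale.
  rewrite RintegralD// RintegralZl//; last exact: integrable_Rsum.
  rewrite RintegralZl// !Rintegral_sum// => [|i]; last exact: (Ip i).1.
  rewrite /dual_cost; congr (_ + _); rewrite -sumrN mulr_sumr; apply: eq_bigr => i _.
  by rewrite (Ip i).2 mulrN mulKf// gt_eqF.
have mb i := Lsq_measurable (sVbar i); have mF i := Lsq_measurable (sF i).
have ml i := Lsq_measurable (sl i); have mp i := Lsq_measurable (sp i).
have mv i := Lsq_measurable (v0_Lsq i).
apply: ae_eq_Rintegral.
- apply: measurable_funD; last first.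
    apply: measurable_funM => //; apply: measurable_sum => i.
    apply: measurable_funM; last exact: (mv i).
    exact: measurableT_comp (mu_ i) measurable_snd.
  apply: measurable_funD.
    apply: measurable_funM => //; apply: measurable_sum => i.
    exact: measurable_funM (mb i) (mb i).
  apply: measurable_sum => i; exact: measurable_funM (mF i) (ml i).
- apply: measurable_funD.
    by apply: measurable_funD; [have /integrableP[/measurable_EFinP] := I1s|
      have /integrableP[/measurable_EFinP] := I2s].
  by apply: measurable_funM => //; have /integrableP[/measurable_EFinP] := I3s.
have h1 : {ae mu, forall z, forall i, component lam i z = prim T (dt D i) z}.
  by apply: filter_forall => i; apply: filterS (lE i) => z; apply.
have h2 : {ae mu, forall z, forall i, u i z.2 = prim T (dt D i) (0, z.2)}.
  apply: filter_forall => i; apply: (ae_snd tm (P := fun x => u i x = prim T (dt D i) (0, x))).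
  by apply: filterS (uE i) => x; apply.
apply: filterS2 h1 h2 => z e1 e2 _; congr (_ + _ + _ * _).
  by apply: eq_bigr => i _; rewrite -e1.
by apply: eq_bigr => i _; rewrite e2.
Qed.

End dual_data.

(** * Correspondence between dual variables and their data *)

Section dual_variables.
Context (R : realType) (n : nat) (T aV : R).
Hypotheses (T_gt0 : 0 < T).

Local Notation X := (spacetime R n).
Local Notation tor := (torus R n).
Local Notation mu := (time_measure T \x torus R n)%E.
Local Notation Lsq f := (f \in Lfun mu 2%:E).
Local Notation J := ('I_n * option 'I_n + option 'I_n)%type.
Implicit Types (D E : J -> X -> R) (W : 'I_n -> X -> R) (lam V : X -> 'rV[R]_n).

Let fin_mu := cylinder_fin T n.

Context (F Vbar : X -> 'rV[R]_n) (V0 : 'rV[R]_n -> 'rV[R]_n).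
Hypothesis sF : forall i, Lsq (component F i).
Hypothesis sVbar : forall i, Lsq (component Vbar i).
Hypothesis sV0 : forall i, component V0 i \in Lfun tor 2%:E.

Local Notation val := (dual_form T aV F Vbar V0).
Local Notation L := (lagrangian T aV V0 F Vbar).

Lemma LooP s : Loo T s <-> measurable_fun setT s /\ exists C, {ae mu, forall z, `|s z| <= C}.
Proof. exact: Lfun_infP. Qed.

Lemma wsymgrad_ae lam lam' i j s : (forall i, Lsq (component lam i)) ->
  (forall i, Lsq (component lam' i)) ->
  (forall i, component lam i = component lam' i %[ae mu]) ->
  is_wsymgrad T lam i j s -> is_wsymgrad T lam' i j s.
Proof.
move=> sl sl' ll' h; apply/wsymgrad_ip => // phi tphi.
rewrite -((wsymgrad_ip i j s sl).1 h _ tphi).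
have md v := Lsq_measurable (smooth_dLsq v tphi).
have ml i' := Lsq_measurable (sl i'); have ml' i' := Lsq_measurable (sl' i').
by rewrite (ip_ae (ml i) (ml' i) (md _) (ll' i)) (ip_ae (ml j) (ml' j) (md _) (ll' j)).
Qed.

Lemma div_free_ae lam lam' : (forall i, Lsq (component lam i)) ->
  (forall i, Lsq (component lam' i)) ->
  (forall i, component lam i = component lam' i %[ae mu]) ->
  div_free T lam -> div_free T lam'.
Proof.
move=> sl sl' ll' h; apply/div_free_ip => // phi tphi.
apply: etrans ((div_free_ip sl).1 h _ tphi); apply: eq_bigr => i _.
have md v := Lsq_measurable (smooth_dLsq v tphi).
have ml := Lsq_measurable (sl i); have ml' := Lsq_measurable (sl' i).
by rewrite (ip_ae ml ml' (md _) (ll' i)).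
Qed.

Lemma lagrangian_val p D C V : (forall j, Lsq (D j)) -> sym_bounded T C D ->
  (forall i, Lsq (component p.1 i)) ->
  (forall i, component p.1 i = prim T (dt D i) %[ae mu]) ->
  (forall i, is_wderiv T (dirt R n) (component p.1 i) (dt D i)) ->
  (forall i j, is_wsymgrad T p.1 i j (sym D i j)) ->
  (forall i, is_wderiv T (dirx R i) p.2 (gr D i)) -> vL2 T V ->
  L p V = val D (component V).
Proof.
case: p => lam gam /= sD sC sl lE lt ls lg sV.
have bs i j : Loo T (sym D i j).
  by apply/LooP; split; [exact: Lsq_measurable (sD _)|exists C; exact: sC].
have h1 i := wderivE T_gt0 (sD (inl (i, None))) (lt i).
have h2 i := wderivE T_gt0 (sD (inr (Some i))) (lg i).
have h3 i j := wsymgradE T_gt0 (sD (inl (i, Some j))) (bs i j) (ls i j).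
have e1 : forall V : X -> 'rV[R]_n, (forall i, Lsq (component V i)) -> _ :=
  fun V sV => lagrangian_quad aV sVbar sD sC sV (fun i j => let: And3 a _ _ := h3 i j in a)
  (fun i => (h1 i).1) (fun i => (h2 i).1) (fun i j => let: And3 _ a _ := h3 i j in a)
  (fun i => (h1 i).2) (fun i => (h2 i).2).
have T0 : (0 : R) <= 0 <= T by rewrite lexx/= ltW.
have e2 := lagrangian_cost aV T_gt0 sF sVbar sV0 sD sl lE
  (fun i => measurable_trace (component lam i) T0)
  (fun i => trace_prim T_gt0 (sD (inl (i, None))) (lE i) T0).
rewrite /lagrangian /val -e2 -e1//.
Qed.

Lemma feasible_dual_class D C : feasible T D -> sym_bounded T C D ->
  dual_class T (lam_of T D, pr D) /\
  forall V, vL2 T V -> L (lam_of T D, pr D) V = val D (component V).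
Proof.
move=> fD sC; have [sD dD yD gD mD] := fD.
have sp i : Lsq (component (lam_of T D) i).
  by rewrite component_lam_of; exact: (prim_Lsq T_gt0 (sD _)).1.
have wt i : is_wderiv T (dirt R n) (component (lam_of T D) i) (dt D i).
  by rewrite component_lam_of; apply: prim_wderiv => //; exact: sD.
have lE i : component (lam_of T D) i = prim T (dt D i) %[ae mu].
  by rewrite component_lam_of; apply: aeW.
have bs i j : Loo T (sym D i j).
  by apply/LooP; split; [exact: Lsq_measurable (sD _)|exists C; exact: sC].
split; last by move=> V sV; exact: (lagrangian_val sD sC).
split => //.
- move=> i; split; first exact: sp.
  by exists (dt D i); split; [exact: sD|exact: wt].
- by move=> i j; exists (sym D i j); split; [exact: bs|exact: yD].
- move=> i; have TT : 0 <= T <= T by rewrite lexx andbT ltW.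
  have := trace_prim T_gt0 (sD (inl (i, None))) (lE i) TT.
  apply: filterS2 (prim_T T_gt0 (sD (inl (i, None)))) => x h0 h1 I.
  by rewrite h1// h0.
- split; last exact/(mean_zeroP (sD _)).
  split; first exact: sD.
  by move=> i; exists (gr D i); split; [exact: sD|exact: gD].
Qed.

(** Lambda agrees a.e. with the primitive of its time derivative because its trace at [T] vanishes;
    all constraints are then carried over to that primitive. Finitely many entries allow one common
    bound. *)
Lemma dual_class_feasible p : dual_class T p -> exists D C,
  [/\ feasible T D, sym_bounded T C D &
      forall V, vL2 T V -> L p V = val D (component V)].
Proof.
case: p => lam gam [/= Hl Hs dl Ht [[sgam Hg] Hm]].
have /choice[g hg] : forall i, exists g, L2 T g /\ is_wderiv T (dirt R n) (component lam i) g.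
  by move=> i; have [_] := Hl i.
have /choice[G hG] := Hg.
have /choice[s hs] : forall ij : 'I_n * 'I_n, exists s, Loo T s /\ is_wsymgrad T lam ij.1 ij.2 s.
  by move=> [i j]; exact: Hs.
have /choice[C HC] : forall ij, exists C, {ae mu, forall z, `|s ij z| <= C}.
  by move=> ij; have [/LooP[_]] := hs ij.
pose D (j : J) : X -> R := match j with
  | inl (i, None) => g i | inl (i, Some k) => s (i, k)
  | inr None => gam | inr (Some i) => G i end.
have sC : sym_bounded T (\sum_ij `|C ij|) D.
  move=> i j; apply: filterS (HC (i, j)) => z /le_trans; apply.
  rewrite (le_trans (ler_norm _))// (bigD1 (i, j))//= lerDl sumr_ge0//.
have ss ij : Lsq (s ij).
  by have [/LooP[ms [B HB]] _] := hs ij; exact: (Lsq_bounded fin_mu ms HB).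
have sD j : Lsq (D j).
  case: j => [[i [k|]]|[i|]] /=; [exact: ss|exact: (hg i).1|exact: (hG i).1|exact: sgam].
have sl i : Lsq (component lam i) by have [] := Hl i.
have lE i : component lam i = prim T (dt D i) %[ae mu].
  exact: (wderiv_trace0 T_gt0 (sl i) (hg i).1 (hg i).2 (Ht i)).
have sl' i : Lsq (component (lam_of T D) i).
  by rewrite component_lam_of; exact: (prim_Lsq T_gt0 (sD _)).1.
have lE' i : component lam i = component (lam_of T D) i %[ae mu].
  by rewrite component_lam_of; exact: lE.
exists D, (\sum_ij `|C ij|); split => //.
- split=> //.
  + exact: div_free_ae lE' dl.
  + by move=> i j; apply: wsymgrad_ae lE' _ => //; exact: (hs (i, j)).2.
  + by move=> i; exact: (hG i).2.
  + exact/(mean_zeroP (sD (inr None))).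
- move=> V sV; apply: (@lagrangian_val (lam, gam) D _ V sD sC) => //.
  + by move=> i; exact: (hg i).2.
  + by move=> i j; exact: (hs (i, j)).2.
  + by move=> i; exact: (hG i).2.
Qed.

End dual_variables.

(** * Pointwise bounds on superlevel sets *)

Lemma quadratic_lead_ge0 (R : realFieldType) (q l c a : R) :
  (forall k, a <= q * k ^+ 2 + l * k + c) -> 0 <= q.
Proof.
move=> h; rewrite leNgt; apply/negP => q0.
have N0 : 0 <= `|l| + `|c| + `|a| by rewrite !addr_ge0.
(* Chosen so that [q k = q - (|l| + |c| + |a|)]. As [k >= 1], the quadratic at [k] is then below
   [- |a|], hence below [a]. *)
pose k := 1 + (`|l| + `|c| + `|a|) / - q.
have k1 : 1 <= k by rewrite lerDl divr_ge0// oppr_ge0 ltW.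
have qk : q * k = q - (`|l| + `|c| + `|a|).
  by rewrite /k mulrDr mulr1 invrN mulrN mulrN mulrC divfK// lt_eqF.
have := h k; rewrite expr2 mulrA qk.
have hl := ler_norm l; have hc := ler_norm c.
have ha : - `|a| <= a by rewrite lerNl -normrN ler_norm.
have n1 := normr_ge0 l; have n2 := normr_ge0 c; have n3 := normr_ge0 a.
nra.
Qed.

Lemma ae_eq0_le0 d (X : measurableType d) (R : realType) (mu : {measure set X -> \bar R})
    (f : X -> R) : mu.-integrable setT (EFin \o f) -> (forall x, 0 <= f x) ->
  \int[mu]_x f x <= 0 -> {ae mu, forall x, f x = 0}.
Proof.
move=> If f0 le0; have i0 : \int[mu]_x f x = 0.
  by apply/eqP; rewrite eq_le le0 Rintegral_ge0.
have : (\int[mu]_x `|(f x)%:E| = 0)%E.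
  rewrite (eq_integral (fun x => (f x)%:E)) => [|x _]; last by rewrite gee0_abs// lee_fin.
  by rewrite -[LHS]fineK ?integrable_fin_num// -/(Rintegral _ _ _) i0.
move/ae_eq_integral_abs => /(_ measurableT) H.
have /H : measurable_fun setT (fun x => (f x)%:E) by case/integrableP : If.
by apply: filterS => x /= /(_ I) [].
Qed.

Section superlevel.
Context (R : realType) (n : nat) (T aV : R).
Hypotheses (T_gt0 : 0 < T) (aV_gt0 : 0 < aV).

Local Notation X := (spacetime R n).
Local Notation mu := (time_measure T \x torus R n)%E.
Local Notation Lsq f := (f \in Lfun mu 2%:E).
Local Notation ip := (ip mu).
Local Notation J := ('I_n * option 'I_n + option 'I_n)%type.
Implicit Types (D E : J -> X -> R) (W : 'I_n -> X -> R).

Let fin_mu := cylinder_fin T n.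

Context (F Vbar : X -> 'rV[R]_n) (V0 : 'rV[R]_n -> 'rV[R]_n).
Hypothesis sVbar : forall i, Lsq (component Vbar i).

Local Notation val := (dual_form T aV F Vbar V0).
Local Notation cost := (dual_cost T aV F Vbar V0).
Local Notation force := (dual_force aV Vbar).

Definition superlevel a D := forall W, (forall i, Lsq (W i)) -> a <= val D W.

Definition form D i j : X -> R := fun z => 2 * sym D i j z + aV * (i == j)%:R.

Lemma quad_directional D C (xi : 'I_n -> R) (b : X -> R) (k : R) :
  (forall j, Lsq (D j)) -> sym_bounded T C D -> Lsq b ->
  quad T aV D (fun i z => k * (xi i * b z)) =
  2^-1 * k ^+ 2 *
    \int[mu]_z (b z * b z * \sum_i \sum_j xi i * xi j * form D i j z).
Proof.
move=> sD sC sb.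
have Ib i j : mu.-integrable setT (EFin \o (fun z => b z * b z * form D i j z)).
  exact: (quad_integrable _ sb sb (sD _) (sC i j)).
have Ix i j : mu.-integrable setT (EFin \o (fun z => xi i * xi j * (b z * b z * form D i j z))).
  exact: integrable_scale.
transitivity (\sum_i \sum_j 2^-1 * k ^+ 2 *
    \int[mu]_z (xi i * xi j * (b z * b z * form D i j z))).
  apply: eq_bigr => i _; apply: eq_bigr => j _.
  rewrite -[RHS]mulrA; congr (2^-1 * _); rewrite -RintegralZl//.
  apply: eq_Rintegral => z _.
  by rewrite /form; ring.
under eq_bigr do rewrite -mulr_sumr; rewrite -mulr_sumr; congr (_ * _).
transitivity (\int[mu]_z \sum_i \sum_j xi i * xi j * (b z * b z * form D i j z)).
  rewrite Rintegral_sum => [|i]; last exact: integrable_Rsum.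
  by apply: eq_bigr => i _; rewrite Rintegral_sum.
apply: eq_Rintegral => z _; rewrite mulr_sumr; apply: eq_bigr => i _.
by rewrite mulr_sumr; apply: eq_bigr => j _; ring.
Qed.

(** The test field is [k] times the indicator of the set where the form is negative in the direction
    [xi]; half the integral of the form over that set is the leading coefficient of a quadratic in
    [k] bounded below. The null set depends on [xi], which is harmless as finitely many directions
    are used. *)
Lemma form_ge0 D C a (xi : 'I_n -> R) : (forall j, Lsq (D j)) -> sym_bounded T C D ->
  superlevel a D ->
  {ae mu, forall z, 0 <= \sum_i \sum_j xi i * xi j * form D i j z}.
Proof.
move=> sD sC sup; pose Q z := \sum_i \sum_j xi i * xi j * form D i j z.
have sform i j : Lsq (form D i j).
  apply: LsqD (Lsq_cst fin_mu _); exact: LsqZ (sD _).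
have sQ : Lsq Q by apply: Lsq_sum => i; apply: Lsq_sum => j; exact: LsqZ.
have mQ := Lsq_measurable sQ.
pose b z : R := (Q z < 0)%R%:R.
have bb : bmeas b.
  split; last by exists 1 => z; rewrite /b; case: (Q z < 0); rewrite ?normr1 ?normr0.
  rewrite (_ : b = \1_([set z | Q z < 0])); last first.
    by apply/funext => x; rewrite indicE; congr (nat_of_bool _)%:R; apply/idP/idP; rewrite inE.
  apply: measurable_indic.
  have := @measurable_fun_ltr _ _ R setT Q (cst 0) mQ (measurable_cst _).
  by move=> /(_ measurableT [set true] I); rewrite setTI.
have sb : Lsq b by exact: bmeas_Lsq.
have q0 : 0 <= 2^-1 * \int[mu]_z (b z * b z * Q z).
  apply: (@quadratic_lead_ge0 _ _ (\sum_i xi i * ip b (force D i)) (cost D) a) => k.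
  have sW i : Lsq (fun z => k * (xi i * b z)) by apply: LsqZ; exact: LsqZ.
  have := sup _ sW; rewrite /val (quad_directional _ _ sD sC sb).
  rewrite (_ : 2^-1 * k ^+ 2 * _ = 2^-1 * \int[mu]_z (b z * b z * Q z) * k ^+ 2);
    last by rewrite mulrAC.
  rewrite (_ : \sum_i ip _ _ = (\sum_i xi i * ip b (force D i)) * k)//.
  rewrite mulr_suml; apply: eq_bigr => i _.
  have sf := dual_force_Lsq aV sVbar i sD.
  by rewrite ipZl//; [rewrite ipZl// mulrC|exact: LsqZ].
have Ib : mu.-integrable setT (EFin \o (fun z => - (b z * b z * Q z))).
  have h := integrableM (bmeas_Lsq_mul sb bb) sQ.
  by have := integrable_scale (-1) h; apply: eq_integrable => // z _; rewrite /= mulN1r.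
have H : {ae mu, forall z, - (b z * b z * Q z) = 0}.
  apply: (ae_eq0_le0 Ib) => [z|].
    rewrite /b; have [Qz|Qz] := ltP (Q z) 0; last by rewrite !mul0r oppr0.
    by rewrite !mul1r oppr_ge0 ltW.
  have h := integrableM (bmeas_Lsq_mul sb bb) sQ.
  rewrite (_ : \int[mu]_z _ = - \int[mu]_z (b z * b z * Q z)); last first.
    rewrite -mulN1r -RintegralZl//; apply: eq_Rintegral => z _.
    by rewrite mulN1r.
  lra.
apply: filterS H => z; rewrite -/(Q z) /b; have [Qz|//] := ltP (Q z) 0.
by rewrite !mul1r => /eqP; rewrite oppr_eq0 => /eqP h; rewrite h ltxx in Qz.
Qed.

Lemma sum_delta2 (f : 'I_n -> R) (c : R) i j :
  \sum_k ((k == i)%:R + c * (k == j)%:R) * f k = f i + c * f j.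
Proof.
under eq_bigr do rewrite mulrDl -mulrA; rewrite big_split/= -mulr_sumr.
have E i' : \sum_k (k == i')%:R * f k = f i'.
  by rewrite (bigD1 i')//= eqxx mul1r big1 ?addr0// => k /negbTE ->; rewrite mul0r.
by rewrite !E.
Qed.

Lemma form_delta2 D (c : R) i j z : let xi k := (k == i)%:R + c * (k == j)%:R in
  \sum_k \sum_l xi k * xi l * form D k l z =
  form D i i z + c * (form D i j z + form D j i z) + c ^+ 2 * form D j j z.
Proof.
move=> xi; transitivity (\sum_k xi k * (form D k i z + c * form D k j z)).
  apply: eq_bigr => k _; rewrite -(sum_delta2 (fun l => form D k l z)) mulr_sumr.
  by apply: eq_bigr => l _; rewrite mulrA.
by rewrite sum_delta2; ring.
Qed.

(** The directions [e_i] give diagonal entries at least [- aV / 2], and zero trace then bounds them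
    above by [(n - 1) aV / 2]. The directions [e_i + e_j] and [e_i - e_j] bound an off-diagonal
    entry by half of the sum of two diagonal entries and [aV], at most [n aV / 2]. The constant no
    longer depends on [C]. *)
Lemma superlevel_sym_bounded D C a : feasible T D -> sym_bounded T C D ->
  superlevel a D -> sym_bounded T (n%:R * aV) D.
Proof.
move=> [sD dD yD _ _] sC sup i j.
have sl i' : Lsq (component (lam_of T D) i').
  by rewrite component_lam_of; exact: (prim_Lsq T_gt0 (sD _)).1.
have tr := wsymgrad_trace0 T_gt0 sl (fun k => sD (inl (k, Some k))) (fun k => yD k k) dD.
have eqs : sym D i j = sym D j i %[ae mu].
  exact: (wsymgrad_unique T_gt0 (sD _) (sD _) (yD i j) (wsymgrad_sym (yD j i))).
have pos (c : R) k l : {ae mu, forall z, 0 <= form D k k z +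
    c * (form D k l z + form D l k z) + c ^+ 2 * form D l l z}.
  have := form_ge0 (fun m => (m == k)%:R + c * (m == l)%:R) sD sC sup.
  by apply: filterS => z; rewrite form_delta2.
have h0 : {ae mu, forall z, forall k, 0 <= form D k k z}.
  apply: filter_forall => k; apply: filterS (pos 0 k k) => z.
  by rewrite expr0n !mul0r !addr0.
have h12 : {ae mu, forall z,
   `|form D i j z + form D j i z| <= form D i i z + form D j j z}.
  apply: filterS2 (pos 1 i j) (pos (-1) i j) => z p1 p2.
  by rewrite ler_norml; move: p1 p2; rewrite sqrrN expr1n => p1 p2; apply/andP; split; lra.
have {}eqs : {ae mu, forall z, sym D i j z = sym D j i z}.
  by apply: filterS eqs => z; apply.
apply: filterS3 h0 h12 (filterI tr eqs) => z p0 p12 [t0 e].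
have lo k : - (aV / 2) <= sym D k k z.
  by have := p0 k; rewrite /form eqxx mulr1; lra.
have n1 : 1 <= n%:R :> R by rewrite ler1n (leq_trans _ (ltn_ord i)).
have up k : sym D k k z <= (n%:R - 1) * (aV / 2).
  have := t0; rewrite (bigD1 k)//= => /eqP; rewrite addr_eq0 => /eqP e'.
  rewrite [leLHS]e'.
  rewrite -sumrN (@le_trans _ _ (\sum_(l < n | l != k) aV / 2))//.
    by apply: ler_sum => l _; rewrite lerNl; exact: lo.
  rewrite sumr_const -[leLHS]mulr_natl; have -> : #|[pred l : 'I_n | l != k]| = n.-1.
    by rewrite cardC1 card_ord.
  by rewrite -subn1 natrB// (leq_ltn_trans _ (ltn_ord k)).
have [ij|ij] := eqVneq i j.
  rewrite -ij ler_norml; apply/andP; split; have := lo i; have := up i; nra.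
move: p12; rewrite /form !eqxx (eq_sym j) (negbTE ij) -e
   !mulr1 !mulr0 !addr0 !ler_norml => /andP[q1 q2].
have ui := up i; have uj := up j; apply/andP; split; nra.
Qed.

End superlevel.

(** * Coercivity of the dual functional *)

Lemma ae_le_Rintegral d (X : measurableType d) (R : realType)
    (mu : {measure set X -> \bar R}) (f g : X -> R) :
  mu.-integrable setT (EFin \o f) -> mu.-integrable setT (EFin \o g) ->
  {ae mu, forall x, f x <= g x} -> \int[mu]_x f x <= \int[mu]_x g x.
Proof.
move=> If Ig fg; rewrite -subr_ge0 -RintegralB//.
have Id : mu.-integrable setT (EFin \o (fun x => g x - f x)).
  by have := integrableB measurableT Ig If.
have [|_] := @ae_le_integrable _ _ _ mu (cst 0) _ (measurable_cst _) Id.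
  by apply: filterS fg => x; rewrite lexx subr_ge0.
apply: le_trans; rewrite (_ : \int[mu]_x _ = \int[mu]_x (cst 0 x * f x)).
  by rewrite RintegralZl// mul0r.
by apply: eq_Rintegral => x _; rewrite mul0r.
Qed.

Section coercivity.
Context (R : realType) (n : nat) (T aV : R).
Hypotheses (T_gt0 : 0 < T) (aV_gt0 : 0 < aV).

Local Notation X := (spacetime R n).
Local Notation tor := (torus R n).
Local Notation mu := (time_measure T \x torus R n)%E.
Local Notation Lsq f := (f \in Lfun mu 2%:E).
Local Notation ip := (ip mu).
Local Notation J := ('I_n * option 'I_n + option 'I_n)%type.
Implicit Types (D E : J -> X -> R) (W : 'I_n -> X -> R).

Let fin_mu := cylinder_fin T n.

Context (F Vbar : X -> 'rV[R]_n) (V0 : 'rV[R]_n -> 'rV[R]_n).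
Hypothesis sF : forall i, Lsq (component F i).
Hypothesis sVbar : forall i, Lsq (component Vbar i).
Hypothesis sV0 : forall i, component V0 i \in Lfun tor 2%:E.

Local Notation cost := (dual_cost T aV F Vbar V0).
Local Notation force := (dual_force aV Vbar).
Local Notation superlevel := (superlevel T aV F Vbar V0).
Local Notation v0 i := (component V0 i \o snd : X -> R).
Local Notation sq f := (ip f f).

(** The entries of the form are at most [(2n + 1) aV] in absolute value, and the double sum of
    products contributes a factor of order [n]; [n + 1] in place of [n] keeps [kappa] positive also
    for [n = 0]. *)
Definition kappa : R := (2 * n%:R + 1) * (n%:R + 1) * aV.

Lemma kappa_gt0 : 0 < kappa.
Proof. by rewrite !mulr_gt0// ltr_wpDl ?mulr_ge0. Qed.

Lemma quad_le D W : (forall j, Lsq (D j)) -> sym_bounded T (n%:R * aV) D ->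
  (forall i, Lsq (W i)) -> quad T aV D W <= kappa * \sum_i sq (W i).
Proof.
have scalar (m N S : R) : 0 <= m -> 0 <= N -> 0 <= S ->
    m / 4 * (N * (S + S)) <= m * (N + 1) * S.
  move=> m0 N0 S0; have := mulr_ge0 (mulr_ge0 m0 N0) S0; have := mulr_ge0 m0 S0; lra.
move=> sD sC sW; pose m : R := (2 * n%:R + 1) * aV.
have m0 : 0 <= m by rewrite mulr_ge0 ?ltW// ltr_wpDl ?mulr_ge0.
have I0 i j := quad_integrable (aV * (i == j)%:R) (sW i) (sW j) (sD (inl (i, Some j))) (sC i j).
have le i j : \int[mu]_z (W i z * W j z * (2 * sym D i j z + aV * (i == j)%:R)) <=
    m * (2^-1 * (sq (W i) + sq (W j))).
  have I1 := integrableM (sW i) (sW i); have I2 := integrableM (sW j) (sW j).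
  have I12 : mu.-integrable setT (EFin \o (fun z => W i z * W i z + W j z * W j z)).
    by have := integrableD measurableT I1 I2.
  have I3 := integrable_scale m (integrable_scale 2^-1 I12).
  rewrite /ip -RintegralD// -RintegralZl// -RintegralZl//; last exact: integrable_scale.
  apply: ae_le_Rintegral; [exact: (I0 i j)|exact: I3|].
  apply: filterS (sC i j) => z sz.
  set A := W i z; set B := W j z; set S := 2 * _ + _.
  have hS : `|S| <= m.
    rewrite (le_trans (ler_normD _ _))// !normrM (ger0_norm (_ : 0 <= 2))//.
    have hd : `|(i == j)%:R| <= 1 :> R by case: (i == j); rewrite ?normr1 ?normr0.
    have := ler_wpM2l (ltW aV_gt0) hd; rewrite (ger0_norm (ltW aV_gt0)) /m.
    by move: sz; lra.
  have hAB : `|A * B| <= 2^-1 * (A * A + B * B).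
    by rewrite ler_norml; apply/andP; split; have := sqr_ge0 (A + B); have := sqr_ge0 (A - B);
      rewrite !expr2; lra.
  rewrite (le_trans (ler_norm _))// normrM mulrC ler_pM//.
have {}le i j : 2^-1 * \int[mu]_z (W i z * W j z * (2 * sym D i j z + aV * (i == j)%:R)) <=
    m / 4 * (sq (W i) + sq (W j)) by have := le i j; lra.
have := ler_sum (index_enum 'I_n) (P := xpredT)
  (fun i _ => ler_sum (index_enum 'I_n) (P := xpredT) (fun j _ => le i j)).
move=> /le_trans; apply.
under eq_bigr do rewrite -mulr_sumr big_split/= sumr_const card_ord.
rewrite -mulr_sumr big_split/= sumr_const card_ord sumrMnl -mulrnDl.
rewrite -[(_ + _) *+ n]mulr_natl /kappa.
have -> : (2 * n%:R + 1) * (n%:R + 1) * aV = m * (n%:R + 1) by rewrite /m; ring.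
apply: scalar => //; apply: sumr_ge0 => i _; exact: ip_ge0.
Qed.

(** Collects what remains in [coercive] once the norms of the time derivatives and of the gradient
    are absorbed on the left: the price of replacing the force by its part free of [Vbar], and the
    data terms of [cost_le]. *)
Definition coercivity_const : R := let N := \sum_i sq (component Vbar i) in
  aV ^+ 2 * N / (4 * kappa) + aV * N / 2 +
  4 * kappa * (T ^+ 2 + 1) * (\sum_i sq (component F i) + \sum_i sq (v0 i)).

Lemma cost_le D (e : R) : (forall j, Lsq (D j)) -> 0 < e ->
  cost D <= aV / 2 * \sum_i sq (component Vbar i) +
    e * (T ^+ 2 + 1) / 2 * \sum_i sq (dt D i) +
    (2 * e)^-1 * (\sum_i sq (component F i) + \sum_i sq (v0 i)).
Proof.
move=> sD e0; have sg i : Lsq (dt D i) by exact: sD.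
have y1 i : ip (component F i) (prim T (dt D i)) <=
    e * T ^+ 2 / 2 * sq (dt D i) + (2 * e)^-1 * sq (component F i).
  have [sp pT] := prim_Lsq T_gt0 (sg i).
  have := ip_young sp (sF i) e0; rewrite ipC invfM.
  have := ler_wpM2l (ltW e0) pT; set ie := e^-1; rewrite mulr2n; lra.
have y2 i : - ip (dt D i) (v0 i) <= e / 2 * sq (dt D i) + (2 * e)^-1 * sq (v0 i).
  have sN := LsqN (sg i).
  have := ip_young sN (v0_Lsq T sV0 i) e0; rewrite invfM.
  have -> : sq (- dt D i) = sq (dt D i).
    by apply: eq_Rintegral => z _; rewrite !fctE mulrNN.
  have -> : ip (- dt D i) (v0 i) = - ip (dt D i) (v0 i).
    have := ipZl (-1) (sg i) (v0_Lsq T sV0 i); rewrite mulN1r => <-.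
    by apply: eq_Rintegral => z _; rewrite !fctE mulN1r.
  set ie := e^-1; rewrite mulr2n; lra.
have h1 := ler_sum (index_enum 'I_n) (P := xpredT) (fun i _ => y1 i).
have h2 := ler_sum (index_enum 'I_n) (P := xpredT) (fun i _ => y2 i).
rewrite big_split/= -!mulr_sumr in h1; rewrite sumrN big_split/= -!mulr_sumr in h2.
rewrite /dual_cost; move: h1 h2; set ie := (2 * e)^-1; lra.
Qed.

Lemma dt_grad_orthogonal D : feasible T D -> \sum_i ip (dt D i) (gr D i) = 0.
Proof.
move=> [sD dD _ gD _].
have sl i : Lsq (component (lam_of T D) i).
  by rewrite component_lam_of; exact: (prim_Lsq T_gt0 (sD _)).1.
apply: (hart_div_grad_orthogonal T_gt0 (sD (inr None)) (fun i => sD (inr (Some i)))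
  (fun i => sD (inl (i, None)))).
- by move=> i; exact: wderiv_hart_deriv (sD _) (sD _) (gD i).
- move=> K; apply: (div_free_dt_hart K sl (fun i => sD (inl (i, None))) _ dD).
  by move=> i; rewrite component_lam_of; exact: prim_wderiv (sD _).
Qed.

Lemma coercive D a : feasible T D -> sym_bounded T (n%:R * aV) D -> superlevel a D ->
  a + (\sum_i sq (dt D i) + \sum_i sq (gr D i)) / (16 * kappa) <= coercivity_const.
Proof.
move=> fD sC sup; have [sD _ _ _ _] := fD.
have k0 := kappa_gt0.
have sf i := dual_force_Lsq aV sVbar i sD.
set N := \sum_i sq (component Vbar i).
set A := \sum_i sq (dt D i); set B := \sum_i sq (gr D i).
pose H := \sum_i sq (force D i).
have hH : a <= - H / (4 * kappa) + cost D.
  (* This step length minimizes [kappa th^2 H - th H], with value [- H / (4 kappa)]. *)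
  pose th := (2 * kappa)^-1; pose W i : X -> R := fun z => - th * force D i z.
  have sW i : Lsq (W i) by exact: LsqZ.
  have := sup _ sW; rewrite /dual_form.
  have := quad_le sD sC sW.
  have -> : \sum_i sq (W i) = th ^+ 2 * H.
    rewrite mulr_sumr; apply: eq_bigr => i _; rewrite ipZl// ipZr//.
    by rewrite mulrA mulrNN expr2.
  have -> : \sum_i ip (W i) (force D i) = - th * H.
    by rewrite mulr_sumr; apply: eq_bigr => i _; rewrite ipZl.
  have -> : - H / (4 * kappa) = kappa * (th ^+ 2 * H) + - th * H.
    by rewrite /th; field; rewrite gt_eqF.
  lra.
have hAB : A + B <= 2 * H + 2 * aV ^+ 2 * N.
  have -> : A + B = \sum_i sq (dt D i + gr D i).
    have -> : A + B = A + 2 * \sum_i ip (dt D i) (gr D i) + B.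
      by rewrite dt_grad_orthogonal// mulr0 addr0.
    rewrite mulr_sumr -!big_split/=; apply: eq_bigr => i _.
    by rewrite (ip_sqrD (sD _) (sD _)) mulr_natl.
  rewrite /H /N !mulr_sumr -big_split/=; apply: ler_sum => i _.
  have sv := LsqZ aV (sVbar i).
  have -> : dt D i + gr D i = force D i + (fun z => aV * component Vbar i z).
    by apply/funext => z; rewrite !fctE /dual_force; ring.
  have := ip_sqrD_le (sf i) sv; rewrite [X in _ + 2 * X]ipZl// ipZr//.
  by rewrite expr2 !mulrA.
have T1 : 0 < T ^+ 2 + 1 by rewrite ltr_wpDl ?sqr_ge0.
have k0' : kappa != 0 by rewrite gt_eqF.
have T1' : T ^+ 2 + 1 != 0 by rewrite gt_eqF.
(* The force yields a gain of [(A + B) / (8 kappa)]; this weight makes the linear terms of the cost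
   use up [A / (16 kappa)], half of the share of [A]. *)
pose e := (8 * kappa * (T ^+ 2 + 1))^-1.
have e0 : 0 < e by rewrite invr_gt0 !mulr_gt0.
have := cost_le sD e0; rewrite -/N -/A.
have -> : e * (T ^+ 2 + 1) / 2 = kappa^-1 / 16 by rewrite /e; field; apply/andP.
have -> : (2 * e)^-1 = 4 * kappa * (T ^+ 2 + 1) by rewrite /e; field; apply/andP.
rewrite /coercivity_const -/N.
have B0 : 0 <= B by apply: sumr_ge0 => i _; exact: ip_ge0.
have E4 : (4 * kappa)^-1 = kappa^-1 / 4 by rewrite invfM mulrC.
have E16 : (16 * kappa)^-1 = kappa^-1 / 16 by rewrite invfM mulrC.
move: hH; rewrite E4 E16.
have i0 : 0 <= kappa^-1 by rewrite invr_ge0 ltW.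
have := ler_wpM2r i0 hAB; have := mulr_ge0 B0 i0.
set k := kappa^-1; set S := _ * (_ + \sum_i sq (v0 i)); clearbody k S.
lra.
Qed.

End coercivity.

(** * Energy bound and convexity of superlevel sets *)

Section attainment.
Context (R : realType) (n : nat) (T aV : R).
Hypotheses (T_gt0 : 0 < T) (aV_gt0 : 0 < aV).

Local Notation X := (spacetime R n).
Local Notation tor := (torus R n).
Local Notation mu := (time_measure T \x torus R n)%E.
Local Notation Lsq f := (f \in Lfun mu 2%:E).
Local Notation ip := (ip mu).
Local Notation J := ('I_n * option 'I_n + option 'I_n)%type.
Implicit Types (D E : J -> X -> R) (W : 'I_n -> X -> R).

Let fin_mu := cylinder_fin T n.

Context (F Vbar : X -> 'rV[R]_n) (V0 : 'rV[R]_n -> 'rV[R]_n).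
Hypothesis sF : forall i, Lsq (component F i).
Hypothesis sVbar : forall i, Lsq (component Vbar i).
Hypothesis sV0 : forall i, component V0 i \in Lfun tor 2%:E.

Local Notation val := (dual_form T aV F Vbar V0).
Local Notation superlevel := (superlevel T aV F Vbar V0).
Local Notation v0 i := (component V0 i \o snd : X -> R).
Local Notation sq f := (ip f f).
Local Notation bound := (coercivity_const T aV F Vbar V0).

(** Each component is bounded by the same quantity, whence the multiple by the number of components:
    coercivity bounds [dt] and [gr], Poincare's inequality reduces [pr] to [gr], and the pointwise
    bound handles [sym]. *)
Lemma feasible_energy D a : feasible T D -> sym_bounded T (n%:R * aV) D ->
  superlevel a D -> energy mu D <=
    (16 * kappa n aV * (bound - a) + (n%:R * aV) ^+ 2 * T) *+ #|{: J}|.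
Proof.
move=> fD sC sup; have [sD _ _ gD mD] := fD.
have k0 : 0 < kappa n aV by exact: kappa_gt0.
have := coercive T_gt0 aV_gt0 sF sVbar sV0 fD sC sup.
set A := \sum_i sq (dt D i); set B := \sum_i sq (gr D i) => co.
have A0 i : sq (dt D i) <= A.
  by rewrite /A (bigD1 i)//= lerDl sumr_ge0// => j _; exact: ip_ge0.
have B0 i : sq (gr D i) <= B.
  by rewrite /B (bigD1 i)//= lerDl sumr_ge0// => j _; exact: ip_ge0.
have Age0 : 0 <= A by apply: sumr_ge0 => i _; exact: ip_ge0.
have Bge0 : 0 <= B by apply: sumr_ge0 => i _; exact: ip_ge0.
have AB : A + B <= 16 * kappa n aV * (bound - a).
  have k16 : 0 < 16 * kappa n aV by rewrite mulr_gt0.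
  by rewrite mulrC -ler_pdivrMr//; move: co; set q := _ / _; lra.
have s0 : 0 <= (n%:R * aV) ^+ 2 * T by rewrite mulr_ge0 ?sqr_ge0 ?ltW.
rewrite /energy -sumr_const; apply: ler_sum => -[[i [k|]]|[i|]] _.
- have : sq (sym D i k) <= (n%:R * aV) ^+ 2 * T.
    have -> : (n%:R * aV) ^+ 2 * T = \int[mu]_z cst ((n%:R * aV) ^+ 2) z.
      by rewrite Rintegral_cst// [X in fine X]cylinder_setT// ltW.
    apply: ae_le_Rintegral.
    + exact: (integrableM (sD _) (sD _)).
    + by have := Lsq_integrable fin_mu (Lsq_cst fin_mu ((n%:R * aV) ^+ 2)).
    + apply: filterS (sC i k) => z sz /=.
      by rewrite (le_trans (ler_norm _))// normrM expr2 ler_pM.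
  by rewrite -/(sym D i k); lra.
- by have := A0 i; rewrite /dt; lra.
- by have := B0 i; rewrite /gr; lra.
- have : sq (pr D) <= B.
    apply: (hart_poincare T_gt0 (sD _) (fun i => sD (inr (Some i)))).
      by move=> i; exact: wderiv_hart_deriv (sD _) (sD _) (gD i).
    (* A basis function without spatial frequency depends on time only, so its pairing with gamma
       vanishes by the mean condition. *)
    move=> K K0; rewrite -[RHS](mD _ (bmeas_cas T (K ord0))); congr ip.
    apply/funext => z; rewrite hart_tens tensE big1 ?mulr1// => i _.
    by rewrite K0 cas0.
  by rewrite /pr; lra.
Qed.

Definition dual_form_lin D W := \sum_i \sum_j \int[mu]_z (W i z * W j z * sym D i j z) +
  \sum_i (ip (dt D i) (W i) + ip (gr D i) (W i)) +
  \sum_i ip (prim T (dt D i)) (component F i) - \sum_i ip (dt D i) (v0 i).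

(** The part of the Lagrangian independent of the dual variable. It equals [aV / 2] times the
    squared distance from [W] to the base state, hence is nonnegative. *)
Definition val_cst W := \sum_i \sum_j 2^-1 * (aV * (i == j)%:R) * ip (W i) (W j) -
  \sum_i aV * ip (component Vbar i) (W i) +
  2^-1 * aV * (\sum_i sq (component Vbar i)).

Lemma valE D C W : (forall j, Lsq (D j)) -> sym_bounded T C D ->
  (forall i, Lsq (W i)) -> val D W = dual_form_lin D W + val_cst W.
Proof.
move=> sD sC sW; have I0 i j := integrableM (sW i) (sW j).
have Is i j : mu.-integrable setT (EFin \o (fun z => W i z * W j z * sym D i j z)).
  exact: integrableMb (I0 i j) (Lsq_measurable (sD _)) (sC i j).
have -> : val D W = \sum_i \sum_j (\int[mu]_z (W i z * W j z * sym D i j z) +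
    2^-1 * (aV * (i == j)%:R) * ip (W i) (W j)) +
    \sum_i (ip (dt D i) (W i) + ip (gr D i) (W i) - aV * ip (component Vbar i) (W i)) +
    dual_cost T aV F Vbar V0 D.
  rewrite /dual_form; congr (_ + _ + _); apply: eq_bigr => i _.
    apply: eq_bigr => j _.
    have -> : \int[mu]_z (W i z * W j z * sym D i j z) =
        2^-1 * \int[mu]_z (2 * (W i z * W j z * sym D i j z)).
      by rewrite RintegralZl// mulKf.
    rewrite -mulrA -mulrDr; congr (_ * _); rewrite /ip -RintegralZl// -RintegralD//.
    - by apply: eq_Rintegral => z _; ring.
    - exact: integrable_scale.
    - exact: integrable_scale.
  have sdg : Lsq (dt D i + gr D i) by apply: LsqD; exact: sD.
  have sv := LsqZ aV (sVbar i).
  rewrite ipC -ipDl//; [|exact: sD|exact: sD].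
  rewrite -ipZl// -ipBl//.
rewrite /dual_form_lin /val_cst /dual_cost.
have -> : \sum_i ip (component F i) (prim T (dt D i)) =
  \sum_i ip (prim T (dt D i)) (component F i) by apply: eq_bigr => i _; rewrite ipC.
under eq_bigr do rewrite big_split/=; rewrite big_split/= sumrB; ring.
Qed.

Lemma val_cst_ge0 W : (forall i, Lsq (W i)) -> 0 <= val_cst W.
Proof.
move=> sW; have -> : val_cst W = aV / 2 * \sum_i sq (W i - component Vbar i).
  have -> : \sum_i sq (W i - component Vbar i) = \sum_i (sq (W i) -
     2 * ip (component Vbar i) (W i) + sq (component Vbar i)).
    by apply: eq_bigr => i _; rewrite ip_sqrB// (ipC mu (W i) (component Vbar i)); ring.
  rewrite big_split/= sumrB -mulr_sumr /val_cst -mulr_sumr.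
  have -> : \sum_i \sum_j 2^-1 * (aV * (i == j)%:R) * ip (W i) (W j) =
      2^-1 * aV * \sum_i sq (W i).
    rewrite mulr_sumr; apply: eq_bigr => i _; rewrite (bigD1 i)//= eqxx mulr1 big1 ?addr0// => j.
    by rewrite eq_sym => /negbTE ->; rewrite !mulr0 mul0r.
  by field.
apply: mulr_ge0; first by rewrite divr_ge0// ltW.
by apply: sumr_ge0 => i _; exact: ip_ge0.
Qed.

Lemma ip_midpoint f g h : Lsq f -> Lsq g -> Lsq h ->
  ip (fun z => 2^-1 * (f z + g z)) h = 2^-1 * (ip f h + ip g h).
Proof. by move=> sf sg sh; rewrite -ipDl// -ipZl//; exact: LsqD. Qed.

Lemma ip_prim_midpoint f g h : Lsq f -> Lsq g -> Lsq h ->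
  ip (prim T (fun z => 2^-1 * (f z + g z))) h =
  2^-1 * (ip (prim T f) h + ip (prim T g) h).
Proof.
move=> sf sg sh; have sm : Lsq (fun z => 2^-1 * (f z + g z)).
  by have := LsqZ 2^-1 (LsqD sf sg).
have sp (k : X -> R) : Lsq k -> Lsq (prim T k) by move=> sk; exact: (prim_Lsq T_gt0 sk).1.
rewrite -ip_midpoint; [|exact: sp|exact: sp|exact: sh].
have spm : Lsq (fun z => 2^-1 * (prim T f z + prim T g z)).
  by have := LsqZ 2^-1 (LsqD (sp _ sf) (sp _ sg)).
apply: ip_ae; [exact: Lsq_measurable (sp _ sm)|exact: Lsq_measurable spm|exact: Lsq_measurable sh|].
have := prim_comb (2^-1) (2^-1) sf sg.
rewrite (_ : (fun z => 2^-1 * f z + 2^-1 * g z) = (fun z => 2^-1 * (f z + g z))).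
  by apply: filterS => z /[apply] ->; rewrite mulrDr.
by apply/funext => z; rewrite mulrDr.
Qed.

Lemma lam_of_Lsq D i : (forall j, Lsq (D j)) -> Lsq (component (lam_of T D) i).
Proof. by move=> sD; rewrite component_lam_of; exact: (prim_Lsq T_gt0 (sD _)).1. Qed.

Lemma feasible_midpoint D E : feasible T D -> feasible T E -> feasible T (midpoint D E).
Proof.
have scalar (a b c e f g : R) : 2^-1 * (a + b) = - f -> 2^-1 * (c + e) = - g ->
    2^-1 * (2^-1 * (a + c) + 2^-1 * (b + e)) = - (2^-1 * (f + g)) by lra.
move=> [sD dD yD gD mD] [sE dE yE gE mE].
have sM j : Lsq (midpoint D E j) by have := LsqZ 2^-1 (LsqD (sD j) (sE j)).
have sl K i := @lam_of_Lsq K i.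
have lM i h : Lsq h -> ip (component (lam_of T (midpoint D E)) i) h = 2^-1 *
    (ip (component (lam_of T D) i) h + ip (component (lam_of T E) i) h).
  by move=> sh; rewrite !component_lam_of; exact: ip_prim_midpoint (sD _) (sE _) sh.
split; first exact: sM.
- apply/div_free_ip => [i|phi tphi]; first exact: sl.
  have d1 := (div_free_ip (fun i => sl D i sD)).1 dD _ tphi.
  have d2 := (div_free_ip (fun i => sl E i sE)).1 dE _ tphi.
  under eq_bigr => i _ do rewrite (lM i _ (smooth_dLsq (dirx R i) tphi)).
  by rewrite -mulr_sumr big_split/= d1 d2 addr0 mulr0.
- move=> i j; apply/wsymgrad_ip => [k|phi tphi]; first exact: sl.
  have [sphi _ _] := tphi; have sp := smooth_Lsq T sphi.
  have d1 := (wsymgrad_ip i j _ (fun i => sl D i sD)).1 (yD i j) _ tphi.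
  have d2 := (wsymgrad_ip i j _ (fun i => sl E i sE)).1 (yE i j) _ tphi.
  rewrite !lM; [|exact: smooth_dLsq..].
  have -> : ip (sym (midpoint D E) i j) phi = 2^-1 * (ip (sym D i j) phi + ip (sym E i j) phi).
    exact: ip_midpoint (sD _) (sE _) sp.
  exact: scalar d1 d2.
- move=> i phi tphi; have [sphi _ _] := tphi; have sp := smooth_Lsq T sphi.
  have sd := smooth_dLsq (dirx R i) tphi.
  have d1 : ip (pr D) ('D_(dirx R i) phi) = - ip (gr D i) phi := gD i _ tphi.
  have d2 : ip (pr E) ('D_(dirx R i) phi) = - ip (gr E i) phi := gE i _ tphi.
  have e1 : ip (pr (midpoint D E)) ('D_(dirx R i) phi) = 2^-1 *
      (ip (pr D) ('D_(dirx R i) phi) + ip (pr E) ('D_(dirx R i) phi)).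
    exact: ip_midpoint (sD _) (sE _) sd.
  have e2 : ip (gr (midpoint D E) i) phi = 2^-1 * (ip (gr D i) phi + ip (gr E i) phi).
    exact: ip_midpoint (sD _) (sE _) sp.
  apply: etrans e1 _; rewrite d1 d2; apply: etrans (congr1 -%R (esym e2)).
  by rewrite -opprD mulrN.
- move=> b bb; have bx : bmeas (fun z : X => b z.1).
    by have [mb [C hC]] := bb; split; [exact: measurableT_comp mb measurable_fst|exists C => z].
  have -> : ip (pr (midpoint D E)) (fun z => b z.1) = 2^-1 *
     (ip (pr D) (fun z => b z.1) + ip (pr E) (fun z => b z.1)).
    exact: ip_midpoint (sD _) (sE _) (bmeas_Lsq fin_mu bx).
  by rewrite mD// mE// addr0 mulr0.
Qed.

Lemma sym_bounded_midpoint C D E : sym_bounded T C D -> sym_bounded T C E ->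
  sym_bounded T C (midpoint D E).
Proof.
move=> cD cE i j; apply: filterS2 (cD i j) (cE i j) => z.
rewrite /sym /midpoint !ler_norml => /andP[? ?] /andP[? ?]; apply/andP; split; lra.
Qed.

Lemma val_lin_midpoint C D E W : (forall j, Lsq (D j)) -> (forall j, Lsq (E j)) ->
  sym_bounded T C D -> sym_bounded T C E -> (forall i, Lsq (W i)) ->
  dual_form_lin (midpoint D E) W = 2^-1 * (dual_form_lin D W + dual_form_lin E W).
Proof.
move=> sD sE cD cE sW.
have Is K i j : (forall j, Lsq (K j)) -> sym_bounded T C K ->
    mu.-integrable setT (EFin \o (fun z => W i z * W j z * sym K i j z)).
  by move=> sK cK; exact: integrableMb (integrableM (sW i) (sW j)) (Lsq_measurable (sK _)) (cK i j).
rewrite /dual_form_lin.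
have -> : \sum_i \sum_j \int[mu]_z (W i z * W j z * sym (midpoint D E) i j z) =
    2^-1 * (\sum_i \sum_j \int[mu]_z (W i z * W j z * sym D i j z) +
      \sum_i \sum_j \int[mu]_z (W i z * W j z * sym E i j z)).
  rewrite -big_split/= mulr_sumr; apply: eq_bigr => i _.
  rewrite -big_split/= mulr_sumr; apply: eq_bigr => j _.
  have I1 := Is D i j sD cD; have I2 := Is E i j sE cE.
  rewrite -RintegralD// -RintegralZl//; last by have := integrableD measurableT I1 I2.
  by apply: eq_Rintegral => z _; rewrite /sym /midpoint; ring.
have -> : \sum_i (ip (dt (midpoint D E) i) (W i) + ip (gr (midpoint D E) i) (W i)) =
    2^-1 * (\sum_i (ip (dt D i) (W i) + ip (gr D i) (W i)) +
      \sum_i (ip (dt E i) (W i) + ip (gr E i) (W i))).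
  rewrite -big_split/= mulr_sumr; apply: eq_bigr => i _.
  rewrite (ip_midpoint (sD (inl (i, None))) (sE (inl (i, None))) (sW i)).
  rewrite (ip_midpoint (sD (inr (Some i))) (sE (inr (Some i))) (sW i)).
  by rewrite /dt /gr; ring.
have -> : \sum_i ip (prim T (dt (midpoint D E) i)) (component F i) =
    2^-1 * (\sum_i ip (prim T (dt D i)) (component F i) +
      \sum_i ip (prim T (dt E i)) (component F i)).
  rewrite -big_split/= mulr_sumr; apply: eq_bigr => i _.
  exact: ip_prim_midpoint (sD _) (sE _) (sF i).
have -> : \sum_i ip (dt (midpoint D E) i) (v0 i) =
    2^-1 * (\sum_i ip (dt D i) (v0 i) + \sum_i ip (dt E i) (v0 i)).
  rewrite -big_split/= mulr_sumr; apply: eq_bigr => i _.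
  exact: ip_midpoint (sD _) (sE _) (v0_Lsq T sV0 i).
ring.
Qed.

Lemma superlevel_midpoint C a D E : (forall j, Lsq (D j)) -> (forall j, Lsq (E j)) ->
  sym_bounded T C D -> sym_bounded T C E -> superlevel a D -> superlevel a E ->
  superlevel a (midpoint D E).
Proof.
move=> sD sE cD cE aD aE W sW.
have sM j : Lsq (midpoint D E j) by have := LsqZ 2^-1 (LsqD (sD j) (sE j)).
rewrite (valE sM (sym_bounded_midpoint cD cE) sW) (val_lin_midpoint sD sE cD cE sW).
have := aD _ sW; have := aE _ sW; rewrite (valE sD cD sW) (valE sE cE sW); lra.
Qed.

End attainment.

(** * Existence of a maximizer *)

Section existence.
Context (R : realType) (n : nat) (T aV : R).
Hypotheses (T_gt0 : 0 < T) (aV_gt0 : 0 < aV).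

Local Notation X := (spacetime R n).
Local Notation tor := (torus R n).
Local Notation mu := (time_measure T \x torus R n)%E.
Local Notation Lsq f := (f \in Lfun mu 2%:E).
Local Notation ip := (ip mu).
Local Notation J := ('I_n * option 'I_n + option 'I_n)%type.
Implicit Types (D E : J -> X -> R) (W : 'I_n -> X -> R).

Let fin_mu := cylinder_fin T n.

Context (F Vbar : X -> 'rV[R]_n) (V0 : 'rV[R]_n -> 'rV[R]_n).
Hypothesis sF : forall i, Lsq (component F i).
Hypothesis sVbar : forall i, Lsq (component Vbar i).
Hypothesis sV0 : forall i, component V0 i \in Lfun tor 2%:E.

Local Notation val := (dual_form T aV F Vbar V0).
Local Notation val_lin := (dual_form_lin T F V0).
Local Notation superlevel := (superlevel T aV F Vbar V0).
Local Notation v0 i := (component V0 i \o snd : X -> R).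
Local Notation bound := (coercivity_const T aV F Vbar V0).
Local Notation value := (dual_value T aV V0 F Vbar).
Local Notation L := (lagrangian T aV V0 F Vbar).

Section limit.
Variables (Dn : nat -> J -> X -> R) (E : J -> X -> R).
Hypotheses (sDn : forall k j, Lsq (Dn k j)) (sE : forall j, Lsq (E j)).
Hypothesis cv : forall j, L2cvg mu (Dn^~ j) (E j).

Lemma feasible_limit : (forall k, feasible T (Dn k)) -> feasible T E.
Proof.
move=> fD.
have cp i : L2cvg mu (fun k => component (lam_of T (Dn k)) i) (component (lam_of T E) i).
  rewrite component_lam_of; under eq_fun do rewrite component_lam_of.
  exact: (prim_L2cvg T_gt0 (sDn ^~ _) (sE _) (cv _)).
have sp k i := @lam_of_Lsq _ _ _ T_gt0 (Dn k) i (sDn k).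
have sp' i := @lam_of_Lsq _ _ _ T_gt0 E i sE.
split; first exact: sE.
- exact: (L2cvg_div_free sp sp' cp (fun k => feasible_div (fD k))).
- move=> i j.
  exact: (L2cvg_wsymgrad sp sp' (sDn ^~ _) (sE _) cp (cv _) (fun k => feasible_sym (fD k) i j)).
- move=> i.
  exact: (L2cvg_wderiv (sDn ^~ _) (sE _) (sDn ^~ _) (sE _) (cv _) (cv _)
    (fun k => feasible_grad (fD k) i)).
- move=> b bb; have bx : bmeas (fun z : X => b z.1).
    by have [mb [C hC]] := bb; split; [exact: measurableT_comp mb measurable_fst|exists C => z].
  have c := cvg_ipl (sDn ^~ (inr None)) (sE _) (bmeas_Lsq fin_mu bx) (cv (inr None)).
  rewrite -[LHS](cvg_lim (@Rhausdorff R) c); apply: cvg_lim => //.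
  by apply: cvg_near_cst; apply: nearW => k; exact: (feasible_mean (fD k) bb).
Qed.

Lemma val_lin_limit C W : (forall k, sym_bounded T C (Dn k)) -> (forall i, Lsq (W i)) ->
  val_lin (Dn k) W @[k --> \oo] --> val_lin E W.
Proof.
move=> cD sW.
have c1 : \sum_i \sum_j \int[mu]_z (W i z * W j z * sym (Dn k) i j z) @[k --> \oo] -->
    \sum_i \sum_j \int[mu]_z (W i z * W j z * sym E i j z).
  apply: cvg_bigsum => i; apply: cvg_bigsum => j.
  exact: (L2cvg_mul_integrable fin_mu (sDn ^~ _) (sE _) (cv _) (fun k => cD k i j)
    (integrableM (sW i) (sW j))).
have c2 : \sum_i (ip (dt (Dn k) i) (W i) + ip (gr (Dn k) i) (W i)) @[k --> \oo] -->
    \sum_i (ip (dt E i) (W i) + ip (gr E i) (W i)).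
  apply: cvg_bigsum => i; apply: cvgD.
    exact: (cvg_ipl (sDn ^~ _) (sE _) (sW i) (cv _)).
  exact: (cvg_ipl (sDn ^~ _) (sE _) (sW i) (cv _)).
have c3 : \sum_i ip (prim T (dt (Dn k) i)) (component F i) @[k --> \oo] -->
    \sum_i ip (prim T (dt E i)) (component F i).
  apply: cvg_bigsum => i.
  exact: (cvg_ipl (fun k => (prim_Lsq T_gt0 (sDn k _)).1) (prim_Lsq T_gt0 (sE _)).1 (sF i)
    (prim_L2cvg T_gt0 (sDn ^~ _) (sE _) (cv _))).
have c4 : \sum_i ip (dt (Dn k) i) (v0 i) @[k --> \oo] --> \sum_i ip (dt E i) (v0 i).
  apply: cvg_bigsum => i.
  exact: (cvg_ipl (sDn ^~ _) (sE _) (v0_Lsq T sV0 i) (cv _)).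
exact: cvgB (cvgD (cvgD c1 c2) c3) c4.
Qed.

End limit.

(** Replaces the extended-real infimum by a family of real inequalities, one for each [W], each of
    which can be passed to the limit separately. *)
Lemma le_dual_value D p a :
  (forall V, vL2 T V -> L p V = val D (component V)) ->
  (a%:E <= value p)%E <-> superlevel a D.
Proof.
move=> LE; split=> [le W sW|sup].
  pose V : X -> 'rV[R]_n := fun z => \row_i W i z.
  have VW : component V = W by apply/funext => i; apply/funext => z; rewrite /component mxE.
  have sV : vL2 T V by move=> i; rewrite VW; exact: sW.
  rewrite -lee_fin (le_trans le)//; apply: ereal_inf_lbound; exists V => //.
  by rewrite LE// VW.
by apply/ereal_infP => _ [V sV <-]; rewrite lee_fin LE//; exact: sup.
Qed.

(** Coercivity bounds every real level lying below the value; an infinite value would admit the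
    level [bound + 1]. *)
Lemma dual_value_le p : dual_class T p -> (value p <= bound%:E)%E.
Proof.
move=> /(dual_class_feasible aV T_gt0 sF sVbar sV0)[D [C [fD sC LE]]].
have sup_le a : superlevel a D -> a <= bound.
  move=> sup; have sB := superlevel_sym_bounded T_gt0 sVbar fD sC sup.
  have := coercive T_gt0 aV_gt0 sF sVbar sV0 fD sB sup; apply: le_trans.
  have k0 : 0 < kappa n aV by exact: kappa_gt0.
  have k16 : 0 <= 16 * kappa n aV by apply: mulr_ge0 => //; exact: ltW.
  rewrite lerDl divr_ge0//.
  by apply: addr_ge0; apply: sumr_ge0 => i _; exact: ip_ge0.
case E : (value p) => [r| |]; rewrite ?leNye//.
  by rewrite lee_fin; apply: sup_le; apply/(le_dual_value _ LE); rewrite E.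
have : bound + 1 <= bound by apply: sup_le; apply/(le_dual_value _ LE); rewrite E leey.
by rewrite gerDl ler10.
Qed.

(** At the zero dual variable the Lagrangian reduces to [val_cst], which is nonnegative. This keeps
    the supremum away from minus infinity. *)
Lemma dual_value_ge0 : exists2 p, dual_class T p & (0 <= value p)%E.
Proof.
pose D : J -> X -> R := fun=> cst 0.
have z0 (g h : X -> R) : g = (fun=> 0) -> ip g h = 0.
  move=> ->; rewrite /ip; under eq_Rintegral do rewrite mul0r.
  by rewrite Rintegral_cst// mul0r.
have p0 i : prim T (dt D i) = fun=> 0.
  apply/funext => z; rewrite /prim; under eq_Rintegral do rewrite mulr0.
  by rewrite Rintegral_cst// mul0r oppr0.
have sD j : Lsq (D j) by exact: Lsq0.
have sl i := @lam_of_Lsq _ _ _ T_gt0 D i sD.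
have l0 i h : ip (component (lam_of T D) i) h = 0.
  by rewrite component_lam_of; apply: z0; exact: p0.
have fD : feasible T D.
  split; first exact: sD.
  - by apply/div_free_ip => // phi _; rewrite big1.
  - move=> i j; apply/wsymgrad_ip => // phi _; rewrite !l0 addr0 mulr0.
    by rewrite [ip _ _]z0 ?oppr0.
  - move=> i phi _; apply: (etrans (z0 _ _ erefl)); apply/esym/eqP.
    by rewrite oppr_eq0; apply/eqP; exact: (z0 _ phi erefl).
  - by move=> b _; exact: z0.
have sC : sym_bounded T 0 D by move=> i j; apply: aeW => z; rewrite normr0.
have [pD LE] := feasible_dual_class aV T_gt0 sF sVbar sV0 fD sC.
exists (lam_of T D, pr D) => //; apply/(le_dual_value _ LE) => W sW.
rewrite (valE aV F V0 sVbar sD sC sW) (_ : val_lin D W = 0).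
  by rewrite add0r; exact: val_cst_ge0.
rewrite /dual_form_lin.
have -> : \sum_i ip (dt D i) (v0 i) = 0 by apply: big1 => i _; exact: z0.
have -> : \sum_i ip (prim T (dt D i)) (component F i) = 0.
  by apply: big1 => i _; apply: z0; exact: p0.
have -> : \sum_i (ip (dt D i) (W i) + ip (gr D i) (W i)) = 0.
  by apply: big1 => i _; exact: etrans (congr2 +%R (z0 _ _ erefl) (z0 _ _ erefl)) (addr0 0).
rewrite big1 ?subr0 ?addr0// => i _; rewrite big1// => j _.
by under eq_Rintegral do rewrite mulrC; exact: z0.
Qed.

Lemma dual_attained : exists p, dual_class T p /\ value p = J_E T aV V0 F Vbar.
Proof.
have [q dq q0] := dual_value_ge0.
have ge0 : (0 <= J_E T aV V0 F Vbar)%E.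
  by apply: le_trans q0 _; apply: ereal_sup_ubound; exists q.
have leB : (J_E T aV V0 F Vbar <= bound%:E)%E.
  by apply/ereal_supP => _ [p dp <-]; exact: dual_value_le.
have [m Em] : exists m, J_E T aV V0 F Vbar = m%:E.
  exists (fine (J_E T aV V0 F Vbar)); rewrite fineK// fin_numE.
  by rewrite gt_eqF ?(lt_le_trans _ ge0) ?ltNy0// lt_eqF// (le_lt_trans leB) ?ltry.
have h0 k : 0 < k.+1%:R^-1 :> R by rewrite invr_gt0.
(* The bound [n aV] is common to all levels, so these sets are nested and the symmetric gradients of
   a sequence drawn from them are uniformly bounded. *)
pose K k : set (J -> X -> R) := [set D | [/\ feasible T D,
  sym_bounded T (n%:R * aV) D & superlevel (m - k.+1%:R^-1) D]].
have K0 k : K k !=set0.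
  have [|_ [p dp <-] lt] := ub_ereal_sup_adherent (S := [set value p | p in dual_class T]) (h0 k).
    by rewrite -/(J_E T aV V0 F Vbar) Em.
  have [D [C [fD sC LE]]] := dual_class_feasible aV T_gt0 sF sVbar sV0 dp.
  have sup : superlevel (m - k.+1%:R^-1) D.
    by apply/(le_dual_value _ LE); rewrite ltW// EFinB -Em.
  exists D; split => //.
  exact: (superlevel_sym_bounded T_gt0 sVbar fD sC sup).
have Kmono k l : (k <= l)%N -> K l `<=` K k.
  move=> kl D [fD sD sup]; split => // W sW; apply: le_trans (sup _ sW).
  by rewrite lerD2l lerN2 lef_pV2 ?posrE// ler_nat ltnS.
have Kmid k D E : K k D -> K k E -> K k (midpoint D E).
  move=> [fD cD uD] [fE cE uE]; split.
  - exact: feasible_midpoint.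
  - exact: sym_bounded_midpoint.
  - exact: (superlevel_midpoint T_gt0 sF sVbar sV0 (feasible_Lsq fD) (feasible_Lsq fE) cD cE uD uE).
have [Dn [E [KDn cvE]]] := midpoint_convex_cvg fin_mu K0 Kmono
  (fun D KD => let: And3 fD _ _ := KD in feasible_Lsq fD) Kmid
  (fun D KD => let: And3 fD cD uD := KD in
     feasible_energy T_gt0 aV_gt0 sF sVbar sV0 fD cD uD).
have fDn k : feasible T (Dn k) by have [] := KDn k.
have cDn k : sym_bounded T (n%:R * aV) (Dn k) by have [] := KDn k.
have sDn k j := feasible_Lsq (fDn k) j.
have sE j := (cvE j).1; have cv j := (cvE j).2.
have fE := feasible_limit sDn sE cv fDn.
have cE : sym_bounded T (n%:R * aV) E.
  move=> i j; exact: (L2cvg_ae_norm_le fin_mu (sDn ^~ _) (sE _) (cv _) (fun k => cDn k i j)).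
have [pE LE] := feasible_dual_class aV T_gt0 sF sVbar sV0 fE cE.
exists (lam_of T E, pr E); split => //.
apply/eqP; rewrite eq_le; apply/andP; split.
  by apply: ereal_sup_ubound; exists (lam_of T E, pr E).
rewrite Em; apply/(le_dual_value _ LE) => W sW.
rewrite (valE aV F V0 sVbar sE cE sW).
have c := val_lin_limit sDn sE cv cDn sW.
(* The limit is taken for a fixed [W], after the constant part has been moved to the other side; the
   infimum over [W] comes only afterwards. *)
have c2 : m - k.+1%:R^-1 - val_cst T aV Vbar W @[k --> \oo] --> m - 0 - val_cst T aV Vbar W.
  apply: cvgB; last exact: cvg_cst.
  by apply: cvgB; [exact: cvg_cst|exact: cvg_harmonic].
have : m - 0 - val_cst T aV Vbar W <= val_lin E W.
  apply: (ler_cvg_to c2 c); apply: nearW => k.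
  have [_ _ uk] := KDn k; have := uk _ sW.
  by rewrite (valE aV F V0 sVbar (sDn k) (cDn k) sW) => h; rewrite lerBlDr.
by rewrite subr0 lerBlDr.
Qed.

End existence.

Theorem theorem3p1 (R : realType) (d : nat) (hd : d = 2%N \/ d = 3%N)
  (T aV : R) (hT : 0 < T) (haV : 0 < aV)
  (V0 : 'rV[R]_d -> 'rV[R]_d)
  (hV0 : forall i, component V0 i \in Lfun (torus R d) 2%:E)
  (hV0div : torus_div_free V0)
  (hV0mean : forall i, \int[torus R d]_x V0 x 0 i = 0)
  (F Vbar : spacetime R d -> 'rV[R]_d)
  (hF : vL2 T F) (hVbar : vL2 T Vbar) :
  exists p : (spacetime R d -> 'rV[R]_d) * (spacetime R d -> R),
    dual_class T p /\
    dual_value T aV V0 F Vbar p = J_E T aV V0 F Vbar.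
Proof. exact: (dual_attained hT haV hF hVbar hV0). Qed.
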